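(* Let $G_1=(V_1,\mathcal E_1)$ be a finite connected oriented graph with distinguished vertices $a_1,b_1$ such that $d_1(a_1,b_1)>1$ and there exist at least two edge-disjoint paths connecting $a_1$ to $b_1$ in $G_1$. Let $p_\star$ be the unique fixed point of $f_1$ in $(0,1)$, $\zeta=f_1'(p_\star)>1$, $\nu=\log_\zeta d_1(a_1,b_1)$, $d_f$ the dimension of the critical cluster, $\alpha_1=\log(|\mathcal E_1|/d_f)/\log d_1(a_1,b_1)$, and $\theta(p)=\mathrm E[\theta^{\bar G_\infty}(p)]$, where $\bar G_\infty$ is the Benjamini–Schramm limit of the hierarchical graphs with seed $G_1$ and $\mathrm E$ is the expectation over $\bar G_\infty$. Then there exists $c>0$ such that, for all $p\in(p_\star,1)$, $$c^{-1}(p-p_\star)^\beta\le\theta(p)\le c\,(p-p_\star)^\beta,$$ where $$\beta=\log_\zeta\frac{|\mathcal E_1|}{d_f}=\alpha_1\nu .$$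
   Context: $G_1=(V_1,\mathcal E_1)$ is a finite connected oriented graph (a finite simple graph with an orientation chosen for each edge), with two distinguished vertices $a_1,b_1$. An edge $e$ is written $e=(e_-,e_+)$. Distances, paths and connectivity ignore orientation; $d_1$ is the graph distance in $G_1$. Hierarchical graphs: $G_0$ is a single oriented edge $(a_0,b_0)$. Given $G_k=(V_k,\mathcal E_k)$ with distinguished vertices $a_k,b_k$, $G_{k+1}$ is obtained by replacing each oriented edge $(x,y)\in\mathcal E_k$ by a fresh copy of $G_1$, with $a_1$ identified with $x$ and $b_1$ with $y$; $a_{k+1},b_{k+1}$ are the vertices that were $a_k,b_k$. Percolation on $G_k$: under $\mathbb P^k_p$ each edge of $G_k$ is independently open with probability $p$. $f_1(p)=\mathbb P^1_p(a_1\leftrightarrow b_1)$; under the stated hypothesis $f_1$ has exactly one fixed point $p_\star$ in $(0,1)$ and $f_1'(p_\star)>1$. The constant $d_f$: it is the largest (Perron–Frobenius) eigenvalue of the $3\times3$ matrix $M(p_\star)$, where $M(p)=\sum_{e'\in\mathcal E_1}M^{e'}(p)$ and, writing $\mathbb P^{1,e'}_p$ for percolation on $G_1$ with edge $e'$ removed and $S_1=\{e'_-\}$, $S_2=\{e'_+\}$, $S_3=\{e'_-,e'_+\}$, the entries are $M^{e'}_{1j}=\mathbb P^{1,e'}_p(S_j\leftrightarrow a_1,\ S_j\not\leftrightarrow b_1)$, $M^{e'}_{2j}=\mathbb P^{1,e'}_p(S_j\not\leftrightarrow a_1,\ S_j\leftrightarrow b_1)$, $M^{e'}_{3j}=\mathbb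 P^{1,e'}_p(S_j\leftrightarrow a_1,\ S_j\leftrightarrow b_1)$. (A set is connected to a vertex if at least one of its elements is.) Equivalently, $d_f$ is the unique positive number such that $\mathbb E^k_{p_\star}[|\mathcal C_{\{a_k,b_k\}}|]/d_f^k$ is bounded above and below by positive constants uniformly in $k$, where $\mathcal C_{\{a_k,b_k\}}$ is the set of edges of $G_k$ having at least one endvertex connected by an open path (possibly of length zero) to $a_k$ or $b_k$. Benjamini–Schramm limit: let $\mathcal G$ be the space of connected, locally finite edge-rooted graphs (orientations forgotten) up to root-preserving isomorphism, with metric $d(\bar G,\bar G')=\inf\{1/(r+1):\bar G|_r\cong\bar G'|_r\}$, where $\bar G|_r$ is the rooted subgraph induced by vertices within distance $r$ of an endpoint of the root edge. With $E_k$ uniform in $\mathcal E_k$, the random elements $(G_k,E_k)$ converge in distribution in $\mathcal G$; the limit is the random edge-rooted infinite graph $\bar G_\infty=(G_\infty,E_\infty)$. Percolation on $\bar G_\infty$: given $\bar G_\infty$, each edge of $G_\infty$ is independently open with probability $p$ under $\mathbf P_p^{\bar G_\infty}$; $\theta^{\bar G_\infty}(p)=\mathbf P_p^{\bar G_\infty}(E_\infty\leftrightarrow\infty)$ is the probability that some endpoint of $E_\infty$ lies in an infinite open cluster. *)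

(* Defs.v *)
From HB Require Import structures.
From mathcomp Require Import all_boot all_order all_algebra.
From mathcomp Require Import all_classical all_reals all_analysis.
From mathcomp Require Import measurable_realfun ring lra.

Set Implicit Arguments.
Unset Strict Implicit.
Unset Printing Implicit Defensive.

Import Order.TTheory GRing.Theory Num.Theory.
Import numFieldNormedType.Exports.

Local Open Scope ring_scope.

Definition link (V : finType) (w : {set V * V}) : rel V :=
  fun x y => ((x, y) \in w) || ((y, x) \in w).

Lemma link_sym (V : finType) (w : {set V * V}) : symmetric (link w).
Proof. by move=> x y; rewrite /link orbC. Qed.

(* A simple graph in which each edge carries an orientation: no loop, and at
   most one of (x, y) and (y, x) is an edge. *)
Record ograph := OGraph {
  vertex : finType ;
  edges : {set vertex * vertex} ;
  src : vertex ;
  tgt : vertex ;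
  edges_irr : forall x, (x, x) \notin edges ;
  edges_asym : forall x y, (x, y) \in edges -> (y, x) \notin edges ;
  src_neq_tgt : src != tgt ;
  ograph_connected : forall x y, connect (link edges) x y }.

Definition edge (G : ograph) := {e : vertex G * vertex G | e \in edges G}.

Definition walk (G : ograph) (n : nat) (x y : vertex G) : bool :=
  [exists s : n.-tuple (vertex G), path (link (edges G)) x s && (last x s == y)].

Lemma ex_walk (G : ograph) (x y : vertex G) : exists n, walk n x y.
Proof.
have /connectP[s ps ->] := ograph_connected x y.
by exists (size s); apply/existsP; exists (in_tuple s); rewrite ps eqxx.
Qed.

Definition gdist (G : ograph) (x y : vertex G) : nat := ex_minn (ex_walk x y).

Definition steps (T : Type) (x : T) (s : seq T) : seq (T * T) := zip (x :: s) s.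

Definition is_path (G : ograph) (x y : vertex G) (s : seq (vertex G)) : Prop :=
  [/\ path (link (edges G)) x s, uniq (x :: s) & last x s = y].

Definition edge_disjoint_paths (G : ograph) (x y : vertex G) : Prop :=
  exists s t, [/\ is_path x y s, is_path x y t &
    forall u v, (u, v) \in steps x s ->
      (u, v) \notin steps x t /\ (v, u) \notin steps x t].

Section Single.

Let E : {set bool * bool} := [set (false, true)].

Let E_irr x : (x, x) \notin E. Proof. by case: x; rewrite inE. Qed.

Let E_asym x y : (x, y) \in E -> (y, x) \notin E.
Proof. by case: x y => [] []; rewrite !inE. Qed.

Let E_connected x y : connect (link E) x y.
Proof.
case: (eqVneq x y) => [->|]; first exact: connect0.
by case: x y => [] []// _; apply: connect1; rewrite /link !inE.
Qed.

Definition single_edge : ograph :=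
  @OGraph bool E false true E_irr E_asym isT E_connected.

End Single.

Section Subst.
Variables G H : ograph.

(* The vertices of G, and one copy per edge of G of the vertices of H other
   than the two that are identified with the endpoints of that edge. *)
Definition subst_vertex : finType :=
  (vertex G +
   (edge G * {v : vertex H | (v != src H) && (v != tgt H)}))%type.

Definition copy (e : edge G) (v : vertex H) : subst_vertex :=
  if insub v is Some v' then inr (e, v')
  else if v == src H then inl (val e).1 else inl (val e).2.

Definition subst_edges : {set subst_vertex * subst_vertex} :=
  [set (copy e f.1, copy e f.2) | e in [set: edge G], f in edges H].

Lemma copy_src e : copy e (src H) = inl (val e).1.
Proof. by rewrite /copy insubF ?eqxx. Qed.

Lemma copy_tgt e : copy e (tgt H) = inl (val e).2.
Proof.
by rewrite /copy insubF ?eqxx ?andbF// eq_sym (negbTE (src_neq_tgt H)).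
Qed.

Lemma edge_neq (e : edge G) : (val e).1 != (val e).2.
Proof.
case: e => [[x y] /= h]; apply/eqP => xy; move: h; rewrite xy.
by apply/negP; exact: edges_irr.
Qed.

Variant copy_spec (e : edge G) (v : vertex H) : subst_vertex -> Type :=
  | CopyIn v' of val v' = v : copy_spec e v (inr (e, v'))
  | CopySrc of v = src H : copy_spec e v (inl (val e).1)
  | CopyTgt of v = tgt H : copy_spec e v (inl (val e).2).

Lemma copyP e v : copy_spec e v (copy e v).
Proof.
rewrite /copy; case: insubP => [v' _ vv'|]; first exact: CopyIn.
rewrite negb_and !negbK; case: eqP => [->|_ /= /eqP ->]; first by move=> _; exact: CopySrc.
exact: CopyTgt.
Qed.

Lemma copy_inj e : injective (copy e).
Proof.
have ne := edge_neq e; have ne' : (val e).2 != (val e).1 by rewrite eq_sym.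
move=> u v; case: (copyP e u) => [u' <-|->|->]; case: (copyP e v) => [v' <-|->|->]//.
- by case=> ->.
- by case=> /eqP; rewrite (negbTE ne).
- by case=> /eqP; rewrite (negbTE ne').
Qed.

Lemma subst_irr x : (x, x) \notin subst_edges.
Proof.
apply/negP => /imset2P[e [u v] _ /= uv [-> /copy_inj uv']].
by move: uv; rewrite uv'; apply/negP; exact: edges_irr.
Qed.

Lemma copy_overlap e e' u v : copy e u = copy e' v -> e != e' ->
  (u = src H /\ (val e).1 \in [:: (val e').1; (val e').2]) \/
  (u = tgt H /\ (val e).2 \in [:: (val e').1; (val e').2]).
Proof.
case: (copyP e u) => [u' _|->|->]; case: (copyP e' v) => [v' _|_|_] //.
- by case=> ->; rewrite eqxx.
- by case=> -> _; left; rewrite !inE eqxx.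
- by case=> -> _; left; rewrite !inE eqxx orbT.
- by case=> -> _; right; rewrite !inE eqxx.
- by case=> -> _; right; rewrite !inE eqxx orbT.
Qed.

Lemma subst_asym x y : (x, y) \in subst_edges -> (y, x) \notin subst_edges.
Proof.
move=> /imset2P[e [u v] _ /= uv [-> ->]].
apply/negP => /imset2P[e' [v' u'] _ /= vu' [ev eu]].
suff ee : e = e'.
  move: ev eu vu'; rewrite -ee => /copy_inj <- /copy_inj <-.
  by apply/negP; exact: edges_asym.
have nuv : u != v.
  by apply/eqP => uv'; move: uv; rewrite uv'; apply/negP; exact: edges_irr.
case: (eqVneq e e') => [//|nee]; exfalso.
have [e1 e2] : (val e).1 \in [:: (val e').1; (val e').2] /\
    (val e).2 \in [:: (val e').1; (val e').2].
  case: (copy_overlap eu nee) (copy_overlap ev nee) nuv => -[-> ?] [] [-> ?];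
    by rewrite ?eqxx.
have key (p q : vertex G * vertex G) : p.1 \in [:: q.1; q.2] ->
    p.2 \in [:: q.1; q.2] -> p.1 != p.2 -> p \in edges G -> q \in edges G ->
    p = q.
  case: p q => [a b] [a' b'] /=; rewrite !inE.
  move=> /orP[]/eqP -> /orP[]/eqP ->; rewrite ?eqxx// => _.
  by move=> /edges_asym/negP.
move: nee => /eqP; apply; apply: val_inj.
exact: key e1 e2 (edge_neq e) (valP e) (valP e').
Qed.

Lemma link_copy e u v :
  link (edges H) u v -> link subst_edges (copy e u) (copy e v).
Proof.
case/orP => h; apply/orP.
  by left; apply/imset2P; exists e (u, v).
by right; apply/imset2P; exists e (v, u).
Qed.

Lemma connect_copy e u v : connect (link subst_edges) (copy e u) (copy e v).
Proof.
have /connectP[s] := ograph_connected u v.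
elim: s u => [u _ ->|w s ih u /= /andP[uw ps] lv]; first exact: connect0.
by apply: connect_trans (ih _ ps lv); apply: connect1; exact: link_copy.
Qed.

Lemma subst_connected x y : connect (link subst_edges) x y.
Proof.
have csym : connect_sym (link subst_edges).
  by apply: sym_connect_sym; exact: link_sym.
have inl_inl (x' y' : vertex G) : connect (link subst_edges) (inl x') (inl y').
  have /connectP[s] := ograph_connected x' y'.
  elim: s x' => [u _ ->|w s ih u /= /andP[uw ps] lv]; first exact: connect0.
  apply: connect_trans (ih _ ps lv); case/orP: uw => h.
    have := connect_copy (exist _ (u, w) h) (src H) (tgt H).
    by rewrite copy_src copy_tgt.
  have := connect_copy (exist _ (w, u) h) (tgt H) (src H).
  by rewrite copy_src copy_tgt.
have to_inl z : exists z', connect (link subst_edges) z (inl z').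
  case: z => [z|[e v]]; first by exists z; exact: connect0.
  exists (val e).1; have := connect_copy e (val v) (src H).
  by rewrite copy_src /copy valK.
have [x' xx'] := to_inl x; have [y' yy'] := to_inl y.
apply: connect_trans xx' _; apply: connect_trans (inl_inl _ y') _.
by rewrite csym.
Qed.

Let subst_neq : (inl (src G) : subst_vertex) != inl (tgt G).
Proof. by apply: contra (src_neq_tgt G) => /eqP[->]. Qed.

Definition subst : ograph :=
  OGraph subst_irr subst_asym subst_neq subst_connected.

End Subst.

Definition hier (G1 : ograph) (k : nat) : ograph :=
  iter k (fun G => subst G G1) single_edge.

Section FinitePercolation.
Variable R : realType.

(* Probability of the event A when each edge of F is independently open with
   probability p; w is the set of open edges. *)
Definition perc_prob (V : finType) (p : R) (F : {set V * V})
    (A : pred {set V * V}) : R :=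
  \sum_(w in powerset F | A w) p ^+ #|w| * (1 - p) ^+ #|F :\: w|.

Definition reaches (V : finType) (w : {set V * V}) (S : {set V}) (x : V) : bool :=
  [exists s in S, connect (link w) s x].

Definition crossing (G : ograph) (p : R) : R :=
  perc_prob p (edges G) (fun w => connect (link w) (src G) (tgt G)).

Definition end_set (V : finType) (e : V * V) (j : 'I_3) : {set V} :=
  nth finset.set0 [:: [set e.1]; [set e.2]; [set e.1; e.2]] j.

Definition reach_type (G : ograph) (w : {set vertex G * vertex G})
    (S : {set vertex G}) (i : 'I_3) : bool :=
  let ra := reaches w S (src G) in
  let rb := reaches w S (tgt G) in
  nth false [:: ra && ~~ rb; ~~ ra && rb; ra && rb] i.

Definition cluster_matrix (G : ograph) (p : R) : 'M[R]_3 :=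
  \sum_(e in edges G) \matrix_(i, j)
    perc_prob p (edges G :\ e) (fun w => reach_type w (end_set e j) i).

(* The spectrum is finite, so this is a maximum as soon as there is a real
   eigenvalue; for the nonnegative matrices above it is the Perron-Frobenius
   eigenvalue. *)
Definition largest_eigenvalue n (M : 'M[R]_n) : R :=
  sup [set x | eigenvalue M x]%classic.

Definition logb (b x : R) : R := ln x / ln b.

End FinitePercolation.

Local Open Scope classical_set_scope.

(* A connected, locally finite graph is countable, so its vertices can be taken
   in nat. The root edge is recorded as a pair but its orientation is ignored
   by ball_iso below. *)
Record egraph := EGraph {
  evert : nat -> bool ;
  eadj : nat -> nat -> bool ;
  eroot : nat * nat ;
  eadj_vert : forall x y, eadj x y -> evert x ;
  eadj_sym : symmetric eadj ;
  eadj_irr : irreflexive eadj ;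
  eroot_adj : eadj eroot.1 eroot.2 ;
  eadj_fin : forall x, finite_set [set y | eadj x y] ;
  egraph_connected : forall x y, evert x -> evert y ->
    exists2 s, path eadj x s & last x s = y }.

Section OfFinite.
Variables (G : ograph) (e : edge G).

Let V : pred nat := fun m => (m < #|vertex G|)%N.

Let adj : rel nat := fun m n =>
  [exists x, exists y, [&& link (edges G) x y, enum_rank x == m :> nat
                         & enum_rank y == n :> nat]].

Let root : nat * nat :=
  (enum_rank (val e).1 : nat, enum_rank (val e).2 : nat).

Let adjP m n : reflect (exists x y, [/\ link (edges G) x y,
  enum_rank x = m :> nat & enum_rank y = n :> nat]) (adj m n).
Proof.
apply: (iffP existsP) => [[x /existsP[y /and3P[? /eqP ? /eqP ?]]]|].
  by exists x, y.
by move=> [x [y [? ? ?]]]; exists x; apply/existsP; exists y; apply/and3P; split=> //; exact/eqP.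
Qed.

Let adj_vert m n : adj m n -> V m.
Proof. by move/adjP => [x [y [_ <- _]]]; exact: ltn_ord. Qed.

Let adj_sym : symmetric adj.
Proof.
suff H m n : adj m n -> adj n m by move=> m n; apply/idP/idP; exact: H.
by move=> /adjP[x [y [? ? ?]]]; apply/adjP; exists y, x; rewrite link_sym.
Qed.

Let adj_irr : irreflexive adj.
Proof.
move=> m; apply/negbTE/negP => /adjP[x [y [h <- /val_inj/enum_rank_inj xy]]].
by move: h; rewrite xy /link orbb (negbTE (edges_irr _)).
Qed.

Let root_adj : adj root.1 root.2.
Proof.
apply/adjP; exists (val e).1, (val e).2; split => //.
by rewrite /link -surjective_pairing (valP e).
Qed.

Let adj_fin m : finite_set [set n | adj m n].
Proof.
apply: (sub_finite_set _ (finite_II #|vertex G|)) => n /= /adjP[x [y [_ _ <-]]].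
exact: ltn_ord.
Qed.

Let adj_connected m n : V m -> V n -> exists2 s, path adj m s & last m s = n.
Proof.
move=> Vm Vn; rewrite -[m]/(nat_of_ord (Ordinal Vm)) -[n]/(nat_of_ord (Ordinal Vn)).
rewrite -(enum_valK (Ordinal Vm)) -(enum_valK (Ordinal Vn)).
have /connectP[s] := ograph_connected (enum_val (Ordinal Vm)) (enum_val (Ordinal Vn)).
move: (enum_val _) (enum_val _) => y x ps ->.
exists [seq (enum_rank z : nat) | z <- s]; last by rewrite (last_map (fun z => enum_rank z : nat)).
elim: s x ps => //= z s ih x /andP[xz ps]; rewrite ih// andbT.
by apply/adjP; exists x, z.
Qed.

Definition egraph_of : egraph :=
  EGraph adj_vert adj_sym adj_irr root_adj adj_fin adj_connected.

End OfFinite.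

(* The vertices of the restriction of G to radius r. *)
Definition eball (G : egraph) (r : nat) : set nat :=
  [set y | exists x s, [/\ x \in [:: (eroot G).1; (eroot G).2],
    (size s <= r)%N, path (eadj G) x s & last x s = y]].

(* The root-preserving isomorphism relation between the subgraphs induced by
   eball G r and eball H r. *)
Definition ball_iso (r : nat) (G H : egraph) : Prop :=
  exists f : nat -> nat,
    [/\ set_bij (eball G r) (eball H r) f,
        forall x y, eball G r x -> eball G r y ->
          eadj G x y = eadj H (f x) (f y) &
        (f (eroot G).1, f (eroot G).2) = eroot H \/
        (f (eroot G).2, f (eroot G).1) = eroot H].

Section BallIso.
Implicit Types G H K : egraph.

Lemma eball_le G r s : (r <= s)%N -> eball G r `<=` eball G s.
Proof.
by move=> rs y [x [t [? tr ? ?]]]; exists x, t; split => //; exact: leq_trans rs.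
Qed.

Lemma eball_root1 G r : eball G r (eroot G).1.
Proof. by exists (eroot G).1, [::]; rewrite !inE eqxx. Qed.

Lemma eball_root2 G r : eball G r (eroot G).2.
Proof. by exists (eroot G).2, [::]; rewrite !inE eqxx orbT. Qed.

Lemma ball_iso_refl r G : ball_iso r G G.
Proof. by exists id; split; [by split => // y Gy; exists y|by []|by left; case: (eroot G)]. Qed.

Lemma ball_iso_sym r G H : ball_iso r G H -> ball_iso r H G.
Proof.
move=> [f [[fun_f inj_f surj_f] adj_f root_f]].
pose g y := xget 0%N [set x | eball G r x /\ f x = y].
have gP y : eball H r y -> eball G r (g y) /\ f (g y) = y.
  move=> /surj_f[x Gx fx].
  have := @xgetPex _ 0%N [set x | eball G r x /\ f x = y].
  by apply; exists x.
have gf x : eball G r x -> g (f x) = x.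
  move=> Gx; have [] := gP (f x) (fun_f _ Gx) => Ggx fgx.
  by apply: inj_f; rewrite ?inE.
exists g; split.
- split.
  + by move=> y /gP[].
  + move=> x y; rewrite !inE => /gP[_ fx] /gP[_ fy] xy.
    by rewrite -fx -fy xy.
  + by move=> x Gx; exists (f x); [exact: fun_f|exact: gf].
- move=> x y /gP[Gx fx] /gP[Gy fy].
  by rewrite adj_f// fx fy.
- case: root_f => <- /=; rewrite !gf; try exact: eball_root1;
    try exact: eball_root2; by [left; case: (eroot G)|right; case: (eroot G)].
Qed.

Lemma ball_iso_trans r G H K :
  ball_iso r G H -> ball_iso r H K -> ball_iso r G K.
Proof.
move=> [f [[fun_f inj_f surj_f] adj_f root_f]].
move=> [g [[fun_g inj_g surj_g] adj_g root_g]].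
exists (g \o f); split.
- split.
  + by move=> x Gx; apply: fun_g; exact: fun_f.
  + move=> x y; rewrite !inE => Gx Gy /= gxy; apply: inj_f; rewrite ?inE//.
    by apply: inj_g; rewrite ?inE//; exact: fun_f.
  + move=> z /surj_g[y /surj_f[x Gx <-] <-]; by exists x.
- by move=> x y Gx Gy /=; rewrite adj_f// adj_g//; exact: fun_f.
- by case: root_f root_g => <- [] <- /=; [left|right|right|left].
Qed.

Lemma ball_iso_le r s G H : (s <= r)%N -> ball_iso r G H -> ball_iso s G H.
Proof.
have fwd G' H' f : (s <= r)%N ->
    (forall x y, eball G' r x -> eball G' r y ->
       eadj G' x y = eadj H' (f x) (f y)) ->
    (f (eroot G').1, f (eroot G').2) = eroot H' \/
    (f (eroot G').2, f (eroot G').1) = eroot H' ->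
    forall y, eball G' s y -> eball H' s (f y).
  move=> sr adj_f root_f y [x [t [xr ts pt <-]]].
  exists (f x), (map f t); split; rewrite ?size_map ?last_map//.
    by move: xr; rewrite !inE; case: root_f => <- /= /orP[] /eqP ->;
      rewrite eqxx ?orbT.
  have tr := leq_trans ts sr.
  have pre u v : t = u ++ v -> eball G' r (last x u).
    move=> tE; exists x, u; split => //.
      by apply: leq_trans tr; rewrite tE size_cat leq_addr.
    by move: pt; rewrite tE cat_path => /andP[].
  suff H0 u v : t = u ++ v -> path (eadj H') (f (last x u)) (map f v).
    exact: (H0 [::] t).
  elim: v u => //= z v ih u tE.
  have tE' : t = rcons u z ++ v by rewrite cat_rcons.
  have := ih _ tE'; rewrite last_rcons => ->; rewrite andbT -adj_f.
  - by move: pt; rewrite tE cat_path /= => /and3P[].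
  - exact: pre tE.
  - by rewrite -(last_rcons x u z); exact: pre tE'.
move=> sr GH; have [g [[fun_g inj_g surj_g] adj_g root_g]] := ball_iso_sym GH.
pose f y := xget 0%N [set x | eball H r x /\ g x = y].
have fP y : eball G r y -> eball H r (f y) /\ g (f y) = y.
  move=> /surj_g[x Gx gx].
  have := @xgetPex _ 0%N [set x | eball H r x /\ g x = y].
  by apply; exists x.
have fg x : eball H r x -> f (g x) = x.
  move=> Hx; have [] := fP (g x) (fun_g _ Hx) => Hfx gfx.
  by apply: inj_g; rewrite ?inE.
have adj_f x y : eball G r x -> eball G r y -> eadj G x y = eadj H (f x) (f y).
  by move=> /fP[Hx gx] /fP[Hy gy]; rewrite adj_g// gx gy.
have root_f : (f (eroot G).1, f (eroot G).2) = eroot H \/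
    (f (eroot G).2, f (eroot G).1) = eroot H.
  case: root_g => <- /=; rewrite !fg; try exact: eball_root1;
    try exact: eball_root2; by [left; case: (eroot H)|right; case: (eroot H)].
have fs := fwd _ _ _ sr adj_f root_f.
have gs := fwd _ _ _ sr adj_g root_g.
exists f; split => //.
- split => //.
  + move=> x y; rewrite !inE => /(eball_le sr)/fP[_ gx] /(eball_le sr)/fP[_ gy].
    by move=> xy; rewrite -gx -gy xy.
  + move=> y Hy; exists (g y); first exact: gs.
    by apply: fg; exact: eball_le Hy.
- by move=> x y /(eball_le sr) ? /(eball_le sr) ?; exact: adj_f.
Qed.

Lemma ball_iso0 G H : ball_iso 0 G H.
Proof.
have eball0 K x : eball K 0 x <-> x = (eroot K).1 \/ x = (eroot K).2.
  split.
    move=> [y [s [+ + + <-]]]; case: s => // + _ _.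
    by rewrite !inE => /orP[]/eqP ->; [left|right].
  by case=> ->; [exact: eball_root1|exact: eball_root2].
have rne K : ((eroot K).1 == (eroot K).2) = false.
  apply/negP => /eqP K12; have := eroot_adj K.
  by rewrite K12 eadj_irr.
have adjs K : eadj K (eroot K).2 (eroot K).1.
  by rewrite eadj_sym; exact: eroot_adj.
pose f x := if x == (eroot G).1 then (eroot H).1 else (eroot H).2.
have f1 : f (eroot G).1 = (eroot H).1 by rewrite /f eqxx.
have f2 : f (eroot G).2 = (eroot H).2 by rewrite /f eq_sym rne.
have ne12 K : (eroot K).1 <> (eroot K).2 by move/eqP; rewrite rne.
exists f; split.
- split.
  + by move=> x /eball0[] ->; apply/eball0; rewrite ?f1 ?f2; [left|right].
  + move=> x y; rewrite !inE => /eball0[] -> /eball0[] ->; rewrite ?f1 ?f2//.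
    * by move/ne12.
    * by move/esym/ne12.
  + by move=> y /eball0[] ->; [exists (eroot G).1|exists (eroot G).2];
      rewrite ?f1 ?f2//; [exact: eball_root1|exact: eball_root2].
- move=> x y /eball0[] -> /eball0[] ->;
    by rewrite ?f1 ?f2 ?eadj_irr ?eroot_adj ?adjs.
- by left; rewrite f1 f2; case: (eroot H).
Qed.

End BallIso.

(* Isomorphic rooted graphs are at distance 0, so the topology, the Borel sets
   and the continuous functions of this pseudometric space are those of the
   space of isomorphism classes. *)
Definition egraph_space (R : realType) : Type := egraph.

Section EgraphSpace.
Variable R : realType.


HB.instance Definition _ := gen_eqMixin (egraph_space R).
HB.instance Definition _ := gen_choiceMixin (egraph_space R).
HB.instance Definition _ := isPointed.Build (egraph_space R)
  (@egraph_of single_edge (exist _ (false, true) (set11 _))).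

Definition egraph_dist (G H : egraph_space R) : R :=
  inf [set (r.+1%:R)^-1 | r in [set r | ball_iso r G H]].

Lemma egraph_dist_lt G H (e : R) : egraph_dist G H < e <->
  exists2 r, ball_iso r G H & (r.+1%:R)^-1 < e.
Proof.
pose A : set R := [set (r.+1%:R)^-1 | r in [set r | ball_iso r G H]].
have A0 : A !=set0 by exists 1, 0%N; [exact: ball_iso0|rewrite invr1].
have Alb : has_lbound A by exists 0 => _ [r _ <-]; rewrite invr_ge0.
split.
  move=> /(inf_lt A0)[_ [r ? <-] ?]; by exists r.
move=> [r rGH re]; apply: le_lt_trans re; apply: ge_inf => //.
by exists r.
Qed.

Let eb (G : egraph_space R) (e : R) : set (egraph_space R) :=
  [set H | egraph_dist G H < e].

Let eb_center G (e : R) : 0 < e -> eb G e G.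
Proof.
move=> e0; apply/egraph_dist_lt.
have [r re] := ltr_add_invr e0; exists r; first exact: ball_iso_refl.
by rewrite add0r in re.
Qed.

Let eb_sym G H (e : R) : eb G e H -> eb H e G.
Proof.
by move=> /egraph_dist_lt[r GH re]; apply/egraph_dist_lt; exists r => //; exact: ball_iso_sym.
Qed.

Let eb_triangle G H K (e1 e2 : R) : eb G e1 H -> eb H e2 K -> eb G (e1 + e2) K.
Proof.
move=> /egraph_dist_lt[r GH re] /egraph_dist_lt[s HK se]; apply/egraph_dist_lt.
have r0 : 0 <= (r.+1%:R : R)^-1 by rewrite invr_ge0.
have s0 : 0 <= (s.+1%:R : R)^-1 by rewrite invr_ge0.
have [rs|/ltnW sr] := leqP r s.
  exists r; first exact: ball_iso_trans GH (ball_iso_le rs HK).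
  by rewrite (lt_le_trans re)// lerDl (le_trans s0)// ltW.
exists s; first exact: ball_iso_trans (ball_iso_le sr GH) HK.
by rewrite (lt_le_trans se)// lerDr (le_trans r0)// ltW.
Qed.

HB.instance Definition _ := hasNbhs.Build (egraph_space R) (nbhs_ (entourage_ eb)).
HB.instance Definition _ := @Nbhs_isPseudoMetric.Build R (egraph_space R)
  (entourage_ eb) erefl eb eb_center eb_sym eb_triangle erefl.

Definition egraph_borel := g_sigma_algebraType (@open (egraph_space R)).

End EgraphSpace.

(* Convergence in distribution to X of (G_k, E_k), with E_k uniform on the edges
   of G_k. *)
Definition bs_limit (R : realType) (G1 : ograph) (d : measure_display)
    (Omega : measurableType d) (P : probability Omega R)
    (X : {RV P >-> egraph_borel R}) : Prop :=
  forall h : egraph_space R -> R, continuous h ->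
    (exists M, forall G, `|h G| <= M) ->
    (fun k => ((\sum_(e : edge (hier G1 k)) h (egraph_of e)) /
               #|edges (hier G1 k)|%:R)%:E) @ \oo --> ('E_P[h \o X])%E.

(* States of the unordered pairs of naturals; {x, y} is indexed by
   (minn x y, maxn x y). *)
Definition config := nat * nat -> bool.

Definition config_space : Type :=
  g_sigma_algebraType (range (fun e => [set w : config | w e])).

HB.instance Definition _ := Measurable.on config_space.

Definition bernoulli_product (R : realType) (p : R)
    (Q : probability config_space R) : Prop :=
  forall (s : seq (nat * nat)) (b : nat * nat -> bool), uniq s ->
    Q [set w | forall e, e \in s -> w e = b e] =
    (\prod_(e <- s) (if b e then p else 1 - p))%:E.

(* Existence of the Bernoulli product measure, realised on `[0, 1[: the digits of
   a uniform point in the expansion that splits every interval in proportions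
   p and 1 - p are independent. *)
Section BernoulliExists.
Variables (R : realType) (p : R).
Hypothesis p01 : 0 <= p <= 1.

Let wt (b : bool) : R := if b then p else 1 - p.

Let shift (x : R) : R := if x < p then x / p else (x - p) / (1 - p).

Let bit (n : nat) (x : R) : bool := iter n shift x < p.

Let bitS n x : bit n.+1 x = bit n (shift x).
Proof. by rewrite /bit iterSr. Qed.

Let lo (w : seq bool) : R :=
  foldr (fun (b : bool) y => if b then p * y else p + (1 - p) * y) 0 w.

Let len (w : seq bool) : R := \prod_(b <- w) wt b.

Let wt_ge0 b : 0 <= wt b.
Proof. by move: p01 => /andP[? ?]; case: b => //=; rewrite subr_ge0. Qed.

Let len_ge0 w : 0 <= len w.
Proof. by apply: prodr_ge0 => b _. Qed.

Let cyl (w : seq bool) : set R := `[lo w, lo w + len w[.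

Let lo_bounds w : 0 <= lo w /\ lo w + len w <= 1.
Proof.
move: p01 => /andP[p0 p1]; elim: w => [|b w [l0 l1]] /=.
  by rewrite /len big_nil add0r.
rewrite /len big_cons -/(len w); have := len_ge0 w.
by case: b => /= ?; split; nra.
Qed.

Let cylP w x : cyl w x <->
  0 <= x < 1 /\ forall i, (i < size w)%N -> bit i x = nth false w i.
Proof.
move: p01 => /andP[p0 p1].
elim: w x => [|b w ih] x.
  rewrite /cyl /len big_nil /= in_itv /= add0r.
  by split => [->|[]//]; split.
have split_bits : (forall i, (i < size (b :: w))%N -> bit i x = nth false (b :: w) i)
    <-> (x < p) = b /\
        forall i, (i < size w)%N -> bit i (shift x) = nth false w i.
  split=> [h|[h0 h] [|i] //= iw]; last by rewrite bitS h.
  by split=> [|i iw]; [have := h 0%N isT|have := h i.+1 iw; rewrite bitS].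
have [l0 l1] := lo_bounds w; have ln0 := len_ge0 w.
have cylE : cyl (b :: w) x <-> lo (b :: w) <= x < lo (b :: w) + wt b * len w.
  by rewrite /cyl /= in_itv /= /len big_cons.
have ihE : (0 <= shift x < 1 /\
    forall i, (i < size w)%N -> bit i (shift x) = nth false w i) <->
    lo w <= shift x < lo w + len w.
  by rewrite -ih /cyl /= in_itv.
apply: (iff_trans cylE); apply: iff_trans; last first.
  by apply: and_iff_compat_l; apply: iff_sym; exact: split_bits.
case: b {split_bits cylE} => /=.
- have [/eqP p_eq0|pn0] := boolP (p == 0).
    rewrite p_eq0 !mul0r add0r; split; first by lra.
    by move=> [? [? ?]]; lra.
  have pp : 0 < p by rewrite lt_neqAle eq_sym pn0.
  split.
    move=> /andP[x1 x2]; have xp : x < p by nra.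
    split; first by apply/andP; split; nra.
    split => //; apply: (proj2 (proj2 ihE _)).
    by rewrite /shift xp ler_pdivlMr// ltr_pdivrMr//; apply/andP; split; nra.
  move=> [/andP[x0 x1] [xp h]]; move: h ihE; rewrite /shift xp => h ihE.
  have : lo w <= x / p < lo w + len w.
    apply/ihE; split => //; rewrite divr_ge0//= ltr_pdivrMr//; lra.
  by rewrite ler_pdivlMr// ltr_pdivrMr// => /andP[? ?]; apply/andP; split; nra.
- have [/eqP p_eq1|pn1] := boolP (p == 1).
    rewrite p_eq1 subrr !mul0r !addr0; split; first by lra.
    by move=> [? [? ?]]; lra.
  have pp : 0 < 1 - p by rewrite subr_gt0 lt_neqAle pn1.
  split.
    move=> /andP[x1 x2]; have xp : (x < p) = false.
      by apply/negbTE; rewrite -leNgt; nra.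
    split; first by apply/andP; split; nra.
    split => //; apply: (proj2 (proj2 ihE _)).
    by rewrite /shift xp ler_pdivlMr// ltr_pdivrMr//; apply/andP; split; nra.
  move=> [/andP[x0 x1] [xp h]]; move: h ihE; rewrite /shift xp => h ihE.
  have px : p <= x by rewrite leNgt xp.
  have : lo w <= (x - p) / (1 - p) < lo w + len w.
    apply/ihE; split => //; rewrite divr_ge0//= ?ltr_pdivrMr//; lra.
  by rewrite ler_pdivlMr// ltr_pdivrMr// => /andP[? ?]; apply/andP; split; nra.
Qed.

Let mu := @lebesgue_measure R.

Let mu_cyl w : mu (cyl w) = (len w)%:E.
Proof.
rewrite /mu /cyl lebesgue_measure_itv /= lte_fin ltrDl -EFinD addrAC subrr add0r.
by case: ltP => // l0; congr EFin; apply/eqP; rewrite eq_le l0 len_ge0.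
Qed.

Let compat (o : option bool) (b : bool) := if o is Some c then b = c else True.

Let owt (o : option bool) : R := if o is Some b then wt b else 1.

Let A (w : seq bool) (cs : seq (option bool)) : set R :=
  [set x | cyl w x /\
     forall i, (i < size cs)%N -> compat (nth None cs i) (bit (size w + i) x)].

Let cyl_rcons w b x : cyl (rcons w b) x <-> cyl w x /\ bit (size w) x = b.
Proof.
split=> [/cylP[x01 h]|[/cylP[x01 h] hb]].
  split; last by rewrite h ?size_rcons// nth_rcons ltnn eqxx.
  apply/cylP; split => // i iw; rewrite h ?nth_rcons ?iw//.
  by rewrite size_rcons ltnW.
apply/cylP; split => // i; rewrite size_rcons nth_rcons ltnS leq_eqVlt.
by move=> /orP[/eqP ->|iw]; [rewrite ltnn eqxx|rewrite iw h].
Qed.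

Let A_rcons w b cs x : A (rcons w b) cs x <->
  bit (size w) x = b /\ A w (None :: cs) x.
Proof.
split=> [[/cyl_rcons[? ?] h]|[hb [hw h]]].
  split => //; split => // -[|i]//= ics; rewrite -addSnnS.
  by have := h i ics; rewrite size_rcons.
split; first exact/cyl_rcons.
by move=> i ics; have := h i.+1 ics; rewrite size_rcons addSnnS.
Qed.

Let A_some w b cs : A w (Some b :: cs) = A (rcons w b) cs.
Proof.
apply/seteqP; split=> x.
  move=> [hw h]; apply/A_rcons; split.
    by have := h 0%N isT; rewrite addn0.
  by split => // -[|i]//= ics; have := h i.+1 ics.
move=> /A_rcons[hb [hw h]]; split => // -[_|i ics]; first by rewrite addn0.
exact: h i.+1 ics.
Qed.

Let A_none w cs : A w (None :: cs) = A (rcons w true) cs `|` A (rcons w false) cs.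
Proof.
apply/seteqP; split=> x.
  by case E : (bit (size w) x) => Ax; [left|right]; apply/A_rcons.
by move=> [] /A_rcons[].
Qed.

Let len_rcons w b : len (rcons w b) = len w * wt b.
Proof. by rewrite /len -cats1 big_cat big_seq1. Qed.

Let mu_A w cs : measurable (A w cs : set (measurableTypeR R)) /\
  mu (A w cs) = (len w * \prod_(o <- cs) owt o)%:E.
Proof.
elim: cs w => [|[b|] cs ih] w.
- have -> : A w [::] = cyl w by apply/seteqP; split=> x [].
  rewrite big_nil mulr1 mu_cyl; split => //; exact: measurable_itv.
- rewrite A_some; have [mA ->] := ih (rcons w b); split => //.
  by rewrite big_cons len_rcons mulrA.
- have [mT eT] := ih (rcons w true); have [mF eF] := ih (rcons w false).
  rewrite A_none; split; first exact: measurableU.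
  have TF0 : A (rcons w true) cs `&` A (rcons w false) cs = set0.
    by apply/seteqP; split=> x // [] /A_rcons[hx _] /A_rcons[]; rewrite hx.
  have -> : mu (A (rcons w true) cs `|` A (rcons w false) cs) =
      (mu (A (rcons w true) cs) + mu (A (rcons w false) cs))%E.
    exact: measureU.
  rewrite eT eF -EFinD big_cons !len_rcons /=; congr EFin.
  by rewrite /wt; ring.
Qed.

Let D : set (measurableTypeR R) := `[0, 1[.

Let mD : measurable D. Proof. exact: measurable_itv. Qed.

Let unif : set (measurableTypeR R) -> \bar R := mrestr mu mD.

HB.instance Definition _ := Measure.on unif.

Let unif_setT : unif setT = 1%E.
Proof.
rewrite /unif /mrestr setTI /mu /D lebesgue_measure_itv /= lte_fin ltr01.
by rewrite sube0.
Qed.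

HB.instance Definition _ := Measure_isProbability.Build _ _ _ unif unif_setT.

Let digits : measurableTypeR R -> config_space := fun x e => bit (pickle e) x.

Let mshift : measurable_fun setT (shift : measurableTypeR R -> measurableTypeR R).
Proof.
apply: measurable_fun_ifT => /=.
- exact: measurable_fun_ltr.
- exact: measurable_funM.
- by apply: measurable_funM => //; exact: measurable_funB.
Qed.

Let miter n : measurable_fun setT
  (iter n shift : measurableTypeR R -> measurableTypeR R).
Proof.
elim: n => [|n ih]; first exact: measurable_id.
exact: (measurableT_comp mshift ih).
Qed.

Let mdigits : measurable_fun setT digits.
Proof.
apply: measurability => //.
move=> _ [_ [e _ <-] <-]; rewrite setTI.
have -> : digits @^-1` [set w | w e] = iter (pickle e) shift @^-1` `]-oo, p[.
  by apply/seteqP; split => x /=; rewrite in_itv.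
rewrite -[X in measurable X]setTI; apply: miter => //.
Qed.

HB.instance Definition _ := isMeasurableFun.Build _ _ _ _ digits mdigits.

Lemma bernoulli_product_exists :
  exists Q : probability config_space R, bernoulli_product p Q.
Proof.
exists (distribution unif digits) => s b us.
have [N sN] : exists N, forall e, e \in s -> (pickle e < N)%N.
  exists (\max_(e <- s) pickle e).+1 => e es.
  by rewrite ltnS (big_rem e)//= leq_max leqnn.
pose c i := if [seq e <- s | pickle e == i] is e :: _ then Some (b e) else None.
have cE e : e \in s -> c (pickle e) = Some (b e).
  move=> es; rewrite /c; case E : [seq _ <- _ | _] => [|e' t].
    by have : e \in [::] by rewrite -E mem_filter eqxx.
  have : e' \in [seq e' <- s | pickle e' == pickle e] by rewrite E mem_head.
  by rewrite mem_filter => /andP[/eqP/(pcan_inj pickleK) ->].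
have cN i : i \notin map pickle s -> c i = None.
  move=> is_; rewrite /c; case E : [seq _ <- _ | _] => [//|e' t].
  have : e' \in [seq e' <- s | pickle e' == i] by rewrite E mem_head.
  rewrite mem_filter => /andP[/eqP e'i e's].
  by move: is_; rewrite -e'i map_f.
have AE : digits @^-1` [set w | forall e, e \in s -> w e = b e] `&` D =
    A [::] (mkseq c N).
  apply/seteqP; split => x.
    move=> [/= h Dx]; split.
      apply/cylP; split => //; move: Dx; by rewrite /D /= in_itv.
    move=> i; rewrite size_mkseq => iN; rewrite nth_mkseq//= add0n.
    have [/mapP[e es ->]|/cN -> //] := boolP (i \in map pickle s).
    by rewrite cE//=; exact: h.
  move=> [/cylP[x01 _] h]; split; last by rewrite /D /= in_itv.
  move=> e es; have := h (pickle e); rewrite size_mkseq => /(_ (sN _ es)).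
  by rewrite nth_mkseq ?sN//= cE.
have [_ muA] := mu_A [::] (mkseq c N).
transitivity (mu (A [::] (mkseq c N))); first by rewrite -AE.
rewrite muA; congr EFin.
rewrite /len big_nil mul1r big_map.
rewrite (bigID (mem (map pickle s))) /= [X in _ * X]big1 ?mulr1; last first.
  by move=> i /cN ->.
rewrite -big_filter (perm_big (map pickle s)) /=.
  by rewrite big_map [LHS]big_seq [RHS]big_seq; apply: eq_bigr => e /cE ->.
apply: uniq_perm.
- by rewrite filter_uniq// iota_uniq.
- by rewrite map_inj_uniq//; exact: (pcan_inj pickleK).
- move=> i; rewrite mem_filter mem_iota /= add0n.
  by apply/andP/idP => [[]//|is_]; split => //; case/mapP: is_ => e /sN + ->.
Qed.

End BernoulliExists.

(* The product Bernoulli(p) measure for p in [0, 1] (percolationP); the default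
   value of xget is only used for other p. *)
Definition percolation (R : realType) (p : R) : probability config_space R :=
  xget (dirac (point : config_space) : probability config_space R)
    [set Q | bernoulli_product p Q].

Lemma percolationP (R : realType) (p : R) :
  0 <= p <= 1 -> bernoulli_product p (percolation p).
Proof.
move=> /bernoulli_product_exists[Q hQ].
by apply: (@xgetPex _ _ [set Q | bernoulli_product p Q]); exists Q.
Qed.

Definition open_adj (G : egraph) (w : config_space) : rel nat :=
  fun x y => eadj G x y && w (minn x y, maxn x y).

Definition cluster (G : egraph) (w : config_space) (x : nat) : set nat :=
  [set y | exists2 s, path (open_adj G w) x s & last x s = y].

Definition root_theta (R : realType) (G : egraph) (p : R) : \bar R :=
  percolation p [set w | infinite_set (cluster G w (eroot G).1) \/
                         infinite_set (cluster G w (eroot G).2)].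

Definition theta (R : realType) (d : measure_display) (Omega : measurableType d)
    (P : probability Omega R) (X : {RV P >-> egraph_borel R}) (p : R) : \bar R :=
  (\int[P]_o root_theta (X o) p)%E.

(* Main.v *)
Require Import Defs.
From HB Require Import structures.
From mathcomp Require Import all_boot all_order all_algebra.
From mathcomp Require Import all_classical all_reals all_analysis.
From mathcomp Require Import measurable_realfun ring lra zify.

Set Implicit Arguments.
Unset Strict Implicit.
Unset Printing Implicit Defensive.

Import Order.TTheory GRing.Theory Num.Theory.
Import numFieldNormedType.Exports.

Local Open Scope ring_scope.

(** Percolation on the hierarchical graphs renormalises exactly. Seen from
    one edge [e] of [G_k], replacing every edge by a copy of [G_1] turns percolation
    of parameter [p] into percolation of parameter [f p], where [f] is the crossing
    probability of [G_1], and the position of the root edge inside its copy enters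
    only through the set of ends of the copy that it reaches (a path leaving the
    copy can come back only through an end already reached). Averaging over the
    edges, the probability that the root edge of [G_n] is connected to the two
    distinguished vertices is a column sum of the product
    [M (f^(n-1) p) ... M (f p) M p / m ^ n], with [M] the matrix of connection types
    and [m] the number of edges of [G_1]: this is [reach_prob_subst] and
    [sum_reach_hier].

    These probabilities bound [theta p] from both sides. The event that the root
    cluster leaves the ball of radius [r] depends on the ball of radius [r + 1], so
    its probability is a continuous function of the rooted graph and its
    expectation in the limit graph is the limit of its averages over the edges of
    [G_k]; letting [r] tend to infinity gives [theta p]. A cluster that goes far
    must leave the copy of [G_n] around the root ([reaches_far], [sum_far_hier]),
    whence an upper bound for each [n]. Conversely few edges of [G_k] are close to
    the distinguished vertices, because distances at least double and the fraction
    of edges at these vertices decays at each step ([near_copy_half],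
    [near_ends0S]), whence a lower bound ([theta_ge_level]).

    It remains to estimate the products of matrices. At [p = ps] they are powers
    of [M ps], governed by its Perron-Frobenius eigenvalue [d_f]; a positive
    eigenvector exists since the third row and column of the matrix are positive.
    The Moore-Shannon inequality gives [zeta = f' ps > 1], so that for [p] slightly
    above [ps] the iterates escape at rate [zeta] and reach a fixed [t > ps] after
    [N] steps with [zeta ^ N] comparable with [1 / (p - ps)]. The distances to [ps]
    along the way have a bounded sum, and both [f x - ps] and the entries of [M x]
    are within a factor [exp (C (x - ps))] of their linearisation and of their value
    at [ps], so the product over these [N] scales is comparable with [d_f ^ N]. Beyond
    [t] the odds of being closed decay geometrically, by the integrated form of the
    Moore-Shannon inequality, and the remaining scales cost a constant factor.
    Hence [theta p] is comparable with [(d_f / m) ^ N], that is with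
    [(p - ps) ^ beta] ([scale_estimates], [pow_scale]). *)

(** * Expectations under percolation *)

Section PercolationExpectation.
Import mathcomp.boot.finset.
Variable R : comNzRingType.

(** The parameter lies in any commutative ring, so that the parameter ['X] gives
    the probability as a polynomial in [p]. *)
Definition perc_exp (T : finType) (p : R) (F : {set T}) (h : {set T} -> R) : R :=
  \sum_(w in powerset F) p ^+ #|w| * (1 - p) ^+ #|F :\: w| * h w.

Lemma set_insert_ind (T : finType) (P : {set T} -> Prop) :
  P set0 -> (forall (e : T) (F : {set T}), e \notin F -> P F -> P (e |: F)) ->
  forall F, P F.
Proof.
move=> P0 PU F; move: {2}#|F| (erefl #|F|) => n; elim: n F => [|n ih] F cF.
  by move/eqP: cF; rewrite cards_eq0 => /eqP ->.
have /card_gt0P[e eF] : (0 < #|F|)%N by rewrite cF.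
rewrite -(setD1K eF); apply: PU; first by rewrite !inE eqxx.
by apply: ih; move: cF; rewrite (cardsD1 e) eF => -[].
Qed.

Lemma eq_perc_exp (T : finType) (p : R) (F : {set T}) (h h' : {set T} -> R) :
  (forall w : {set T}, w \subset F -> h w = h' w) -> perc_exp p F h = perc_exp p F h'.
Proof. by move=> hh; apply: eq_bigr => w; rewrite powersetE => /hh ->. Qed.

Lemma perc_exp_set0 (T : finType) (p : R) (h : {set T} -> R) :
  perc_exp p set0 h = h set0.
Proof.
rewrite /perc_exp powerset0 big_set1 cards0 setDv cards0.
by rewrite !expr0 !mul1r.
Qed.

(** Conditioning on the state of one edge; every induction on the set of edges
    below rests on it. *)
Lemma perc_expU1 (T : finType) (p : R) e (F : {set T}) (h : {set T} -> R) : e \notin F ->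
  perc_exp p (e |: F) h =
  p * perc_exp p F (fun w => h (e |: w)) + (1 - p) * perc_exp p F h.
Proof.
move=> eF; rewrite /perc_exp (bigID (fun w : {set T} => e \in w)) /=; congr (_ + _).
  rewrite mulr_sumr (reindex_onto (fun w => e |: w) (fun w => w :\ e)) /=; last first.
    by move=> w /andP[_ ew]; rewrite setD1K.
  apply: eq_big => [w|w].
    rewrite !powersetE setU11 andbT; apply/andP/idP.
      move=> [sw /eqP <-]; apply/fintype.subsetP => x; rewrite !inE => /andP[xe].
      case/orP => [/eqP xE|xw]; first by rewrite xE eqxx in xe.
      by have /fintype.subsetP/(_ x) := sw; rewrite !inE xw orbT (negbTE xe) /=; apply.
    move=> sw; split; first exact: setUS.
    by rewrite setU1K//; apply: contra eF => /(fintype.subsetP sw).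
  rewrite !powersetE => /andP[/andP[sw _] /eqP wE].
  have ew : e \notin w by rewrite -wE !inE eqxx.
  rewrite cardsU1 ew exprS.
  have -> : (e |: F) :\: (e |: w) = F :\: w.
    apply/setP => x; rewrite !inE; case: (eqVneq x e) => //= ->.
    by rewrite (negbTE eF) andbF.
  by rewrite !mulrA.
rewrite mulr_sumr; apply: eq_big => [w|w].
  rewrite !powersetE; apply/andP/idP => [[sw ew]|sw].
    apply/fintype.subsetP => x xw; have /fintype.subsetP/(_ x xw) := sw.
    by rewrite !inE => /orP[/eqP xe|//]; rewrite -xe xw in ew.
  split; first by apply: fintype.subset_trans sw _; exact: subsetUr.
  by apply: contra eF => /(fintype.subsetP sw).
rewrite powersetE => /andP[sw ew].
have -> : (e |: F) :\: w = e |: (F :\: w).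
  by apply/setP => x; rewrite !inE; case: (eqVneq x e) => [->|]; rewrite ?(negbTE ew).
by rewrite cardsU1 !inE (negbTE eF) andbF exprS; ring.
Qed.

Lemma perc_expZ (T : finType) (p c : R) (F : {set T}) (h : {set T} -> R) :
  perc_exp p F (fun w => c * h w) = c * perc_exp p F h.
Proof. by rewrite /perc_exp mulr_sumr; apply: eq_bigr => w _; rewrite mulrCA. Qed.

Lemma perc_expD (T : finType) (p : R) (F : {set T}) (h h' : {set T} -> R) :
  perc_exp p F (fun w => h w + h' w) = perc_exp p F h + perc_exp p F h'.
Proof. by rewrite /perc_exp -big_split; apply: eq_bigr => w _; rewrite mulrDr. Qed.

Lemma perc_exp_sum (T I : finType) (p : R) (F : {set T}) (h : I -> {set T} -> R) :
  perc_exp p F (fun w => \sum_i h i w) = \sum_i perc_exp p F (h i).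
Proof.
by rewrite /perc_exp exchange_big; apply: eq_bigr => w _; rewrite mulr_sumr.
Qed.

Lemma perc_exp_cst (T : finType) (p c : R) (F : {set T}) :
  perc_exp p F (fun=> c) = c.
Proof.
elim/set_insert_ind: F => [|e F eF ih]; first by rewrite perc_exp_set0.
by rewrite perc_expU1// ih; ring.
Qed.

(** Independence of disjoint sets of edges. *)
Lemma perc_expU (T : finType) (p : R) (F F' : {set T}) (h : {set T} -> R) : [disjoint F & F'] ->
  perc_exp p (F :|: F') h =
  perc_exp p F (fun w => perc_exp p F' (fun w' => h (w :|: w'))).
Proof.
elim/set_insert_ind: F h => [|e F eF ih] h dF.
  rewrite set0U perc_exp_set0; apply: eq_perc_exp => w _.
  by rewrite set0U.
have eF' : e \notin F'.
  by rewrite (disjointFr dF) // !inE eqxx.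
have dF' : [disjoint F & F'].
  by apply: disjointWl dF; exact: subsetUr.
rewrite -setUA !perc_expU1 ?inE ?negb_or ?eF// !ih//; congr (_ * _ + _).
apply: eq_perc_exp => w _; apply: eq_perc_exp => w' _.
by rewrite setUA.
Qed.

Lemma perc_exp_imset (T T' : finType) (p : R) (phi : T -> T') (F : {set T})
    (h : {set T'} -> R) :
  {in F &, injective phi} ->
  perc_exp p (phi @: F) h = perc_exp p F (fun w => h (phi @: w)).
Proof.
elim/set_insert_ind: F h => [|e F eF ih] h inj.
  by rewrite imset0 !perc_exp_set0 imset0.
have injF : {in F &, injective phi}.
  by move=> x y xF yF; apply: inj; rewrite !inE ?xF ?yF orbT.
have ephi : phi e \notin phi @: F.
  apply/imsetP => -[x xF ex]; move: eF; rewrite (inj e x) ?xF//.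
    by rewrite !inE eqxx.
  by rewrite !inE xF orbT.
rewrite imsetU1 !perc_expU1// !ih//; congr (_ * _ + _).
by apply: eq_perc_exp => w _; rewrite imsetU1.
Qed.

(** Replacing each element of [D] by a block of independent elements, declared
    open when a block event of probability [q] holds, gives percolation of
    parameter [q] on [D]. *)
Lemma perc_exp_blocks (I T : finType) (p q : R) (D : {set I})
    (F : I -> {set T}) (g : I -> {set T} -> bool)
    (h : {set I} -> R) :
  (forall i j, i \in D -> j \in D -> i != j -> [disjoint F i & F j]) ->
  (forall i, i \in D -> perc_exp p (F i) (fun w => (g i w)%:R) = q) ->
  perc_exp p (\bigcup_(i in D) F i)
    (fun w => h [set i in D | g i (w :&: F i)]) = perc_exp q D h.
Proof.
elim/set_insert_ind: D h => [|e D eD ih] h dF gq.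
  rewrite big_set0 !perc_exp_set0; congr h.
  by apply/setP => i; rewrite !inE.
have dFD i j : i \in D -> j \in D -> i != j -> [disjoint F i & F j].
  by move=> iD jD; apply: dF; rewrite !inE ?iD ?jD orbT.
have gD i : i \in D -> perc_exp p (F i) (fun w => (g i w)%:R) = q.
  by move=> iD; apply: gq; rewrite !inE iD orbT.
have de i : i \in D -> [disjoint F e & F i].
  move=> iD; apply: dF; rewrite ?inE ?eqxx ?iD ?orbT//.
  by apply: contraNneq eD => ->.
have dbig : [disjoint F e & \bigcup_(i in D) F i].
  by apply/bigcup_disjointP => i iD; exact: de.
have disj (A B : {set T}) : [disjoint A & B] -> A :&: B = set0.
  by move=> AB; apply/eqP; rewrite setI_eq0.
rewrite big_setU1//= perc_expU// perc_expU1// -!(ih _ dFD gD).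
transitivity (perc_exp p (F e) (fun w => (g e w)%:R *
    perc_exp p (\bigcup_(i in D) F i) (fun w' => h (e |: [set i in D | g i (w' :&: F i)]))
   + (1 - (g e w)%:R) *
    perc_exp p (\bigcup_(i in D) F i) (fun w' => h [set i in D | g i (w' :&: F i)]))).
  apply: eq_perc_exp => w we.
  have -> : perc_exp p (\bigcup_(i in D) F i) (fun w' =>
      h [set i in e |: D | g i ((w :|: w') :&: F i)]) =
    perc_exp p (\bigcup_(i in D) F i) (fun w' =>
      h (if g e w then e |: [set i in D | g i (w' :&: F i)]
         else [set i in D | g i (w' :&: F i)])).
    apply: eq_perc_exp => w' w'D; congr h; apply/setP => i; rewrite !inE.
    have [->|ie] := eqVneq i e.
      rewrite /= setIUl (setIidPl we).
      have -> : w' :&: F e = set0.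
        apply/disj; rewrite disjoint_sym; exact: disjointWr w'D dbig.
      rewrite setU0; case: ifP => ge; rewrite !inE ?eqxx//.
      by rewrite (negbTE eD).
    rewrite /=; have -> : (i \in (if g e w then e |: [set i0 in D | g i0 (w' :&: F i0)]
         else [set i0 in D | g i0 (w' :&: F i0)])) =
        (i \in D) && g i (w' :&: F i).
      by case: ifP; rewrite !inE// (negbTE ie).
    case iD : (i \in D) => //=; congr g; rewrite setIUl.
    have -> : w :&: F i = set0.
      by apply/disj; exact: disjointWl we (de _ iD).
    by rewrite set0U.
  by case: (g e w); rewrite ?mul1r ?mul0r ?subrr ?mul0r ?addr0 ?subr0 ?mul1r ?add0r.
set a := perc_exp p _ (fun w' => h (e |: _)); set b := perc_exp p _ (fun w' => h _).
have ge := gq e (setU11 _ _).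
have -> : perc_exp p (F e) (fun w => (g e w)%:R * a + (1 - (g e w)%:R) * b) =
   perc_exp p (F e) (fun w => (a - b) * (g e w)%:R + b).
  by apply: eq_perc_exp => w _; ring.
by rewrite perc_expD perc_expZ perc_exp_cst ge; ring.
Qed.

End PercolationExpectation.

Section PercolationProbability.
Import mathcomp.boot.finset.
Variable R : realType.

Lemma perc_probE (V : finType) (p : R) (F : {set V * V}) (A : pred {set V * V}) :
  perc_prob p F A = perc_exp p F (fun w => (A w)%:R).
Proof.
rewrite /perc_prob /perc_exp big_mkcondr /=; apply: eq_bigr => w _.
by case: (A w); rewrite ?mulr1 ?mulr0.
Qed.

Lemma perc_weight_ge0 (T : finType) (p : R) (F w : {set T}) : 0 <= p <= 1 ->
  0 <= p ^+ #|w| * (1 - p) ^+ #|F :\: w|.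
Proof.
by move=> /andP[p0 p1]; rewrite mulr_ge0 ?exprn_ge0// subr_ge0.
Qed.

Lemma le_perc_exp (T : finType) (p : R) (F : {set T}) (h h' : {set T} -> R) : 0 <= p <= 1 ->
  (forall w : {set T}, w \subset F -> h w <= h' w) -> perc_exp p F h <= perc_exp p F h'.
Proof.
move=> p01 hh; apply: ler_sum => w; rewrite powersetE => /hh.
by move=> ?; rewrite ler_wpM2l// perc_weight_ge0.
Qed.

End PercolationProbability.

(** * Renormalisation *)

Section Renormalisation.
Import mathcomp.boot.finset.
Variables (G B : ograph).

Definition edge_copy (E : edge G) (f : vertex B * vertex B) :
  vertex (subst G B) * vertex (subst G B) := (copy E f.1, copy E f.2).

(** An edge with an end in the interior of a copy determines the copy; so does an
    edge joining the two ends of a copy, since [G] has at most one edge between two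
    vertices. *)
Lemma edge_copy_inj E E' f f' : f \in edges B -> f' \in edges B ->
  edge_copy E f = edge_copy E' f' -> E = E' /\ f = f'.
Proof.
case: f f' => [u v] [u' v'] fB fB' [] /= eu ev.
suff EE : E = E'.
  by split => //; move: eu ev; rewrite EE => /copy_inj -> /copy_inj ->.
have nuv : u != v.
  by apply/eqP => uv; move: fB; rewrite uv; apply/negP; exact: edges_irr.
case: (eqVneq E E') => [//|nee]; exfalso.
have ends : (val E).1 \in [:: (val E').1; (val E').2] /\
    (val E).2 \in [:: (val E').1; (val E').2].
  case: (copy_overlap eu nee) (copy_overlap ev nee) nuv => -[-> ?] [] [-> ?];
    by rewrite ?eqxx.
have [e1 e2] := ends.
have := edge_neq E; move: nee => /eqP; case: E E' e1 e2 {ends eu ev}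
  => [[a b] ab] [[a' b'] ab'] /=; rewrite !inE => e1 e2 ne ab0.
case/orP: e1 => /eqP aE; case/orP: e2 => /eqP bE; move: ab0; rewrite ?aE ?bE ?eqxx// => _.
- by apply: ne; apply: val_inj; rewrite /= aE bE.
- by have := ab; rewrite aE bE => /edges_asym; rewrite ab'.
Qed.

Definition restrict (w : {set vertex (subst G B) * vertex (subst G B)})
    (E : edge G) : {set vertex B * vertex B} :=
  [set f in edges B | edge_copy E f \in w].

(** The copy of [e] is left out because it contains the root edge; what happens in
    it is recorded by the connection type instead. *)
Definition coarse (e : edge G)
    (w : {set vertex (subst G B) * vertex (subst G B)}) :
    {set vertex G * vertex G} :=
  [set val E | E in [set E in [set~ e] |
     connect (link (restrict w E)) (src B) (tgt B)]].

Lemma connect_ind (T : finType) (r : rel T) (P : T -> Prop) x y :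
  (forall u v, r u v -> P u -> P v) -> P x -> connect r x y -> P y.
Proof.
move=> rP Px /connectP[s sp ->]; elim: s x Px sp => //= z s ih x Px /andP[xz].
by apply: ih; exact: rP xz Px.
Qed.

Lemma connect_link_sym (T : finType) (w : {set T * T}) :
  connect_sym (link w).
Proof. by apply: sym_connect_sym; exact: link_sym. Qed.

Lemma link_edge (T : finType) (w : {set T * T}) x y :
  link w x y -> exists2 f, f \in w & (x, y) = f \/ (x, y) = (f.2, f.1).
Proof. by case/orP => h; [exists (x, y); auto|exists (y, x); auto]. Qed.

Lemma connect_restrict w (E : edge G) u v :
  connect (link (restrict w E)) u v ->
  connect (link w) (copy E u : vertex (subst G B)) (copy E v).
Proof.
move=> uv; apply: (connect_ind (P := fun v => connect (link w)
  (copy E u : vertex (subst G B)) (copy E v)) _ _ uv); last exact: connect0.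
move=> a b ab h; apply: connect_trans h _; apply: connect1.
by case/orP: ab; rewrite inE => /andP[_ abw]; apply/orP; [left|right].
Qed.

Definition end_of (E : edge G) (u : vertex B) : vertex G :=
  if u == src B then (val E).1 else (val E).2.

Definition terminal (u : vertex B) := (u == src B) || (u == tgt B).

Lemma copy_terminal E u : terminal u -> copy E u = inl (end_of E u).
Proof.
rewrite /terminal /end_of => /orP[/eqP ->|/eqP ->].
  by rewrite copy_src eqxx.
by rewrite copy_tgt eq_sym (negbTE (src_neq_tgt B)).
Qed.

Lemma copy_inl E u x : copy E u = inl x -> terminal u /\ x = end_of E u.
Proof.
rewrite /terminal /end_of; case: (copyP E u) => [//|->|->] [<-].
  by rewrite eqxx.
by rewrite eq_sym (negbTE (src_neq_tgt B)) eqxx orbT.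
Qed.

(** The deterministic half of renormalisation. A path that leaves the copy of
    [e] can re-enter it only through an end already reached, so what matters
    inside that copy is which of its ends [S] reaches; every other copy matters
    only through whether it is crossed. *)
Lemma reaches_coarse (e : edge G) (S : {set vertex B})
    (w : {set vertex (subst G B) * vertex (subst G B)}) (x : vertex G) :
  w \subset edges (subst G B) ->
  reaches w (copy e @: S : {set vertex (subst G B)}) (inl x) <->
  exists u, [/\ terminal u, reaches (restrict w e) S u &
    connect (link (coarse e w)) (end_of e u) x].
Proof.
move=> wE; split; last first.
  move=> [u [tu /existsP[s /andP[sS su]] ux]].
  apply/existsP; exists (copy e s); rewrite imset_f//=.
  apply: connect_trans (connect_restrict su) _; rewrite copy_terminal//.
  apply: (connect_ind (P := fun z => connect (link w)
     (inl (end_of e u) : vertex (subst G B)) (inl z)) _ _ ux); last exact: connect0.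
  move=> a b /link_edge[f /imsetP[E]].
  rewrite inE => /andP[_ Est] -> {f} abE h; apply: connect_trans h _.
  have := connect_restrict Est; rewrite copy_src copy_tgt.
  case: abE => [abE|[-> ->]]; last by rewrite connect_link_sym.
  by rewrite -abE.
(* [C] is the part of [G] reached from [S]; [K E v] says how the vertex [v] of the
   copy of [E] is reached, from [S] or from an end in [C]. *)
pose C (z : vertex G) := exists u, [/\ terminal u, reaches (restrict w e) S u &
    connect (link (coarse e w)) (end_of e u) z].
pose K E v := (E = e /\ reaches (restrict w e) S v) \/
  exists u, [/\ terminal u, connect (link (restrict w E)) u v & C (end_of E u)].
(* The only delicate case is the copy of [e], which [coarse] omits: when its two ends
   are joined inside it, [S] itself reaches the second one. *)
have KC E v z : copy E v = inl z -> K E v -> C z.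
  move=> /copy_inl[tv ->] [[-> Sv]|[u [tu uv Cu]]].
    by exists v; split => //; exact: connect0.
  have [->//|nuv] := eqVneq v u.
  have uv' : connect (link (restrict w E)) (src B) (tgt B).
    case/orP: tu nuv uv => /eqP ->; case/orP: tv => /eqP ->; rewrite ?eqxx// => _ h.
    by rewrite connect_link_sym.
  have [Ee|Ene] := eqVneq E e.
    rewrite Ee; move: Cu uv; rewrite Ee => -[t [tt St ttu]] uv.
    have [tv'|ntv] := eqVneq t v; first by exists v; rewrite -tv'; split=> //; exact: connect0.
    have tu' : t = u.
      by case/orP: tu nuv ntv => /eqP ->; case/orP: tv => /eqP ->;
        case/orP: tt => /eqP ->; rewrite ?eqxx.
    exists v; split => //.
    move/existsP: St => [s /andP[sS st]]; apply/existsP; exists s.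
    by rewrite sS /= (connect_trans st)// tu'.
  have step : link (coarse e w) (val E).1 (val E).2.
    apply/orP; left; rewrite -surjective_pairing; apply: imset_f.
    by rewrite !inE Ene uv'.
  case: Cu => t [tt St ttu]; exists t; split => //; apply: connect_trans ttu _.
  have nts : (tgt B == src B) = false by rewrite eq_sym (negbTE (src_neq_tgt B)).
  case/orP: tu nuv => /eqP ->; case/orP: tv => /eqP ->; rewrite /end_of ?eqxx ?nts// => _.
    exact: connect1.
  by rewrite connect_link_sym; exact: connect1.
suff H z : reaches w (copy e @: S : {set vertex (subst G B)}) z ->
    exists E v, z = copy E v /\ K E v.
  by move=> /H[E [v [/esym]]]; exact: KC.
move=> /existsP[_ /andP[/imsetP[s sS ->] sz]].
apply: (connect_ind (P := fun z => exists E v, z = copy E v /\ K E v) _ _ sz);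
  last first.
  exists e, s; split => //; left; split => //.
  by apply/existsP; exists s; rewrite sS connect0.
move=> y {sz}z yz [E [v [yE Kv]]].
have [E0 [v0 [v1 [y0 z0 v01]]]] : exists E0 v0 v1,
    [/\ y = copy E0 v0, z = copy E0 v1 & link (restrict w E0) v0 v1].
  have [f fw yzE] := link_edge yz.
  have /imset2P[E0 f0 _ f0B fE] := fintype.subsetP wE _ fw.
  case: yzE; rewrite fE => -[-> ->].
    exists E0, f0.1, f0.2; split => //; apply/orP; left.
    by rewrite inE -surjective_pairing f0B /edge_copy -fE.
  exists E0, f0.2, f0.1; split => //; apply/orP; right.
  by rewrite inE -surjective_pairing f0B /edge_copy -fE.
exists E0, v1; split => //.
have [tv0|ntv0] := boolP (terminal v0).
  right; exists v0; split => //; first exact: connect1.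
  by apply: (KC E v) => //; rewrite -yE y0 copy_terminal.
have [EE vv] : E0 = E /\ v0 = v.
  move: yE; rewrite y0; move: ntv0; rewrite /terminal.
  case: (copyP E0 v0) => [v' <-|->|->]; rewrite ?eqxx ?orbT//.
  by case: (copyP E v) => [v'' <-|//|//] _ [-> ->].
case: Kv => [[Ee Sv]|[u [tu uv Cu]]]; [left|right].
  split; first by rewrite EE.
  move/existsP: Sv => [s' /andP[s'S sv]]; apply/existsP; exists s'; rewrite s'S /=.
  by apply: connect_trans sv _; rewrite -vv -Ee -EE; exact: connect1.
exists u; rewrite EE; split => //; apply: connect_trans uv _.
by rewrite -vv -EE; exact: connect1.
Qed.

End Renormalisation.

Section RenormalisedProbability.
Import mathcomp.boot.finset.
Variable R : realType.

Definition reach_prob (G : ograph) (p : R) (e : vertex G * vertex G) (j : 'I_3)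
    (X : {set vertex G}) : R :=
  perc_prob p (edges G :\ e) (fun w => [exists x in X, reaches w (end_set e j) x]).

Definition type_prob (B : ograph) (p : R) (f : vertex B * vertex B)
    (i j : 'I_3) : R :=
  perc_prob p (edges B :\ f) (fun w => reach_type w (end_set f j) i).

Variables (G B : ograph).

Let copies (E : edge G) := [set edge_copy E f | f in edges B].

Lemma edges_subst : edges (subst G B) = \bigcup_E copies E.
Proof.
apply/setP => z; apply/imset2P/bigcupP => [[E f _ fB ->]|[E _ /imsetP[f fB ->]]].
  by exists E => //; exact: imset_f.
by exists E f => //; rewrite inE.
Qed.

Lemma edges_substD1 (e : edge G) f : f \in edges B ->
  edges (subst G B) :\ edge_copy e f =
  [set edge_copy e f | f in edges B :\ f] :|: \bigcup_(E in [set~ e]) copies E.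
Proof.
move=> fB; rewrite edges_subst; apply/setP => z; rewrite !inE.
apply/andP/orP => [[zf /bigcupP[E _ /imsetP[g gB zE]]]|[|]].
- have [Ee|Ee] := eqVneq E e.
    left; apply/imsetP; exists g; last by rewrite zE Ee.
    by rewrite !inE gB andbT; apply: contraNneq zf => <-; rewrite zE Ee.
  by right; apply/bigcupP; exists E; rewrite ?inE// zE imset_f.
- move=> /imsetP[g]; rewrite !inE => /andP[gf gB] ->; split.
    by apply: contra gf => /eqP /edge_copy_inj[]// _ ->.
  by apply/bigcupP; exists e => //; exact: imset_f.
- move=> /bigcupP[E]; rewrite !inE => Ee /imsetP[g gB ->]; split.
    by apply: contra Ee => /eqP /edge_copy_inj[]// ->.
  by apply/bigcupP; exists E => //; exact: imset_f.
Qed.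

Lemma copies_disjoint E E' : E != E' -> [disjoint copies E & copies E'].
Proof.
move=> nE; apply/pred0P => z /=; apply/negbTE/negP => /andP[].
move=> /imsetP[f fB ->] /imsetP[f' fB' /edge_copy_inj[]// EE].
by rewrite EE eqxx in nE.
Qed.

Lemma restrict_imset (E : edge G) (w : {set vertex B * vertex B}) :
  w \subset edges B -> restrict [set edge_copy E f | f in w] E = w.
Proof.
move=> wB; apply/setP => f; rewrite inE; apply/andP/idP => [[fB]|fw].
  move=> /imsetP[g gw /edge_copy_inj[]//]; last by move=> _ ->.
  exact: fintype.subsetP wB _ gw.
by split; [exact: fintype.subsetP wB _ fw|exact: imset_f].
Qed.

Lemma end_set_edge_copy (e : edge G) f j :
  end_set (edge_copy e f) j =
  (copy e @: end_set f j : {set vertex (subst G B)}).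
Proof.
case: j => -[|[|[|//]]] lj; rewrite /end_set /= ?imset_set1//.
by rewrite imsetU !imset_set1.
Qed.

(** Renormalisation: percolation of parameter [p] on [subst G B], seen from the
    copy of [e], is percolation of parameter [crossing B p] on [G]; the edge [f]
    of that copy enters only through the ends of the copy that it reaches. *)
Lemma reach_prob_subst (p : R) (e : edge G) f j (X : {set vertex G}) :
  f \in edges B ->
  reach_prob p (edge_copy e f) j [set inl x | x in X] =
  \sum_i type_prob p f i j * reach_prob (crossing B p) (val e) i X.
Proof.
move=> fB.
pose crossed E (w : {set vertex (subst G B) * vertex (subst G B)}) :=
  connect (link (restrict w E)) (src B) (tgt B).
pose H i (D : {set edge G}) : R :=
  ([exists x in X, reaches [set val E | E in D] (end_set (val e) i) x])%:R.
rewrite /reach_prob perc_probE edges_substD1// perc_expU; last first.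
  apply/bigcup_disjointP => E; rewrite !inE => Ee.
  have := copies_disjoint (_ : e != E); rewrite eq_sym => /(_ Ee); apply: disjointWl.
  by apply: imsetS; exact: subsetDl.
transitivity (perc_exp p [set edge_copy e f | f in edges B :\ f] (fun w =>
  \sum_i (reach_type (restrict w e) (end_set f j) i)%:R *
    perc_exp (crossing B p) [set~ e] (H i))); last first.
  rewrite perc_exp_sum; apply: eq_bigr => i _.
  under eq_perc_exp => w _ do rewrite mulrC.
  rewrite perc_expZ mulrC; congr (_ * _).
    rewrite /type_prob perc_probE perc_exp_imset; last first.
      move=> g g'; rewrite !inE => /andP[_ gB] /andP[_ gB'].
      by move=> /edge_copy_inj[].
    apply: eq_perc_exp => w wf; rewrite restrict_imset//.
    by apply: fintype.subset_trans wf _; exact: subsetDl.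
  rewrite perc_probE.
  have -> : edges G :\ val e = [set val E | E in [set~ e]].
    apply/setP => z; rewrite !inE; apply/andP/imsetP => [[ze zG]|[E]].
      by exists (exist _ z zG) => //; rewrite !inE; apply: contra ze => /eqP <-.
    rewrite !inE => Ee ->; split; last exact: valP.
    by apply: contra Ee => /eqP/val_inj ->.
  by rewrite perc_exp_imset//; move=> ? ? _ _; exact: val_inj.
apply: eq_perc_exp => w wf.
transitivity (perc_exp p (\bigcup_(E in [set~ e]) copies E) (fun w' =>
  \sum_i (reach_type (restrict w e) (end_set f j) i)%:R *
   H i [set E in [set~ e] | crossed E (w' :&: copies E)])); last first.
  rewrite perc_exp_sum; apply: eq_bigr => i _; rewrite perc_expZ; congr (_ * _).
  apply: perc_exp_blocks => [E E' _ _|E _]; first exact: copies_disjoint.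
  rewrite perc_exp_imset; last by move=> g g' ? ? /edge_copy_inj[].
  rewrite /crossing perc_probE; apply: eq_perc_exp => w' w'B.
  by rewrite /crossed restrict_imset.
apply: eq_perc_exp => w' w'C.
have we : restrict (w :|: w') e = restrict w e.
  apply/setP => g; rewrite !inE; case gB : (g \in edges B) => //=.
  case gw : (edge_copy e g \in w) => //=; apply/negP.
  move=> /(fintype.subsetP w'C)/bigcupP[E]; rewrite !inE => Ee.
  move=> /imsetP[h hB /edge_copy_inj[]// eE _]; by rewrite eE eqxx in Ee.
have wE : coarse e (w :|: w') =
    [set val E | E in [set E in [set~ e] | crossed E (w' :&: copies E)]].
  suff D : [set E in [set~ e] | crossed E (w :|: w')] =
      [set E in [set~ e] | crossed E (w' :&: copies E)] by rewrite -D.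
  apply/setP => E; rewrite !inE; case Ee: (E != e) => //=.
  rewrite /crossed; suff -> : restrict (w :|: w') E = restrict (w' :&: copies E) E by [].
  apply/setP => g; rewrite !inE; case gB : (g \in edges B) => //=.
  have -> : edge_copy E g \in copies E by exact: imset_f.
  have [/(fintype.subsetP wf)/imsetP[h]|gw] := boolP (edge_copy E g \in w).
    rewrite !inE => /andP[_ hB] /edge_copy_inj[]// EE _.
    by rewrite EE eqxx in Ee.
  by rewrite andbT.
have wsub : w :|: w' \subset edges (subst G B).
  rewrite subUset; apply/andP; split.
    apply: fintype.subset_trans wf _; rewrite edges_subst.
    apply: (fintype.subset_trans (B := mem (copies e))).
      by apply: imsetS; exact: subsetDl.
    exact: bigcup_sup.
  apply: fintype.subset_trans w'C _; rewrite edges_subst.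
  by apply/bigcupsP => E _; exact: bigcup_sup.
have nts : (tgt B == src B) = false by rewrite eq_sym (negbTE (src_neq_tgt B)).
have -> : [exists x in [set inl x | x in X],
      reaches (w :|: w') (end_set (edge_copy e f) j) x] =
   [exists x in X, (reaches (restrict w e) (end_set f j) (src B) &&
        connect (link (coarse e (w :|: w'))) (val e).1 x) ||
     (reaches (restrict w e) (end_set f j) (tgt B) &&
        connect (link (coarse e (w :|: w'))) (val e).2 x)].
  rewrite end_set_edge_copy; apply/existsP/existsP.
    move=> [_ /andP[/imsetP[x xX ->]]] /(reaches_coarse _ _ _ wsub).
    rewrite we => -[u [/orP[]/eqP -> Su]]; rewrite /end_of ?eqxx ?nts => ux.
      by exists x; rewrite xX Su ux.
    by exists x; rewrite xX Su ux orbT.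
  move=> [x /andP[xX /orP[]/andP[Su ux]]]; exists (inl x);
      rewrite imset_f//=; apply/(reaches_coarse _ _ _ wsub).
    by exists (src B); rewrite we /terminal /end_of !eqxx; split.
  by exists (tgt B); rewrite we /terminal /end_of nts eqxx orbT; split.
rewrite /H -wE; move: (coarse _ _) => W.
rewrite !big_ord_recl big_ord0 /reach_type /end_set /= addr0.
have r1 a x : reaches W [set a] x = connect (link W) a x.
  apply/existsP/idP => [[b]|ax]; first by rewrite inE => /andP[/eqP ->].
  by exists a; rewrite inE eqxx.
have r2 a b x : reaches W [set a; b] x = connect (link W) a x || connect (link W) b x.
  apply/existsP/orP => [[c]|[ax|bx]].
  - by rewrite !inE => /andP[/orP[]/eqP ->]; auto.
  - by exists a; rewrite !inE eqxx.
  - by exists b; rewrite !inE eqxx orbT.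
case: (reaches (restrict w e) _ (src B)); case: (reaches (restrict w e) _ (tgt B));
  rewrite /= ?mul0r ?mul1r ?add0r ?addr0.
- by congr (_%:R); congr nat_of_bool; apply: eq_existsb => x; rewrite r2.
- by congr (_%:R); congr nat_of_bool; apply: eq_existsb => x; rewrite r1 orbF.
- by congr (_%:R); congr nat_of_bool; apply: eq_existsb => x; rewrite r1.
- case: existsP => // -[x]; by rewrite andbF.
Qed.

Lemma sum_edges_subst (F : vertex (subst G B) * vertex (subst G B) -> R) :
  \sum_(g in edges (subst G B)) F g =
  \sum_(e : edge G) \sum_(f in edges B) F (edge_copy e f).
Proof.
rewrite /= /subst_edges curry_imset2X big_imset /=; last first.
  move=> [E f] [E' f']; rewrite !inE /= => fB fB' h.
  by have [-> ->] := edge_copy_inj fB fB' h.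
by rewrite pair_big_dep /=; apply: eq_big => [[E f]|[E f] _]; rewrite ?inE.
Qed.

End RenormalisedProbability.

(** * Distances in substituted graphs *)

Section Distances.
Import mathcomp.boot.finset.

Definition within (G : ograph) (r : nat) (x y : vertex G) : Prop :=
  exists s, [/\ (size s <= r)%N, path (link (edges G)) x s & last x s = y].

Definition near (G : ograph) (r : nat) (e : vertex G * vertex G) (x : vertex G) : bool :=
  [exists n : 'I_r.+1, walk n e.1 x || walk n e.2 x].

Definition far (G : ograph) (r : nat) (e : vertex G * vertex G) : {set vertex G} :=
  [set x | ~~ near r e x].

Lemma nearP (G : ograph) r (e : vertex G * vertex G) x :
  reflect (within r e.1 x \/ within r e.2 x) (near r e x).
Proof.
have toW n z : (n <= r)%N -> walk n z x -> within r z x.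
  move=> nr /existsP[s /andP[sp /eqP sx]]; exists s; split => //.
  by rewrite size_tuple.
have ofW z : within r z x -> exists2 n, (n < r.+1)%N & walk n z x.
  move=> [s [sr sp sx]]; exists (size s) => //.
  by apply/existsP; exists (in_tuple s); rewrite /= sp sx eqxx.
apply: (iffP existsP) => [[n /orP[]]|[] /ofW[n nr nx]].
- by move=> h; left; apply: toW h; rewrite -ltnS.
- by move=> h; right; apply: toW h; rewrite -ltnS.
- by exists (Ordinal nr); rewrite nx.
- by exists (Ordinal nr); rewrite nx orbT.
Qed.

Lemma within_trans (G : ograph) r r' (x y z : vertex G) :
  within r x y -> within r' y z -> within (r + r') x z.
Proof.
move=> [s [sr sp sy]] [t [tr tp tz]]; exists (s ++ t); split.
- by rewrite size_cat leq_add.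
- by rewrite cat_path sp sy.
- by rewrite last_cat sy.
Qed.

Lemma near_within (G : ograph) r r' e (y z : vertex G) :
  near r e y -> within r' y z -> near (r + r') e z.
Proof.
move=> /nearP h yz; apply/nearP.
by case: h => h; [left|right]; exact: within_trans h yz.
Qed.

Lemma near_le (G : ograph) r r' e (y : vertex G) :
  (r <= r')%N -> near r e y -> near r' e y.
Proof.
move=> rr /nearP h; apply/nearP.
by case: h => -[s [sr sp sy]]; [left|right]; exists s; split=> //; exact: leq_trans rr.
Qed.

Lemma ex_near (G : ograph) e (x : vertex G) : exists r, near r e x.
Proof.
have [n nx] := ex_walk e.1 x; exists n; apply/existsP; exists (Ordinal (ltnSn n)).
by rewrite nx.
Qed.

Definition dist_edge (G : ograph) e (x : vertex G) := ex_minn (ex_near e x).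

Lemma near_dist (G : ograph) r e (x : vertex G) : near r e x = (dist_edge e x <= r)%N.
Proof.
rewrite /dist_edge; case: ex_minnP => n nn nmin.
by apply/idP/idP => [/nmin//|nr]; exact: near_le nn.
Qed.

Lemma dist_edge_link (G : ograph) e (x y : vertex G) :
  link (edges G) x y -> (dist_edge e y <= (dist_edge e x).+1)%N.
Proof.
move=> xy; rewrite -near_dist -addn1; apply: (@near_within _ _ _ _ x).
  by rewrite near_dist.
by exists [:: y]; rewrite /= xy.
Qed.

Variables (G B : ograph).

(** The vertices that copies share with [G] sit at even heights, and the interior
    of a copy at the mean of the heights of its ends; the steps of
    [subst G B] change this height by at most one when [B] has no edge
    between its ends, so that distances at least double. *)
Definition height (e : vertex G * vertex G) (z : vertex (subst G B)) : nat :=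
  match z with
  | inl x => (dist_edge e x).*2
  | inr (E, _) => dist_edge e (val E).1 + dist_edge e (val E).2
  end.

Hypothesis nadj : ~~ link (edges B) (src B) (tgt B).

Lemma height_link e z z' : link (edges (subst G B)) z z' ->
  (height e z' <= (height e z).+1)%N.
Proof.
have H E u v : link (edges B) u v ->
    (height e (copy E v : vertex (subst G B)) <= (height e (copy E u)).+1)%N.
  have E12 : link (edges G) (val E).1 (val E).2.
    by apply/orP; left; rewrite -surjective_pairing; exact: valP.
  have E21 : link (edges G) (val E).2 (val E).1 by rewrite link_sym.
  have l12 := dist_edge_link e E12; have l21 := dist_edge_link e E21.
  move=> uv; case: (copyP E u) uv => [u' _|->|->]; case: (copyP E v) => [v' _|->|->] uv.
  all: try (move: l12 l21; rewrite /=; lia).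
  by have := nadj; rewrite link_sym uv.
case/orP => /imset2P[E f _ fB [-> ->]]; apply: H; apply/orP; [left|right];
  by rewrite -surjective_pairing.
Qed.

(** Height zero on the copy of [e] and steps at most one. *)
Lemma near_copy_half r (e : edge G) (f : vertex B * vertex B) (x : vertex G) :
  near r (edge_copy e f) (inl x) -> near r./2 (val e) x.
Proof.
have d0 : dist_edge (val e) (val e).1 = 0%N /\ dist_edge (val e) (val e).2 = 0%N.
  by split; apply/eqP; rewrite -leqn0 -near_dist; apply/nearP; [left|right]; exists [::].
have h0 v : height (val e) (copy e v : vertex (subst G B)) = 0%N.
  by move: d0 => /= [d1 d2]; case: (copyP e v) => [v' _|_|_]; rewrite /= ?d1 ?d2.
have Hp s z : path (link (edges (subst G B))) z s ->
    (height (val e) (last z s) <= height (val e) z + size s)%N.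
  elim: s z => [|a s ih] z /=; first by rewrite addn0.
  move=> /andP[za /ih h]; apply: leq_trans h _.
  by rewrite addnS -addSn leq_add2r; exact: height_link.
move/nearP => h; rewrite near_dist.
suff [s sr sx] : exists2 s : seq (vertex (subst G B)), (size s <= r)%N &
    ((dist_edge (val e) x).*2 <= size s)%N by rewrite geq_half_double; exact: leq_trans sx sr.
case: h => -[s [sr /Hp sp sx]]; exists s => //; move: sp;
  by rewrite sx /edge_copy /= h0.
Qed.

Let nB := #|vertex B|.

Lemma within_copy (E : edge G) u v :
  within nB (copy E u : vertex (subst G B)) (copy E v).
Proof.
have /connectP[s0 s0p ->] := ograph_connected u v.
case/shortenP: s0p => s sp us _; exists (map (copy E) s); split.
- rewrite size_map /nB; apply: leq_trans (max_card (mem (u :: s))).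
  by move/card_uniqP: us => ->.
- elim: s u sp {us} => //= a s ih u /andP[ua sp].
  by rewrite link_copy//=; exact: ih.
- by rewrite (last_map (copy E)).
Qed.

Lemma near_edge_copy (e : edge G) (f : vertex B * vertex B) v :
  near nB (edge_copy e f) (copy e v : vertex (subst G B)).
Proof. by apply/nearP; left; exact: within_copy. Qed.

Lemma near_inl r (e : edge G) (f : vertex B * vertex B) x :
  near r (val e) x -> near (nB * r.+1) (edge_copy e f) (inl x : vertex (subst G B)).
Proof.
have link_inl y z : link (edges G) y z ->
    within nB (inl y : vertex (subst G B)) (inl z).
  case/orP => h.
    have := within_copy (exist _ (y, z) h) (src B) (tgt B).
    by rewrite copy_src copy_tgt.
  have := within_copy (exist _ (z, y) h) (tgt B) (src B).
  by rewrite copy_src copy_tgt.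
have paths s y : path (link (edges G)) y s ->
    within (nB * size s) (inl y : vertex (subst G B)) (inl (last y s)).
  elim: s y => [|a s ih] y /=; first by exists [::].
  by move=> /andP[ya /ih h]; rewrite mulnS; apply: within_trans h; exact: link_inl.
move=> /nearP[] [s [sr sp <-]].
  apply: (@near_le _ (nB + nB * size s)); first by rewrite mulnS leq_add2l leq_mul.
  apply: near_within (paths _ _ sp); rewrite -(copy_src B).
  exact: near_edge_copy.
apply: (@near_le _ (nB + nB * size s)); first by rewrite mulnS leq_add2l leq_mul.
apply: near_within (paths _ _ sp); rewrite -(copy_tgt B).
exact: near_edge_copy.
Qed.

(** Going far from an edge of [subst G B] requires visiting a vertex of [G] that
    is far from the edge of [G] whose copy contains it. *)
Lemma reaches_far r (e : edge G) f j
    (w : {set vertex (subst G B) * vertex (subst G B)}) z :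
  f \in edges B -> w \subset edges (subst G B) ->
  z \in far (nB * r.+2) (edge_copy e f) ->
  reaches w (end_set (edge_copy e f) j) z ->
  [exists y in [set inl x | x in far r (val e)],
     reaches w (end_set (edge_copy e f) j) y].
Proof.
move=> fB wE; rewrite inE => zfar Sz.
case: z Sz zfar => [x|[E v']] Sz zfar.
  apply/existsP; exists (inl x); rewrite Sz andbT imset_f// inE.
  apply: contra zfar => /(near_inl f); apply: near_le.
  by rewrite leq_mul.
have cv' : copy E (val v') = inr (E, v') by rewrite /copy valK.
have Ene : E != e.
  apply: contra zfar => /eqP Ee; move: cv'; rewrite Ee => <-.
  by apply: near_le (near_edge_copy e f (val v')); rewrite leq_pmulr.
move/existsP: Sz => [s /andP[sS sz]].
have [v0 s0] : exists v0, s = copy e v0.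
  move: sS; rewrite end_set_edge_copy => /imsetP[v0 _ ->]; by exists v0.
have [x [xE sx]] : exists x, (x = (val E).1 \/ x = (val E).2) /\
    connect (link w) s (inl x).
  pose P (y : vertex (subst G B)) := connect (link w) s y /\
    forall u, y = inr (E, u) ->
    exists x, (x = (val E).1 \/ x = (val E).2) /\ connect (link w) s (inl x).
  suff [_ /(_ _ erefl)] : P (inr (E, v')) by [].
  apply: (connect_ind (P := P) _ _ sz); last first.
    split => // u; rewrite s0; case: (copyP e v0) => [u' _ [ee _]|//|//].
    by rewrite ee eqxx in Ene.
  move=> a b ab [sa ha]; split; first exact: connect_trans sa (connect1 ab).
  move=> u bu; case: a ab sa ha => [a|[E' u']] ab sa ha; last first.
    apply: (ha u'); congr (inr (_, _)).
    have [g gw gE] := link_edge ab; have /imset2P[E0 f0 _ _ g0] := fintype.subsetP wE _ gw.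
    move: gE; rewrite bu g0; case: (copyP E0 f0.1) => [? _|_|_]; case: (copyP E0 f0.2) => [? _|_|_] [] [] //.
      by move=> -> _ ->.
    by move=> -> _ ->.
  exists a; split => //.
  have [g gw gE] := link_edge ab; have /imset2P[E0 f0 _ _ g0] := fintype.subsetP wE _ gw.
  move: gE; rewrite bu g0; case: (copyP E0 f0.1) => [? _|_|_]; case: (copyP E0 f0.2) => [? _|_|_] [] [] //.
  - by move=> -> ->; left.
  - by move=> -> ->; right.
  - by move=> -> ->; left.
  - by move=> -> ->; right.
apply/existsP; exists (inl x); apply/andP; split; last first.
  by apply/existsP; exists s; rewrite sS.
rewrite imset_f// inE; apply: contra zfar => /(near_inl f) h.
rewrite -[r.+2]addn1 mulnDr muln1 -cv'; apply: (near_within h).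
case: xE => ->; first by rewrite -(copy_src B); exact: within_copy.
by rewrite -(copy_tgt B); exact: within_copy.
Qed.

End Distances.

(** * Averages over the edges of hierarchical graphs *)

Section HierarchicalSums.
Import mathcomp.boot.finset.
Variable R : realType.

Lemma gdist_gt1_nadj (G : ograph) (x y : vertex G) :
  (1 < gdist x y)%N -> ~~ link (edges G) x y.
Proof.
rewrite /gdist; case: ex_minnP => n _ nmin; apply: contraL => xy.
rewrite -leqNgt; apply: nmin; apply/existsP; exists [tuple y].
by rewrite /= xy eqxx.
Qed.

Lemma perc_prob_ge0 (V : finType) (p : R) (F : {set V * V}) A : 0 <= p <= 1 ->
  0 <= perc_prob p F A.
Proof.
by move=> p01; apply: sumr_ge0 => w _; exact: perc_weight_ge0.
Qed.

Lemma perc_prob_le1 (V : finType) (p : R) (F : {set V * V}) A : 0 <= p <= 1 ->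
  perc_prob p F A <= 1.
Proof.
move=> p01; rewrite perc_probE -[leRHS](perc_exp_cst p 1 F).
by apply: le_perc_exp => // w _; case: (A w).
Qed.

Lemma le_perc_prob (V : finType) (p : R) (F : {set V * V})
    (A A' : pred {set V * V}) : 0 <= p <= 1 ->
  (forall w : {set V * V}, w \subset F -> A w -> A' w) ->
  perc_prob p F A <= perc_prob p F A'.
Proof.
move=> p01 AA; rewrite !perc_probE; apply: le_perc_exp => // w /AA.
by case: (A w) => [->|_] //; case: (A' w).
Qed.

Lemma crossing_in01 (G : ograph) (p : R) : 0 <= p <= 1 -> 0 <= crossing G p <= 1.
Proof. by move=> p01; rewrite /crossing perc_prob_ge0// perc_prob_le1. Qed.

Lemma iter_crossing_in01 (G : ograph) n (p : R) : 0 <= p <= 1 ->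
  0 <= iter n (crossing G) p <= 1.
Proof. by move=> p01; elim: n => //= n; exact: crossing_in01. Qed.

Lemma sum_edge (G : ograph) (F : vertex G * vertex G -> R) :
  \sum_(e : edge G) F (val e) = \sum_(e in edges G) F e.
Proof.
rewrite [RHS](reindex_omap (val : edge G -> _) insub) /=; last first.
  by move=> e eG; rewrite insubT.
by apply: eq_bigl => e; rewrite (valP e) valK eqxx.
Qed.

Lemma cluster_matrixE (G : ograph) (p : R) i j :
  cluster_matrix G p i j = \sum_(f in edges G) type_prob p f i j.
Proof.
by rewrite /cluster_matrix summxE; apply: eq_bigr => f _; rewrite mxE.
Qed.

Lemma cluster_matrix_ge0 (G : ograph) (p : R) i j : 0 <= p <= 1 ->
  0 <= cluster_matrix G p i j.
Proof.
by move=> p01; rewrite cluster_matrixE; apply: sumr_ge0 => f _; exact: perc_prob_ge0.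
Qed.

Lemma sum_reach_prob_subst (G B : ograph) (p : R) j
    (X : vertex G * vertex G -> {set vertex G}) :
  \sum_(e : edge G) \sum_(f in edges B)
     reach_prob p (edge_copy e f) j [set inl x | x in X (val e)] =
  \sum_i (\sum_(e in edges G) reach_prob (crossing B p) e i (X e)) *
     cluster_matrix B p i j.
Proof.
under eq_bigr => e _ do under eq_bigr => f fB do rewrite reach_prob_subst//.
under eq_bigr => e _ do rewrite exchange_big.
rewrite exchange_big; apply: eq_bigr => i _.
rewrite -sum_edge mulr_suml; apply: eq_bigr => e _.
by rewrite -mulr_suml mulrC cluster_matrixE.
Qed.

Variable G1 : ograph.
Hypothesis nadj : ~~ link (edges G1) (src G1) (tgt G1).

(** The parameter runs through the iterates of the crossing probability because
    the scales of the hierarchical graph see percolation renormalised. *)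
Fixpoint type_prod (p : R) (n : nat) : 'M[R]_3 :=
  if n is n'.+1 then type_prod (crossing G1 p) n' *m cluster_matrix G1 p
  else 1%:M.

Lemma type_prodSr p n : type_prod p n.+1 =
  cluster_matrix G1 (iter n (crossing G1) p) *m type_prod p n.
Proof.
elim: n p => [|n ih] p; first by rewrite /= mul1mx mulmx1.
by rewrite [LHS]/= -/(type_prod _ n.+1) ih -mulmxA -iterSr.
Qed.

Lemma type_prodD p m n : type_prod p (m + n) =
  type_prod (iter n (crossing G1) p) m *m type_prod p n.
Proof.
elim: n p => [|n ih] p; first by rewrite addn0 mulmx1.
by rewrite addnS [LHS]/= ih [in RHS]/= mulmxA -iterSr.
Qed.

Lemma type_prod_ge0 p n i j : 0 <= p <= 1 -> 0 <= type_prod p n i j.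
Proof.
elim: n p i j => [|n ih] p i j p01; first by rewrite mxE; case: (_ == _).
rewrite mxE; apply: sumr_ge0 => l _; rewrite mulr_ge0 ?cluster_matrix_ge0//.
by apply: ih; exact: crossing_in01.
Qed.

Lemma card_edges_hier k : #|edges (hier G1 k)| = (#|edges G1| ^ k)%N.
Proof.
elim: k => [|k ih]; first by rewrite /= cards1.
have inj : {in setX [set: edge (hier G1 k)] (edges G1) &,
    injective (uncurry (fun e f => edge_copy e f))}.
  move=> [E f] [E' f']; rewrite !inE /= => fB fB' /edge_copy_inj.
  by move=> /(_ fB fB')[-> ->].
have -> : edges (hier G1 k.+1) = edges (subst (hier G1 k) G1) by [].
rewrite /= /subst_edges curry_imset2X card_in_imset// cardsX cardsT card_sig.
by rewrite expnSr -ih; congr (_ * _)%N; apply: eq_card.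
Qed.

Lemma sum_reach_hier k p j :
  \sum_(e in edges (hier G1 k))
     reach_prob p e j [set src (hier G1 k); tgt (hier G1 k)] =
  \sum_i type_prod p k i j.
Proof.
elim: k p j => [|k ih] p j.
  rewrite /= big_set1 /reach_prob setDv perc_probE perc_exp_set0.
  case: existsP => [_|[]].
    by rewrite (bigD1 j)//= mxE eqxx big1 ?addr0// => i ij; rewrite mxE (negbTE ij).
  have [s sj] : exists s, s \in end_set (false, true) j.
    by case: j => -[|[|[|//]]] lj;
      [exists false|exists true|exists true]; rewrite /end_set /= !inE.
  exists s; apply/andP; split; first by case: s {sj}; rewrite !inE.
  by apply/existsP; exists s; rewrite sj connect0.
rewrite sum_edges_subst.
have -> : [set src (hier G1 k.+1); tgt (hier G1 k.+1)] =
    [set inl x | x in [set src (hier G1 k); tgt (hier G1 k)]].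
  by rewrite imsetU !imset_set1.
rewrite (sum_reach_prob_subst G1 p j (fun=> [set src (hier G1 k); tgt (hier G1 k)])).
under eq_bigr => i _ do rewrite ih mulr_suml.
by rewrite exchange_big; apply: eq_bigr => i _; rewrite [in RHS]/= mxE.
Qed.

(** A vertex outside the ball of radius [radius n] around an edge of [G_(k+n)] lies
    outside the copy of [G_n] that contains the edge. *)
Definition radius n : nat := iter n (fun r => #|vertex G1| * r.+2)%N 0%N.

(** Peeling off the last [n] substitutions, each of which contributes one factor
    to the product; what remains is at most one for each edge of [G_k]. *)
Lemma sum_far_hier k n p j : 0 <= p <= 1 ->
  \sum_(e in edges (hier G1 (k + n))) reach_prob p e j (far (radius n) e) <=
  #|edges G1|%:R ^+ k * \sum_i type_prod p n i j.
Proof.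
elim: n p j => [|n ih] p j p01.
  have -> : \sum_i type_prod p 0 i j = 1.
    by rewrite (bigD1 j)//= mxE eqxx big1 ?addr0// => i ij; rewrite mxE (negbTE ij).
  rewrite mulr1 -natrX -card_edges_hier addn0 -sum1_card natr_sum.
  by apply: ler_sum => e _; exact: perc_prob_le1.
rewrite addnS sum_edges_subst.
apply: (@le_trans _ _ (\sum_(e : edge (hier G1 (k + n))) \sum_(f in edges G1)
    reach_prob p (edge_copy e f) j [set inl x | x in far (radius n) (val e)])).
  apply: ler_sum => e _; apply: ler_sum => f fB; apply: le_perc_prob => // w wE.
  move=> /existsP[z /andP[zf Sz]]; apply: reaches_far Sz => //.
  by apply: fintype.subset_trans wE _; exact: subsetDl.
rewrite (sum_reach_prob_subst G1 p j (far (radius n))).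
rewrite mulr_sumr; under [leRHS]eq_bigr => i _ do rewrite [type_prod _ _]/= mxE mulr_sumr.
rewrite exchange_big /=; apply: ler_sum => i _.
under [leRHS]eq_bigr => l _ do rewrite mulrA.
rewrite -mulr_suml -mulr_sumr ler_wpM2r ?cluster_matrix_ge0//.
by apply: ih; exact: crossing_in01.
Qed.

Definition near_ends k r : {set vertex (hier G1 k) * vertex (hier G1 k)} :=
  [set e in edges (hier G1 k) |
    near r e (src (hier G1 k)) || near r e (tgt (hier G1 k))].

(** An edge far from both distinguished vertices goes far as soon as it reaches
    one of them. *)
Lemma sum_far_hier_ge k r p j : 0 <= p <= 1 ->
  \sum_i type_prod p k i j - #|near_ends k r|%:R <=
  \sum_(e in edges (hier G1 k)) reach_prob p e j (far r e).
Proof.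
move=> p01; rewrite -sum_reach_hier lerBlDr.
have -> : #|near_ends k r|%:R = \sum_(e in edges (hier G1 k)) (e \in near_ends k r)%:R :> R.
  rewrite -sum1_card natr_sum [RHS](bigID [in near_ends k r]) /= [X in _ + X]big1 ?addr0.
    apply: eq_big => [e|e eE]; last by rewrite eE.
    by rewrite !inE; case: (e \in edges _); rewrite ?andbF.
  by move=> e /andP[_ /negbTE ->].
rewrite -big_split; apply: ler_sum => e eE /=.
case en: (e \in near_ends k r).
  by rewrite -[leLHS]add0r lerD// ?perc_prob_ge0// perc_prob_le1.
rewrite addr0; apply: le_perc_prob => // w _ /existsP[z /andP[zX Sz]].
apply/existsP; exists z; rewrite Sz andbT inE.
move: en; rewrite inE eE /= => /negbT; rewrite negb_or => /andP[e1 e2].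
by move: zX; rewrite !inE => /orP[]/eqP ->.
Qed.

Lemma near_endsS k r : (#|near_ends k.+1 r| <= #|edges G1| * #|near_ends k r./2|)%N.
Proof.
have sub : near_ends k.+1 r \subset [set g | [exists e : edge (hier G1 k),
    (val e \in near_ends k r./2) && [exists f in edges G1, g == edge_copy e f]]].
  apply/fintype.subsetP => g; rewrite !inE => /andP[/imset2P[e f _ fB ge]].
  rewrite ge => /orP h; apply/existsP; exists e; apply/andP; split; last first.
    by apply/existsP; exists f; rewrite fB eqxx.
  rewrite inE (valP e) /=; apply/orP.
  case: h => h; [left|right]; exact: (near_copy_half nadj h).
pose N := [set e : edge (hier G1 k) | val e \in near_ends k r./2].
apply: (@leq_trans #|[set edge_copy e f | e in N, f in edges G1]|).
  apply: subset_leq_card; apply: fintype.subset_trans sub _.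
  apply/fintype.subsetP => g; rewrite inE => /existsP[e /andP[eN]].
  by move=> /existsP[f /andP[fB /eqP ->]]; apply/imset2P; exists e f => //; rewrite inE.
rewrite curry_imset2X; apply: leq_trans (leq_imset_card _ _) _.
rewrite cardsX mulnC leq_mul2l; apply/orP; right.
rewrite -(card_imset _ val_inj); apply: subset_leq_card.
by apply/fintype.subsetP => _ /imsetP[e + ->]; rewrite inE.
Qed.

Lemma near0 (G : ograph) e (x : vertex G) : near 0 e x = (x == e.1) || (x == e.2).
Proof.
apply/nearP/orP => [[]|[]/eqP ->].
- by move=> [[|a s] [//= _ _ <-]]; left.
- by move=> [[|a s] [//= _ _ <-]]; right.
- by left; exists [::].
- by right; exists [::].
Qed.

Lemma ex_link (G : ograph) (u : vertex G) : exists v, link (edges G) u v.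
Proof.
have [v uv] : exists v, v != u.
  have [us|] := eqVneq u (src G); last by exists (src G); rewrite eq_sym.
  by exists (tgt G); rewrite us eq_sym; exact: src_neq_tgt.
have /connectP[[|w s] /=] := ograph_connected u v; first by move=> _ vu; rewrite vu eqxx in uv.
by move=> /andP[uw _] _; exists w.
Qed.

Lemma terminal_link u v : terminal u -> terminal v -> ~~ link (edges G1) u v.
Proof.
move=> /orP[]/eqP -> /orP[]/eqP ->; rewrite ?nadj// 1?link_sym ?nadj//.
  by rewrite /link (negbTE (edges_irr _)).
by rewrite /link (negbTE (edges_irr _)).
Qed.

Lemma subst_inl_nadj (G : ograph) (x y : vertex G) :
  ~~ link (edges (subst G G1)) (inl x) (inl y).
Proof.
have H (E : edge G) u v a b : (u, v) \in edges G1 ->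
    copy E u = inl a :> vertex (subst G G1) ->
    copy E v = inl b :> vertex (subst G G1) -> false.
  move=> uv /copy_inl[tu _] /copy_inl[tv _].
  by have := terminal_link tu tv; rewrite /link uv.
apply/negP => /orP[] /imset2P[E [u v] _ uv [/esym eu /esym ev]].
  by have := H _ _ _ _ _ uv eu ev.
by have := H _ _ _ _ _ uv eu ev.
Qed.

Lemma near0_copy (G : ograph) (e : edge G) f (x : vertex G) :
  near 0 (edge_copy e f) (inl x : vertex (subst G G1)) ->
  exists u, [/\ terminal u, x = end_of e u & (u = f.1) \/ (u = f.2)].
Proof.
by rewrite near0 => /orP[]/eqP/esym/copy_inl[tu xu];
  [exists f.1|exists f.2]; split; auto.
Qed.

Lemma near0_end_of (G : ograph) (e : edge G) u : near 0 (val e) (end_of (B := G1) e u).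
Proof. by rewrite near0 /end_of; case: ifP => _; rewrite eqxx ?orbT. Qed.

(** For [k > 0] no edge of [G_k] joins its two distinguished vertices. An edge at one
    of them is replaced by a copy of [G_1] which has an edge at its other end, and
    that edge is away from both distinguished vertices of [G_(k+1)]. *)
Lemma near_ends0S k :
  (#|near_ends k.+2 0| <= #|edges G1|.-1 * #|near_ends k.+1 0|)%N.
Proof.
pose N := [set e : edge (hier G1 k.+1) | val e \in near_ends k.+1 0].
pose D e := [set f in edges G1 | edge_copy e f \in near_ends k.+2 0].
have sub : near_ends k.+2 0 \subset \bigcup_(e in N) [set edge_copy e f | f in D e].
  apply/fintype.subsetP => g gN; have := gN; rewrite inE => /andP[].
  move=> /imset2P[e f _ fB ge] gn; apply/bigcupP; exists e; last first.
    by apply/imsetP; exists f => //; rewrite inE fB -[edge_copy _ _]ge.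
  rewrite !inE (valP e) /=.
  by apply/orP; case/orP: gn; rewrite ge => /near0_copy[u [_ xu _]];
    have := near0_end_of e u; rewrite -xu => h; [left|right].
have cD e : e \in N -> (#|D e| <= #|edges G1|.-1)%N.
  rewrite !inE (valP e) /= => eN.
  have [u [tu eu]] : exists u : vertex G1, terminal u /\
      (end_of e u == src (hier G1 k.+1)) || (end_of e u == tgt (hier G1 k.+1)).
    have t1 : terminal (src G1) by rewrite /terminal eqxx.
    have t2 : terminal (tgt G1) by rewrite /terminal eqxx orbT.
    have e1 : end_of e (src G1) = (val e).1 by rewrite /end_of eqxx.
    have e2 : end_of e (tgt G1) = (val e).2.
      by rewrite /end_of eq_sym (negbTE (src_neq_tgt _)).
    move: eN; rewrite !near0 => /orP[] /orP[]/eqP h.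
    - by exists (src G1); rewrite e1; split => //; apply/orP; left; apply/eqP/esym.
    - by exists (tgt G1); rewrite e2; split => //; apply/orP; left; apply/eqP/esym.
    - by exists (src G1); rewrite e1; split => //; apply/orP; right; apply/eqP/esym.
    - by exists (tgt G1); rewrite e2; split => //; apply/orP; right; apply/eqP/esym.
  have [u' [tu' nu ends]] : exists u', [/\ terminal u', u' != u &
      link (edges (hier G1 k.+1)) (end_of e u) (end_of e u')].
    have lk : link (edges (hier G1 k.+1)) (val e).1 (val e).2.
      by apply/orP; left; rewrite -surjective_pairing; exact: valP.
    have nts := negbTE (src_neq_tgt G1).
    case/orP: tu => /eqP ->; [exists (tgt G1)|exists (src G1)];
      rewrite /terminal /end_of ?eqxx ?(eq_sym (tgt _)) ?nts ?orbT; split => //.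
    by rewrite link_sym.
  have [v u'v] := ex_link u'.
  have [f fB fu'] : exists2 f, f \in edges G1 & (f = (u', v)) \/ (f = (v, u')).
    by case/orP: u'v; [exists (u', v)|exists (v, u')]; auto.
  have ntv : ~~ terminal v by apply: contraL u'v; exact: terminal_link.
  have fND : f \notin D e.
    have no x : x = src (hier G1 k.+1) \/ x = tgt (hier G1 k.+1) ->
        ~~ near 0 (edge_copy e f) (inl x : vertex (subst (hier G1 k.+1) G1)).
      move=> xst; apply/negP => /near0_copy[t [tt xt tf]].
      have tu'_ : t = u'.
        by case: fu' tf => -> /= [] // tv; rewrite tv (negbTE ntv) in tt.
      move: ends; rewrite -tu'_ -xt.
      case/orP: eu => /eqP ->; case: xst => ->.
      - by rewrite /link (negbTE (edges_irr _)).
      - exact/negP/subst_inl_nadj.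
      - exact/negP/subst_inl_nadj.
      - by rewrite /link (negbTE (edges_irr _)).
    rewrite !inE fB /= negb_and negb_or; apply/orP; right; apply/andP; split;
      by apply: no; auto.
  rewrite [#|edges G1|](cardsD1 f) fB /=; apply: subset_leq_card.
  apply/fintype.subsetP => g gD; rewrite !inE; apply/andP; split.
    by apply: contraNneq fND => <-.
  by move: gD; rewrite inE => /andP[].
apply: leq_trans (subset_leq_card sub) _.
apply: (@leq_trans (\sum_(e in N) #|edges G1|.-1)%N).
  elim/big_rec2: _ => [|e n A eN ih]; first by rewrite cards0.
  apply: leq_trans (leq_card_setU _ _) _; apply: leq_add ih.
  by apply: leq_trans (leq_imset_card _ _) _; exact: cD.
rewrite sum_nat_const mulnC leq_mul2l; apply/orP; right.
rewrite -(card_imset _ val_inj); apply: subset_leq_card.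
by apply/fintype.subsetP => _ /imsetP[e + ->]; rewrite inE.
Qed.

(** Halving the radius [j] times brings it to zero, where the bound on the edges at
    the distinguished vertices applies. *)
Lemma card_near_ends j r k : (r < 2 ^ j)%N ->
  (#|near_ends (k + j).+1 r| <= #|edges G1| ^ j.+1 * #|edges G1|.-1 ^ k)%N.
Proof.
elim: j r => [|j ih] r rj.
  have -> : r = 0%N by move: rj; rewrite expn0; case: r.
  rewrite addn0 expn1; elim: k {rj} => [|k ih].
    rewrite expn0 muln1 -[X in (_ <= X)%N](expn1 #|edges G1|) -card_edges_hier.
    by apply: subset_leq_card; apply/fintype.subsetP => e; rewrite inE => /andP[].
  apply: leq_trans (near_ends0S k) _.
  by rewrite expnS mulnCA leq_mul2l ih orbT.
rewrite addnS expnS -mulnA; apply: leq_trans (near_endsS _ _) _.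
by rewrite leq_mul2l ih ?orbT// ltn_half_double -mul2n -expnS.
Qed.

End HierarchicalSums.

Section RootEdge.
Import mathcomp.boot.finset.

(** Started from both ends of [e], a cluster does not depend on the state
    of [e]. *)
Lemma reaches_root_edge (V : finType) (e : V * V) (w : {set V * V}) (x : V) :
  reaches (e |: w) [set e.1; e.2] x = reaches w [set e.1; e.2] x.
Proof.
apply/existsP/existsP => -[s /andP[sS sx]]; last first.
  exists s; rewrite sS; apply: connect_sub sx => u v uv; apply: connect1.
  by case/orP: uv => uv; apply/orP; [left|right]; rewrite inE uv orbT.
have [s' [s'S s'x]] : exists s', s' \in [set e.1; e.2] /\ connect (link w) s' x.
  apply: (connect_ind (P := fun y => exists s', s' \in [set e.1; e.2] /\
     connect (link w) s' y) _ _ sx); last by exists s.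
  move=> u v uv [s' [s'S s'u]].
  have [vS|vS] := boolP (v \in [set e.1; e.2]); first by exists v.
  exists s'; split => //; apply: connect_trans s'u (connect1 _).
  move: vS uv; rewrite /link !inE negb_or => /andP[v1 v2].
  have ne1 : ((u, v) == e) = false by apply: contraNF v2 => /eqP <-.
  have ne2 : ((v, u) == e) = false by apply: contraNF v1 => /eqP <-.
  by rewrite ne1 ne2.
by exists s'; rewrite s'S.
Qed.

Lemma reach_prob_root (R : realType) (G : ograph) (p : R)
    (e : vertex G * vertex G) (X : {set vertex G}) : e \in edges G ->
  perc_exp p (edges G)
    (fun w => ([exists x in X, reaches w (end_set e ord_max) x])%:R) =
  reach_prob p e ord_max X.
Proof.
move=> eG; rewrite -[in LHS](setD1K eG) perc_expU1 ?inE ?eqxx//.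
rewrite /reach_prob perc_probE.
under eq_perc_exp => w _ do under eq_existsb => x do rewrite reaches_root_edge.
by rewrite -mulrDl subrKC mul1r.
Qed.

End RootEdge.

(** * Positivity of the matrix of connection types *)

Section MatrixEntries.
Import mathcomp.boot.finset.
Variables (R : realType) (G : ograph).
Hypothesis nadj : ~~ link (edges G) (src G) (tgt G).
Hypothesis two_paths : edge_disjoint_paths (src G) (tgt G).

Lemma perc_prob_ge_config (V : finType) (p : R) (F w0 : {set V * V})
    (A : pred {set V * V}) : 0 <= p <= 1 -> w0 \subset F -> A w0 ->
  p ^+ #|w0| * (1 - p) ^+ #|F :\: w0| <= perc_prob p F A.
Proof.
move=> p01 wF Aw; rewrite /perc_prob (bigD1 w0) ?powersetE ?wF//=.
by rewrite lerDl; apply: sumr_ge0 => w _; exact: perc_weight_ge0.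
Qed.

Lemma path_avoid (V : finType) (E : {set V * V}) (f : V * V) x s :
  path (link E) x s -> f \notin steps x s -> (f.2, f.1) \notin steps x s ->
  path (link (E :\ f)) x s.
Proof.
elim: s x => //= y s ih x /andP[xy sp].
rewrite /steps /= !inE !negb_or => /andP[fxy fs] /andP[fyx fs'].
rewrite ih// andbT; case/orP: xy => h; apply/orP; [left|right]; rewrite !inE h andbT.
  by rewrite eq_sym.
by apply: contra fyx => /eqP <-.
Qed.

Lemma link_steps_mem (V : finType) (x u v : V) s :
  (u, v) \in steps x s -> u \in x :: s /\ v \in x :: s.
Proof.
elim: s x => //= y s ih x; rewrite /steps /= inE => /orP[/eqP[-> ->]|/ih[uy vy]].
  by rewrite !inE !eqxx orbT.
by rewrite !(inE, in_cons) in uy vy *; rewrite uy vy !orbT.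
Qed.

(** Of two edge-disjoint paths, at least one avoids [f]. *)
Lemma connected_setD1 (f : vertex G * vertex G) :
  connect (link (edges G :\ f)) (src G) (tgt G).
Proof.
have [s [t [[sp _ sx] [tp _ tx] st]]] := two_paths.
have [/orP fs|] := boolP ((f \in steps (src G) s) || ((f.2, f.1) \in steps (src G) s)).
  apply/connectP; exists t => //; apply: path_avoid => //.
    case: fs => fs; first by rewrite [f]surjective_pairing; apply: (st _ _ _).1; rewrite -surjective_pairing.
    by rewrite [f]surjective_pairing; apply: (st _ _ fs).2.
  case: fs => fs; last exact: (st _ _ fs).1.
  by rewrite [f]surjective_pairing in fs; exact: (st _ _ fs).2.
rewrite negb_or => /andP[fs fs']; apply/connectP; exists s => //.
exact: path_avoid.
Qed.

Lemma reach_type_full (f : vertex G * vertex G) j :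
  (forall x, x \in end_set f j -> connect (link (edges G :\ f)) x (tgt G)) ->
  reach_type (edges G :\ f) (end_set f j) ord_max.
Proof.
move=> h; rewrite /reach_type /=.
have [s sj] : exists s, s \in end_set f j.
  by case: j {h} => -[|[|[|//]]] lj; [exists f.1|exists f.2|exists f.2];
    rewrite /end_set /= !inE eqxx ?orbT.
have st := h s sj; apply/andP; split; apply/existsP; exists s; rewrite sj//=.
by apply: connect_trans st _; rewrite connect_link_sym connected_setD1.
Qed.

Lemma reach_type_both (f : vertex G * vertex G) : f \in edges G ->
  reach_type (edges G :\ f) (end_set f ord_max) ord_max.
Proof.
move=> fG; have H x : reaches (edges G :\ f) (end_set f ord_max) x.
  rewrite -reaches_root_edge setD1K//; apply/existsP; exists f.1.
  by rewrite !inE eqxx; exact: ograph_connected.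
by rewrite /reach_type /= !H.
Qed.

(** With all other edges open, the two ends of an edge together reach both
    terminals. *)
Lemma cluster_matrix_both_ge (p : R) : 0 <= p <= 1 ->
  #|edges G|%:R * p ^+ #|edges G| <= cluster_matrix G p ord_max ord_max.
Proof.
move=> /andP[p0 p1]; rewrite cluster_matrixE mulr_natl -sumr_const.
apply: ler_sum => f fG; apply: le_trans (perc_prob_ge_config _ (subxx _) (reach_type_both fG)).
  by rewrite setDv cards0 expr0 mulr1 ler_wiXn2l// subset_leq_card// subsetDl.
by rewrite p0.
Qed.

Variable p : R.
Hypothesis p01 : 0 < p < 1.

Let p01w : 0 <= p <= 1. Proof. by case/andP: p01 => *; rewrite !ltW. Qed.

Let cluster_matrix_gt0 (f : vertex G * vertex G) i j
    (w0 : {set vertex G * vertex G}) : f \in edges G -> w0 \subset edges G :\ f ->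
  reach_type w0 (end_set f j) i -> 0 < cluster_matrix G p i j.
Proof.
move=> fG wf fij; rewrite cluster_matrixE (bigD1 f)//=.
apply: ltr_pwDl; last by apply: sumr_ge0 => g _; exact: perc_prob_ge0.
apply: lt_le_trans (perc_prob_ge_config p01w wf fij).
by case/andP: p01 => p0 p1; rewrite mulr_gt0 ?exprn_gt0 ?subr_gt0.
Qed.

(** Both ends of the first edge of one of the two paths stay connected to both
    terminals when that edge is removed. *)
Lemma cluster_matrix_last_row_gt0 j : 0 < cluster_matrix G p ord_max j.
Proof.
have [s [t [[sp us sx] _ _]]] := two_paths.
case: s sp us sx => [_ _ /= st|y s]; first by have := src_neq_tgt G; rewrite st eqxx.
rewrite [path _ _ _]/= [last _ _]/= => /andP[ay sp] /= /andP[ays _] sy.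
have [f fG fE0] := link_edge ay.
have fE : (f.1 = src G /\ f.2 = y) \/ (f.2 = src G /\ f.1 = y).
  by case: fE0 => [<-|[-> ->]]; auto.
have yt : connect (link (edges G :\ f)) y (tgt G).
  apply/connectP; exists s => //; apply: path_avoid => //.
    apply/negP => fs; have := fs; rewrite [f]surjective_pairing => /link_steps_mem[f1 f2].
    by case: fE f1 f2 => -[-> _] f1 f2; rewrite ?f1 ?f2 in ays.
  apply/negP => /link_steps_mem[f1 f2].
  by case: fE f1 f2 => -[-> _] f1 f2; rewrite ?f1 ?f2 in ays.
apply: (cluster_matrix_gt0 fG (subxx _)); apply: reach_type_full => x.
have ends : x \in end_set f j -> x = src G \/ x = y.
  case: j => -[|[|[|//]]] lj; rewrite /end_set /= !inE.
  - by move=> /eqP ->; case: fE => -[]; auto.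
  - by move=> /eqP ->; case: fE => -[]; auto.
  - by move=> /orP[]/eqP ->; case: fE => -[]; auto.
by move=> /ends[->|->] //; exact: connected_setD1.
Qed.

Let closed_edge x y : link (edges G) x y -> exists2 f, f \in edges G &
  forall z, reaches set0 (end_set f ord_max) z = (z == x) || (z == y).
Proof.
move=> /link_edge[f fG fE]; exists f => // z.
have conn a : connect (link (set0 : {set vertex G * vertex G})) a z = (z == a).
  apply/idP/eqP => [|->]; last exact: connect0.
  by move=> /connectP[[|b s] /=]; rewrite ?/link ?inE.
apply/existsP/idP => [[a]|zxy].
  rewrite conn !inE => /andP[/orP[]/eqP -> /eqP ->];
  by case: fE => [<-|[-> ->]]; rewrite eqxx ?orbT.
exists z; rewrite conn eqxx andbT !inE.
by case: fE zxy => [<-|[-> ->]] //; rewrite orbC.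
Qed.

(** For the types that miss one terminal, all edges closed is a suitable
    configuration, seen from an edge at the other terminal. *)
Lemma cluster_matrix_last_col_gt0 i : 0 < cluster_matrix G p i ord_max.
Proof.
have [v sv] := ex_link (src G); have [u tu] := ex_link (tgt G).
have vt : (tgt G == v) = false by apply: contraNF nadj => /eqP ->.
have us : (src G == u) = false by apply: contraNF nadj => /eqP ->; rewrite link_sym.
have nst := negbTE (src_neq_tgt G).
case: i => -[|[|[|//]]] li.
- have [f fG fE] := closed_edge sv.
  apply: (cluster_matrix_gt0 fG (sub0set _)).
  by rewrite /reach_type /= !fE eqxx vt (eq_sym (tgt G)) nst.
- have [f fG fE] := closed_edge tu.
  apply: (cluster_matrix_gt0 fG (sub0set _)).
  by rewrite /reach_type /= !fE eqxx us nst.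
- rewrite (_ : Ordinal li = ord_max); last exact: val_inj.
  exact: cluster_matrix_last_row_gt0.
Qed.

End MatrixEntries.

(** * Perron-Frobenius for three connection types *)

Section PerronFrobenius.
Variable R : realType.

Lemma ord3_ind (P : 'I_3 -> Prop) : P ord0 -> P (lift ord0 ord0) ->
  P (lift ord0 (lift ord0 ord0)) -> forall i, P i.
Proof.
move=> P0 P1 P2; case=> -[|[|[|//]]] li.
- by rewrite (_ : Ordinal li = ord0)//; exact: val_inj.
- by rewrite (_ : Ordinal li = lift ord0 ord0)//; exact: val_inj.
- by rewrite (_ : Ordinal li = lift ord0 (lift ord0 ord0))//; exact: val_inj.
Qed.

Lemma ord_max3 : ord_max = lift ord0 (lift ord0 ord0) :> 'I_3.
Proof. exact: val_inj. Qed.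

(** The determinant of a matrix that is diagonally dominant by a wide margin. *)
Lemma dominant_det_ge0 (u x y z b c c1 c2 e f : R) : 0 <= u ->
  0 <= b <= u -> 0 <= c <= u -> 0 <= c1 <= u -> 0 <= c2 <= u ->
  0 <= e <= u -> 0 <= f <= u -> 3 * u <= x -> 3 * u <= y -> 3 * u <= z ->
  0 <= z * (x * y - b * c) - e * (y * c1 + b * c2) - f * (x * c2 + c * c1).
Proof.
move=> u0 /andP[b0 bu] /andP[c0 cu] /andP[c10 c1u] /andP[c20 c2u] /andP[e0 eu]
  /andP[f0 fu] xu yu zu.
have u3 : u <= 3 * u by rewrite ler_peMl// ler1n.
have u30 : 0 <= 3 * u := le_trans u0 u3.
have x0 := le_trans u30 xu; have y0 := le_trans u30 yu; have z0 := le_trans u30 zu.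
have le2 (p q r s : R) : 0 <= p -> 0 <= r -> p <= q -> r <= s -> p * r <= q * s.
  by move=> *; exact: ler_pM.
have sq : 9 * (u * u) = 3 * u * (3 * u) by ring.
have h1 := ler_wpM2l z0 (le2 _ _ _ _ b0 c0 bu cu).
have h2 := ler_wpM2l y0 (le2 _ _ _ _ e0 c10 eu c1u).
have h3 := ler_wpM2l x0 (le2 _ _ _ _ f0 c20 fu c2u).
have h4 := le2 _ _ _ _ e0 (mulr_ge0 b0 c20) eu (le2 _ _ _ _ b0 c20 bu c2u).
have h5 := le2 _ _ _ _ f0 (mulr_ge0 c0 c10) fu (le2 _ _ _ _ c0 c10 cu c1u).
have k1 : z * (9 * (u * u)) <= x * y * z.
  have -> : x * y * z = z * (x * y) by ring.
  by rewrite sq ler_wpM2l// le2.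
have k2 : y * (9 * (u * u)) <= x * y * z.
  have -> : x * y * z = y * (x * z) by ring.
  by rewrite sq ler_wpM2l// le2.
have k3 : x * (9 * (u * u)) <= x * y * z.
  have -> : x * y * z = x * (y * z) by ring.
  by rewrite sq ler_wpM2l// le2.
have k4 : u * (u * u) <= x * (u * u).
  by rewrite ler_wpM2r ?mulr_ge0// (le_trans u3).
have k5 : 0 <= x * (u * u) by rewrite !mulr_ge0.
have -> : z * (x * y - b * c) - e * (y * c1 + b * c2) - f * (x * c2 + c * c1) =
  x * y * z - z * (b * c) - y * (e * c1) - x * (f * c2) - e * (b * c2) - f * (c * c1)
  by ring.
clear -h1 h2 h3 h4 h5 k1 k2 k3 k4 k5; lra.
Qed.

(** Elimination of the first two coordinates: [rho] is sought above the
    top eigenvalue [s] of the upper left block, where the block can be inverted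
    with nonnegative entries. *)
Lemma perron_root3 (a b c1 c d c2 e f g : R) :
  0 <= a -> 0 <= b -> 0 <= c -> 0 <= d -> 0 <= g ->
  0 < c1 -> 0 < c2 -> 0 < e -> 0 < f ->
  exists rho, let D := (rho - a) * (rho - d) - b * c in
    [/\ a < rho, d < rho, 0 < D &
    (rho - g) * D - e * ((rho - d) * c1 + b * c2)
      - f * ((rho - a) * c2 + c * c1) = 0].
Proof.
move=> a0 b0 c0 d0 g0 c10 c20 e0 f0.
pose r := Num.sqrt ((a - d) ^+ 2 + 4 * (b * c)).
have r0 : 0 <= r by exact: sqrtr_ge0.
have bc0 : 0 <= b * c by exact: mulr_ge0.
have r2 : r ^+ 2 = (a - d) ^+ 2 + 4 * (b * c).
  by rewrite sqr_sqrtr// addr_ge0 ?sqr_ge0// mulr_ge0.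
pose s := (a + d + r) / 2.
have rad : `|a - d| <= r.
  by rewrite -(ler_pXn2r (n := 2))// ?nnegrE// real_normK ?num_real// r2 lerDl mulr_ge0.
have [as_ ds] : a <= s /\ d <= s.
  by move: rad; rewrite ler_norml /s => /andP[? ?]; split; lra.
have Ds : (s - a) * (s - d) = b * c.
  have : 4 * ((s - a) * (s - d)) = 4 * (b * c) by rewrite /s; field: r2.
  by lra.
have Dt t : s < t -> 0 < (t - a) * (t - d) - b * c.
  move=> st; rewrite -Ds.
  have -> : (t - a) * (t - d) - (s - a) * (s - d) = (t - s) * (t + s - a - d) by ring.
  by apply: mulr_gt0; lra.
have [N1 N2] : 0 <= (s - d) * c1 + b * c2 /\ 0 <= (s - a) * c2 + c * c1.
  by split; rewrite addr_ge0 ?mulr_ge0 ?subr_ge0// ltW.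
(* The determinant is negative at [s] unless the two off-diagonal terms vanish. *)
have [Npos|Nneg] := ltP 0 (e * ((s - d) * c1 + b * c2) + f * ((s - a) * c2 + c * c1)).
  pose p : {poly R} := ('X - g%:P) * (('X - a%:P) * ('X - d%:P) - (b * c)%:P)
    - e%:P * (('X - d%:P) * c1%:P + (b * c2)%:P)
    - f%:P * (('X - a%:P) * c2%:P + (c * c1)%:P).
  have pE t : p.[t] = (t - g) * ((t - a) * (t - d) - b * c)
    - e * ((t - d) * c1 + b * c2) - f * ((t - a) * c2 + c * c1).
    by rewrite /p !hornerE.
  pose u := b + c + c1 + c2 + e + f.
  (* [T] makes [T - M] diagonally dominant. *)
  pose T := s + g + 3 * u.
  have u0 : 0 < u by rewrite /u; lra.
  have pT : 0 <= p.[T].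
    have [bu cu] : 0 <= b <= u /\ 0 <= c <= u by rewrite b0 c0 /u; split; lra.
    have [c1u c2u] : 0 <= c1 <= u /\ 0 <= c2 <= u
      by rewrite (ltW c10) (ltW c20) /u; split; lra.
    have [eu fu] : 0 <= e <= u /\ 0 <= f <= u
      by rewrite (ltW e0) (ltW f0) /u; split; lra.
    by rewrite pE; apply: (dominant_det_ge0 (ltW u0)) => //; rewrite /T; lra.
  have ps : p.[s] < 0.
    by rewrite pE Ds subrr mulr0; lra.
  have sT : s <= T by rewrite /T; lra.
  have [x /andP[sx xT] /rootP px] := poly_ivt sT (introT andP (conj (ltW ps) pT)).
  have sx' : s < x.
    by rewrite lt_neqAle sx andbT; apply/eqP => sxE; move: ps; rewrite sxE px ltxx.
  exists x; split; rewrite ?Dt//; try lra.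
  by rewrite -pE.
(* In the remaining case the block is [s] times the identity, and the determinant
   is [t - s] times a quadratic polynomial. *)
have [n1 n2] : (s - d) * c1 + b * c2 = 0 /\ (s - a) * c2 + c * c1 = 0.
  have h1 : 0 <= e * ((s - d) * c1 + b * c2) by apply: mulr_ge0; lra.
  have h2 : 0 <= f * ((s - a) * c2 + c * c1) by apply: mulr_ge0; lra.
  split; apply/eqP.
    have : e * ((s - d) * c1 + b * c2) == 0 by apply/eqP; lra.
    by rewrite mulf_eq0 (gt_eqF e0).
  have : f * ((s - a) * c2 + c * c1) == 0 by apply/eqP; lra.
  by rewrite mulf_eq0 (gt_eqF f0).
have [sd b_0] : s = d /\ b = 0.
  have h1 : 0 <= (s - d) * c1 by apply: mulr_ge0; lra.
  have h2 : 0 <= b * c2 by apply: mulr_ge0; lra.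
  split; apply/eqP; last first.
    have : b * c2 == 0 by apply/eqP; lra.
    by rewrite mulf_eq0 (gt_eqF c20) orbF.
  have : (s - d) * c1 == 0 by apply/eqP; lra.
  by rewrite mulf_eq0 (gt_eqF c10) orbF subr_eq0.
have [sa c_0] : s = a /\ c = 0.
  have h1 : 0 <= (s - a) * c2 by apply: mulr_ge0; lra.
  have h2 : 0 <= c * c1 by apply: mulr_ge0; lra.
  split; apply/eqP; last first.
    have : c * c1 == 0 by apply/eqP; lra.
    by rewrite mulf_eq0 (gt_eqF c10) orbF.
  have : (s - a) * c2 == 0 by apply/eqP; lra.
  by rewrite mulf_eq0 (gt_eqF c20) orbF subr_eq0.
pose K := e * c1 + f * c2.
have K0 : 0 < K by rewrite /K addr_gt0// mulr_gt0.
pose q := Num.sqrt ((g - s) ^+ 2 + 4 * K).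
have q2 : q ^+ 2 = (g - s) ^+ 2 + 4 * K.
  by rewrite sqr_sqrtr// addr_ge0 ?sqr_ge0//; lra.
have q0 : 0 <= q by exact: sqrtr_ge0.
have gsq : `|g - s| < q.
  by rewrite -(ltr_pXn2r (n := 2))// ?nnegrE// real_normK ?num_real// q2 ltrDl; lra.
have gsq' : s - g < q by apply: le_lt_trans gsq; rewrite distrC ler_norm.
exists ((g + s + q) / 2); rewrite /=.
have sr : s < (g + s + q) / 2 by lra.
split; rewrite ?Dt//; try lra.
have root : ((g + s + q) / 2 - g) * ((g + s + q) / 2 - s) = K.
  have : 4 * (((g + s + q) / 2 - g) * ((g + s + q) / 2 - s)) = 4 * K by field: q2.
  by lra.
rewrite b_0 c_0 -sa -sd; set t := (g + s + q) / 2 in root *.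
have -> : (t - g) * ((t - s) * (t - s) - 0 * 0) - e * ((t - s) * c1 + 0 * c2)
   - f * ((t - s) * c2 + 0 * c1) = (t - s) * ((t - g) * (t - s) - (e * c1 + f * c2)).
  by ring.
by rewrite root /K subrr mulr0.
Qed.

Lemma perron_vector3 (M : 'M[R]_3) : (forall i j, 0 <= M i j) ->
  (forall i, 0 < M i ord_max) -> (forall j, 0 < M ord_max j) ->
  exists (rho : R) (v : 'I_3 -> R), [/\ 0 < rho, forall i, 0 < v i &
    forall i, \sum_j M i j * v j = rho * v i].
Proof.
rewrite ord_max3 => M0 Mc Mr.
set i0 : 'I_3 := ord0; set i1 : 'I_3 := lift ord0 ord0.
set i2 : 'I_3 := lift ord0 (lift ord0 ord0).
have [rho [arho drho D0 P0]] := perron_root3 (M0 i0 i0) (M0 i0 i1) (M0 i1 i0)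
  (M0 i1 i1) (M0 i2 i2) (Mc i0) (Mc i1) (Mr i0) (Mr i1).
exists rho, (fun i : 'I_3 => nth 0 [:: (rho - M i1 i1) * M i0 i2 + M i0 i1 * M i1 i2;
  (rho - M i0 i0) * M i1 i2 + M i1 i0 * M i0 i2;
  (rho - M i0 i0) * (rho - M i1 i1) - M i0 i1 * M i1 i0] i).
split.
- by apply: le_lt_trans arho; exact: M0.
- apply: ord3_ind => //=.
    by apply: ltr_pwDl; [rewrite mulr_gt0 ?subr_gt0//; exact: Mc|rewrite mulr_ge0].
  by apply: ltr_pwDl; [rewrite mulr_gt0 ?subr_gt0//; exact: Mc|rewrite mulr_ge0].
- by apply: ord3_ind; rewrite !big_ord_recl big_ord0 /= -/i0 -/i1 -/i2; lra.
Qed.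

(** Pairing the absolute values of a left eigenvector with the positive right
    eigenvector. *)
Lemma le_eigenvalue n (M : 'M[R]_n) (rho : R) (v : 'I_n -> R) (x : R) :
  (forall i j, 0 <= M i j) -> (forall i, 0 < v i) ->
  (forall i, \sum_j M i j * v j = rho * v i) -> eigenvalue M x -> x <= rho.
Proof.
move=> M0 v0 Mv /eigenvalueP[u uM u0].
have [k uk] : exists k, u 0 k != 0.
  apply/existsP; apply: contraNT u0; rewrite negb_exists => /forallP h.
  by apply/eqP/rowP => k; rewrite mxE; apply/eqP; have := h k; rewrite negbK.
pose S := \sum_i `|u 0 i| * v i.
have S0 : 0 < S.
  rewrite /S (bigD1 k)//= ltr_pwDl ?mulr_gt0 ?normr_gt0//.
  by apply: sumr_ge0 => i _; rewrite mulr_ge0// ltW.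
rewrite -(ler_pM2r S0); apply: (@le_trans _ _ (`|x| * S)).
  by apply: ler_wpM2r; [exact: ltW|exact: ler_norm].
have -> : rho * S = \sum_i (\sum_j `|u 0 j| * M j i) * v i.
  under [RHS]eq_bigr => i _ do rewrite mulr_suml.
  rewrite exchange_big mulr_sumr; apply: eq_bigr => i _ /=.
  under eq_bigr => j _ do rewrite -mulrA.
  by rewrite -mulr_sumr Mv mulrCA.
rewrite mulr_sumr; apply: ler_sum => i _; rewrite mulrA.
apply: ler_wpM2r; first exact: ltW.
have /rowP/(_ i) := uM; rewrite !mxE -normrM => <-.
apply: le_trans (ler_norm_sum _ _ _) _; apply: ler_sum => j _.
by rewrite normrM (ger0_norm (M0 j i)).
Qed.

(** A right eigenvector gives an eigenvalue in the sense of row vectors because a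
    matrix and its transpose have the same characteristic polynomial. *)
Lemma largest_eigenvalueE n (M : 'M[R]_n) (rho : R) (v : 'I_n -> R) (k : 'I_n) :
  (forall i j, 0 <= M i j) -> (forall i, 0 < v i) ->
  (forall i, \sum_j M i j * v j = rho * v i) -> largest_eigenvalue M = rho.
Proof.
move=> M0 v0 Mv.
have tr : char_poly M^T = char_poly M.
  rewrite /char_poly -det_tr; congr (\det _).
  by apply/matrixP => i j; rewrite !mxE eq_sym.
have erho : eigenvalue M rho.
  rewrite eigenvalue_root_char -tr -eigenvalue_root_char.
  apply/eigenvalueP; exists (\row_j v j).
    apply/rowP => i; rewrite !mxE -Mv; apply: eq_bigr => j _.
    by rewrite !mxE mulrC.
  apply/eqP => /rowP/(_ k); rewrite !mxE => vk.
  by have := v0 k; rewrite vk ltxx.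
apply/eqP; rewrite eq_le; apply/andP; split.
  by apply: ge_sup; [exists rho|move=> x; exact: le_eigenvalue Mv].
apply: ub_le_sup => //; exists rho => x; exact: le_eigenvalue Mv.
Qed.

End PerronFrobenius.

(** * The Moore-Shannon inequality *)

Section MooreShannon.
Import mathcomp.boot.finset.
Variable R : realType.

Definition increasing_event (T : finType) (A : pred {set T}) : Prop :=
  forall w w' : {set T}, w \subset w' -> A w -> A w'.

Definition event_prob (T : finType) (p : R) (F : {set T}) (A : pred {set T}) : R :=
  perc_exp p F (fun w => (A w)%:R).

Definition event_poly (T : finType) (F : {set T}) (A : pred {set T}) : {poly R} :=
  perc_exp 'X F (fun w => (A w)%:R).

(** Conditioning the event on [e] being open. *)
Definition contract (T : finType) (A : pred {set T}) (e : T) : pred {set T} :=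
  fun w => A (e |: w).

Lemma event_probU1 (T : finType) (p : R) (F : {set T}) A e : e \notin F ->
  event_prob p (e |: F) A = p * event_prob p F (contract A e) + (1 - p) * event_prob p F A.
Proof. exact: perc_expU1. Qed.

Lemma event_polyU1 (T : finType) (F : {set T}) A e : e \notin F ->
  event_poly (e |: F) A = 'X * event_poly F (contract A e) + (1 - 'X) * event_poly F A.
Proof. exact: perc_expU1. Qed.

Lemma event_poly_horner (T : finType) (p : R) (F : {set T}) A :
  (event_poly F A).[p] = event_prob p F A.
Proof.
elim/set_insert_ind: F A => [|e F eF ih] A.
  by rewrite /event_poly /event_prob !perc_exp_set0; case: (A _); rewrite hornerC.
by rewrite event_probU1// event_polyU1// !hornerE !ih.
Qed.

Lemma event_poly0_deriv (T : finType) A : (event_poly (set0 : {set T}) A)^`() = 0.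
Proof. by rewrite /event_poly perc_exp_set0; case: (A _); rewrite derivC. Qed.

Lemma event_polyU1_deriv (T : finType) (p : R) (F : {set T}) A e : e \notin F ->
  (event_poly (e |: F) A)^`().[p] =
  event_prob p F (contract A e) - event_prob p F A +
  p * (event_poly F (contract A e))^`().[p] + (1 - p) * (event_poly F A)^`().[p].
Proof.
move=> eF; rewrite event_polyU1// derivD !derivM derivB derivX derivC.
by rewrite !hornerE !event_poly_horner /=; ring.
Qed.

Lemma contract_increasing (T : finType) (A : pred {set T}) e :
  increasing_event A -> increasing_event (contract A e).
Proof. by move=> incA w w' ww; apply: incA; exact: setUS. Qed.

Lemma event_prob_in01 (T : finType) (p : R) (F : {set T}) A : 0 <= p <= 1 ->
  0 <= event_prob p F A <= 1.
Proof.
move=> p01; rewrite /event_prob; apply/andP; split.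
  rewrite -[leLHS](perc_exp_cst p 0 F); apply: le_perc_exp => // w _.
rewrite -[leRHS](perc_exp_cst p 1 F); apply: le_perc_exp => // w _.
by case: (A w).
Qed.

Lemma le_contract (T : finType) (p : R) (F : {set T}) A e : increasing_event A ->
  0 <= p <= 1 -> event_prob p F A <= event_prob p F (contract A e).
Proof.
move=> incA p01; apply: le_perc_exp => // w _; rewrite ler_nat.
case Aw : (A w) => //.
by rewrite /contract (incA w)//; exact: subsetUr.
Qed.

(** Conditioning on one edge decomposes the variance of an event: the variance
    of the conditional probability is [p (1 - p) x ^+ 2], where [x] is the probability
    that the edge is pivotal, while the derivative gains [x]. *)
Lemma moore_shannon_step (p h1 h0 d1 d0 : R) : 0 <= p <= 1 ->
  h1 * (1 - h1) <= p * (1 - p) * d1 -> h0 * (1 - h0) <= p * (1 - p) * d0 ->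
  (p * h1 + (1 - p) * h0) * (1 - (p * h1 + (1 - p) * h0)) +
    p * (1 - p) * ((h1 - h0) * (1 - (h1 - h0))) <=
  p * (1 - p) * (h1 - h0 + p * d1 + (1 - p) * d0).
Proof.
move=> /andP[p0 p1] i1 i0; have k1 := ler_wpM2l p0 i1.
have p1' : 0 <= 1 - p by lra.
have k0 := ler_wpM2l p1' i0.
have -> : p * (1 - p) * (h1 - h0 + p * d1 + (1 - p) * d0) =
  p * (1 - p) * (h1 - h0) + p * (p * (1 - p) * d1) + (1 - p) * (p * (1 - p) * d0) by ring.
have -> : (p * h1 + (1 - p) * h0) * (1 - (p * h1 + (1 - p) * h0)) +
    p * (1 - p) * ((h1 - h0) * (1 - (h1 - h0))) =
  p * (h1 * (1 - h1)) + (1 - p) * (h0 * (1 - h0)) + p * (1 - p) * (h1 - h0) by ring.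
lra.
Qed.

(** The Moore-Shannon inequality: the excess in each conditioning step is
    [p (1 - p) x (1 - x)], which is nonnegative. *)
Lemma moore_shannon (T : finType) (p : R) (F : {set T}) A : increasing_event A ->
  0 <= p <= 1 ->
  event_prob p F A * (1 - event_prob p F A) <= p * (1 - p) * (event_poly F A)^`().[p].
Proof.
move=> + p01; elim/set_insert_ind: F A => [|e F eF ih] A incA.
  rewrite event_poly0_deriv horner0 mulr0 /event_prob perc_exp_set0.
  by case: (A _); rewrite ?subrr ?mulr0 ?mul0r.
rewrite event_probU1// event_polyU1_deriv//.
have inc1 := contract_increasing (e := e) incA.
apply: le_trans (moore_shannon_step p01 (ih _ inc1) (ih _ incA)).
have := @le_contract _ _ F _ e incA p01.
have /andP[] := event_prob_in01 F A p01.
have /andP[] := event_prob_in01 F (contract A e) p01.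
move=> h10 h11 h00 h01 h01'; rewrite lerDl; case/andP: p01 => p0 p1.
by rewrite !mulr_ge0//; lra.
Qed.

Lemma moore_shannon_strict (T : finType) (p : R) (F : {set T}) A e :
  increasing_event A -> 0 < p < 1 -> e \notin F ->
  0 < event_prob p F (contract A e) - event_prob p F A < 1 ->
  event_prob p (e |: F) A * (1 - event_prob p (e |: F) A) <
  p * (1 - p) * (event_poly (e |: F) A)^`().[p].
Proof.
move=> incA p01 eF /andP[piv0 piv1].
have p01' : 0 <= p <= 1 by case/andP: p01 => *; rewrite !ltW.
rewrite event_probU1// event_polyU1_deriv//.
have inc1 := contract_increasing (e := e) incA.
apply: lt_le_trans (moore_shannon_step p01' (moore_shannon F inc1 p01')
  (moore_shannon F incA p01')).
rewrite ltrDl; case/andP: p01 => p0 p1.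
by rewrite !mulr_gt0//; lra.
Qed.

(** The integrated form of the Moore-Shannon inequality: multiplying the odds of
    each edge by [1 + u] multiplies the odds of an increasing event by at least as
    much. It is stated without denominators; [(1 + u) s = t (1 + u s)] says
    that the odds of [t] are [1 + u] times those of [s]. *)
Lemma event_prob_odds (T : finType) (F : {set T}) A (s t u : R) :
  increasing_event A -> 0 <= s <= 1 -> 0 <= t <= 1 -> 0 <= u ->
  (1 + u) * s = t * (1 + u * s) ->
  (1 + u) * event_prob s F A <= event_prob t F A * (1 + u * event_prob s F A).
Proof.
move=> + s01 t01 u0 st; elim/set_insert_ind: F A => [|e F eF ih] A incA.
  rewrite /event_prob !perc_exp_set0; case: (A _); first by rewrite !mulr1 mul1r.
  by rewrite !mulr0 mul0r.
rewrite !event_probU1//.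
have := ih _ incA; have := ih _ (contract_increasing (e := e) incA).
have := @le_contract _ _ F _ e incA s01.
have /andP[] := event_prob_in01 F A s01; have /andP[] := event_prob_in01 F (contract A e) s01.
case/andP: s01 => s0 s1; case/andP: t01 => t0 t1.
set a := event_prob s F (contract A e); set b := event_prob s F A.
set a' := event_prob t F (contract A e); set b' := event_prob t F A.
move=> a0 a1 b0 b1 ba ia ib.
set m := s * a + (1 - s) * b.
have s1' : 0 <= 1 - s by lra.
have m0 : 0 <= m by rewrite /m addr_ge0// mulr_ge0.
have ua : 0 <= u * a by exact: mulr_ge0.
have ub : 0 <= u * b by exact: mulr_ge0.
have us : 0 <= u * s by exact: mulr_ge0.
have um : 0 <= u * m by exact: mulr_ge0.
have kpos : 0 < (1 + u * a) * (1 + u * b) * (1 + u * s).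
  by rewrite !mulr_gt0//; lra.
rewrite -(ler_pM2l kpos).
have st' : (1 + u * s) * (1 - t) = 1 - s by rewrite mulrBr mulr1 [_ * t]mulrC -st; ring.
have -> : (1 + u * a) * (1 + u * b) * (1 + u * s) * ((t * a' + (1 - t) * b') * (1 + u * m))
  = (1 + u * m) * ((t * (1 + u * s)) * (a' * (1 + u * a)) * (1 + u * b)
     + ((1 + u * s) * (1 - t)) * (b' * (1 + u * b)) * (1 + u * a)) by ring.
rewrite st' -st.
have ha : (1 + u) * s * ((1 + u) * a) * (1 + u * b) <=
    (1 + u) * s * (a' * (1 + u * a)) * (1 + u * b).
  apply: ler_wpM2r; first by lra.
  by apply: ler_wpM2l => //; rewrite mulr_ge0//; lra.
have hb : (1 - s) * ((1 + u) * b) * (1 + u * a) <= (1 - s) * (b' * (1 + u * b)) * (1 + u * a).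
  by apply: ler_wpM2r; [lra|exact: ler_wpM2l].
apply: (@le_trans _ _ ((1 + u * m) * ((1 + u) * s * ((1 + u) * a) * (1 + u * b) +
   (1 - s) * ((1 + u) * b) * (1 + u * a)))); last first.
  by apply: ler_wpM2l; [lra|exact: lerD].
(* The difference of the two sides factors, with a zero at [a = b]. *)
have E : 0 <= (1 + u) * (u * (s * (1 - s)) * (a - b) * (1 - (a - b) + u * b)).
  by rewrite !mulr_ge0//; lra.
rewrite -subr_ge0; apply: le_trans E _; rewrite le_eqVlt; apply/orP; left; apply/eqP.
by rewrite /m; ring.
Qed.

End MooreShannon.

(** * The crossing probability *)

Section CrossingProbability.
Import mathcomp.boot.finset.
Variables (R : realType) (G : ograph).
Hypothesis nadj : ~~ link (edges G) (src G) (tgt G).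

Definition crossed : pred {set vertex G * vertex G} :=
  fun w => connect (link w) (src G) (tgt G).

Lemma crossing_event (p : R) : crossing G p = event_prob p (edges G) crossed.
Proof. exact: perc_probE. Qed.

Lemma crossed_increasing : increasing_event crossed.
Proof.
move=> w w' /fintype.subsetP ww; apply: connect_sub => x y xy; apply: connect1.
by case/orP: xy => /ww xy; apply/orP; auto.
Qed.

Lemma crossed_set0 : ~~ crossed set0.
Proof.
apply/negP => /connectP[[|x s] /=]; last by rewrite /link !inE.
by move=> _ st; have := src_neq_tgt G; rewrite st eqxx.
Qed.

Lemma crossed_set1 e : e \in edges G -> ~~ crossed [set e].
Proof.
move=> eG; apply/negP => cr.
have h z : connect (link [set e]) (src G) z -> z = src G \/ link [set e] (src G) z.
  apply: (connect_ind (P := fun z => z = src G \/ link [set e] (src G) z)); last by left.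
  move=> x y xy [xE|sx]; first by right; rewrite -xE.
  left; move: sx xy; rewrite /link !inE.
  by move=> /orP[]/eqP eE /orP[]/eqP eE'; congruence.
case: (h _ cr) => [ts|st]; first by have := src_neq_tgt G; rewrite ts eqxx.
by move: nadj; rewrite /link; case/orP: st; rewrite inE => /eqP ->; rewrite eG ?orbT.
Qed.

Lemma config_weight_gt0 (p : R) (F w0 : {set vertex G * vertex G}) : 0 < p < 1 ->
  w0 \subset F -> 0 < perc_exp p F (fun w => (w == w0)%:R).
Proof.
move=> p01 wF; have p01' : 0 <= p <= 1 by case/andP: p01 => *; rewrite !ltW.
have := perc_prob_ge_config (A := pred1 w0) p01' wF (eqxx _).
rewrite perc_probE; apply: lt_le_trans.
by case/andP: p01 => *; rewrite mulr_gt0// exprn_gt0// subr_gt0.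
Qed.

(** An edge of a minimal crossing configuration is pivotal in it, and no edge
    crosses alone. *)
Lemma ex_pivotal (p : R) : 0 < p < 1 -> exists2 e, e \in edges G &
  0 < event_prob p (edges G :\ e) (contract crossed e) -
      event_prob p (edges G :\ e) crossed < 1.
Proof.
move=> p01; have p01' : 0 <= p <= 1 by case/andP: p01 => *; rewrite !ltW.
pose good w := crossed w && (w \subset edges G).
have good0 : good (edges G) by rewrite /good subxx andbT; exact: ograph_connected.
case: (arg_minnP (fun w : {set _} => #|w|) good0) => w0 /andP[cw0 wE] wmin.
have [e ew0] : exists e, e \in w0.
  apply/set0Pn; apply: contraTneq cw0 => ->; exact: crossed_set0.
have eG : e \in edges G := fintype.subsetP wE _ ew0.
have nc : ~~ crossed (w0 :\ e).
  apply/negP => c; have := wmin (w0 :\ e); rewrite /good c /=.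
  have -> : w0 :\ e \subset edges G by apply: fintype.subset_trans wE; exact: subsetDl.
  by move=> /(_ isT); rewrite [#|w0|](cardsD1 e) ew0 ltnn.
exists e => //; apply/andP; split.
  rewrite subr_gt0.
  have w1E : w0 :\ e \subset edges G :\ e by exact: setSD.
  apply: (@lt_le_trans _ _ (event_prob p (edges G :\ e) crossed +
      perc_exp p (edges G :\ e) (fun w => (w == w0 :\ e)%:R))).
    by rewrite ltrDl; exact: config_weight_gt0.
  rewrite /event_prob -perc_expD; apply: le_perc_exp => // w wF.
  have [->|_] := eqVneq w (w0 :\ e).
    by rewrite (negbTE nc) add0r /contract setD1K// cw0.
  rewrite addr0 ler_nat; case cw : (crossed w) => //.
  by rewrite /contract (crossed_increasing _ cw)//; exact: subsetUr.
have [h0 _] := andP (event_prob_in01 (edges G :\ e) crossed p01').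
apply: (@le_lt_trans _ _ (event_prob p (edges G :\ e) (contract crossed e))).
  by rewrite gerBl.
apply: (@lt_le_trans _ _ (event_prob p (edges G :\ e) (contract crossed e) +
      perc_exp p (edges G :\ e) (fun w => (w == set0)%:R))).
  by rewrite ltrDl; apply: config_weight_gt0 => //; exact: sub0set.
rewrite /event_prob -perc_expD -[leRHS](perc_exp_cst p 1 (edges G :\ e)).
apply: le_perc_exp => // w _; have [->|_] := eqVneq w set0.
  by rewrite /contract setU0 (negbTE (crossed_set1 eG)) add0r.
by rewrite addr0; case: (contract _ _ _).
Qed.

Lemma crossing_horner : @crossing R G = horner (event_poly R (edges G) crossed).
Proof. by apply/funext => p; rewrite event_poly_horner crossing_event. Qed.

Lemma deriv_fixpoint_gt1 (ps : R) : 0 < ps < 1 -> crossing G ps = ps ->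
  1 < (event_poly R (edges G) crossed)^`().[ps].
Proof.
move=> ps01 fix_ps; have [e eG piv] := ex_pivotal ps01.
have := moore_shannon_strict crossed_increasing ps01 _ piv.
rewrite setD1K// -crossing_event fix_ps !inE eqxx => /(_ isT).
case/andP: ps01 => p0 p1.
by rewrite -[X in X < _]mulr1 ltr_pM2l// mulr_gt0// subr_gt0.
Qed.

Lemma crossing1 : crossing G (1 : R) = 1.
Proof.
have h : 0 <= (1 : R) <= 1 by rewrite ler01 /=.
apply/eqP; rewrite eq_le perc_prob_le1//=.
have := perc_prob_ge_config (A := crossed) h (subxx (edges G)) (ograph_connected (src G) (tgt G)).
by rewrite setDv cards0 expr0 expr1n mulr1.
Qed.

Lemma crossing_in01_strict (p : R) : 0 < p < 1 -> 0 < crossing G p < 1.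
Proof.
move=> p01; have p01' : 0 <= p <= 1 by case/andP: p01 => *; rewrite !ltW.
apply/andP; split.
  apply: lt_le_trans (perc_prob_ge_config (A := crossed) p01' (subxx _) (ograph_connected _ _)).
  by case/andP: p01 => *; rewrite mulr_gt0// exprn_gt0// subr_gt0.
rewrite crossing_event; apply: (@lt_le_trans _ _ (event_prob p (edges G) crossed +
      perc_exp p (edges G) (fun w => (w == set0)%:R))).
  by rewrite ltrDl; apply: config_weight_gt0 => //; exact: sub0set.
rewrite /event_prob -perc_expD -[leRHS](perc_exp_cst p 1 (edges G)).
apply: le_perc_exp => // w _; have [->|_] := eqVneq w set0.
  by rewrite (negbTE crossed_set0) add0r.
by rewrite addr0; case: (crossed _).
Qed.

Definition odds_against (x : R) := (1 - x) / x.

(** [odds_against (f x) / odds_against x] does not increase with [x]: this is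
    [event_prob_odds] with [1 + u] the ratio of the odds of [t] and [s]. *)
Lemma odds_against_crossing (s t : R) : 0 < s -> s <= t -> t < 1 ->
  odds_against (crossing G t) * odds_against s <=
  odds_against t * odds_against (crossing G s).
Proof.
move=> s0 st t1; have t0 := lt_le_trans s0 st; have s1 := le_lt_trans st t1.
have s01 : 0 <= s <= 1 by rewrite !ltW.
have t01 : 0 <= t <= 1 by rewrite !ltW.
have [fs0 fs1] := andP (crossing_in01_strict (introT andP (conj s0 s1))).
have [ft0 ft1] := andP (crossing_in01_strict (introT andP (conj t0 t1))).
pose u := (t - s) / (s * (1 - t)).
have st1 : 0 < s * (1 - t) by rewrite mulr_gt0// subr_gt0.
have u0 : 0 <= u by rewrite divr_ge0 ?subr_ge0// ltW.
have uE : u * (s * (1 - t)) = t - s by rewrite mulfVK// gt_eqF.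
have := event_prob_odds (edges G) crossed_increasing s01 t01 u0.
rewrite -!crossing_event => /(_ ltac:(nra)).
move: fs0 fs1 ft0 ft1; set fs := crossing G s; set ft := crossing G t.
move=> fs0 fs1 ft0 ft1 h.
have h' : (1 + u) * (s * (1 - t)) * (fs * (1 - ft)) <= s * (1 - t) * (ft * (1 - fs)).
  have -> : (1 + u) * (s * (1 - t)) * (fs * (1 - ft)) =
    s * (1 - t) * ((1 + u) * fs * (1 - ft)) by ring.
  by apply: ler_wpM2l; [exact: ltW|nra].
have h2 : t * (1 - s) * (fs * (1 - ft)) <= s * (1 - t) * (ft * (1 - fs)).
  by apply: le_trans h'; rewrite mulrDl mul1r uE le_eqVlt; apply/orP; left; apply/eqP; ring.
rewrite /odds_against.
have -> : (1 - ft) / ft * ((1 - s) / s) = t * (1 - s) * (fs * (1 - ft)) / (t * s * fs * ft).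
  by field; rewrite !gt_eqF.
have -> : (1 - t) / t * ((1 - fs) / fs) = s * (1 - t) * (ft * (1 - fs)) / (t * s * fs * ft).
  by field; rewrite !gt_eqF.
by rewrite ler_wpM2r// invr_ge0 !mulr_ge0// ltW.
Qed.

Lemma odds_against_gt0 (x : R) : 0 < x < 1 -> 0 < odds_against x.
Proof. by move=> /andP[x0 x1]; rewrite divr_gt0// subr_gt0. Qed.

Lemma odds_against_le (x y : R) : 0 < x -> 0 < y ->
  (odds_against x <= odds_against y) = (y <= x).
Proof.
move=> x0 y0; rewrite /odds_against !mulrBl !mul1r !divff ?gt_eqF//.
by rewrite lerD2r lef_pV2.
Qed.

Lemma crossing_homo (s t : R) : 0 < s -> s <= t -> t <= 1 ->
  crossing G s <= crossing G t.
Proof.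
move=> s0 st; rewrite le_eqVlt => /orP[/eqP st1|t1].
  rewrite st1 crossing1; apply: perc_prob_le1.
  by rewrite (ltW s0) -st1 st.
have t0 := lt_le_trans s0 st; have s1 := le_lt_trans st t1.
have [fs0 _] := andP (crossing_in01_strict (introT andP (conj s0 s1))).
have [ft0 _] := andP (crossing_in01_strict (introT andP (conj t0 t1))).
rewrite -odds_against_le//.
have os := odds_against_gt0 (introT andP (conj s0 s1)).
have ofs := odds_against_gt0 (crossing_in01_strict (introT andP (conj s0 s1))).
rewrite -(ler_pM2r os); apply: le_trans (odds_against_crossing s0 st t1) _.
by rewrite mulrC ler_wpM2l ?odds_against_le// ltW.
Qed.

End CrossingProbability.

(** * Behaviour above the fixed point *)

Section Supercritical.
Import mathcomp.boot.finset.
Variables (R : realType) (G : ograph).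

Let f := @crossing R G.

Lemma iter_crossing_ge (s q : R) i : 0 < s < 1 -> s <= f s -> s <= q <= 1 ->
  [/\ s <= iter i f s, iter i f s < 1 & iter i f s <= iter i f q <= 1].
Proof.
move=> s01 sf /andP[sq q1]; have [s0 s1] := andP s01.
elim: i => [|i [h1 h2 /andP[h3 h4]]] /=; first by rewrite sq q1.
have x0 := lt_le_trans s0 h1.
have m1 : f s <= f (iter i f s) := crossing_homo G s0 h1 (ltW h2).
have m2 : f (iter i f s) <= f (iter i f q) := crossing_homo G x0 h3 h4.
have m3 : f (iter i f s) < 1.
  by have /andP[] := crossing_in01_strict G (introT andP (conj x0 h2)).
have m4 : f (iter i f q) <= 1.
  by apply: perc_prob_le1; rewrite h4 andbT ltW// (lt_le_trans x0).
by split; rewrite ?m2 ?m4//; exact: le_trans sf m1.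
Qed.

(** Above the fixed point the odds of being closed decay geometrically along the
    iterates, so the product of the iterates converges. *)
Lemma prod_iter_crossing_ge (s : R) : 0 < s < 1 -> s < f s ->
  exists2 c, 0 < c & forall k q, s <= q <= 1 -> c <= \prod_(i < k) iter i f q.
Proof.
move=> s01 sf; have [s0 s1] := andP s01.
pose r := odds_against s; have r0 : 0 < r := odds_against_gt0 s01.
pose kap := odds_against (f s) / r.
have fs0 : 0 < f s := lt_trans s0 sf.
have fs01 := crossing_in01_strict G s01.
have kap0 : 0 < kap by rewrite divr_gt0// odds_against_gt0.
have kap1 : kap < 1.
  by rewrite ltr_pdivrMr// mul1r ltNge odds_against_le// -ltNge.
have decay i : odds_against (iter i f s) <= r * kap ^+ i.
  elim: i => [|i ih]; first by rewrite expr0 mulr1.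
  have [h1 h2 _] := iter_crossing_ge i s01 (ltW sf) (introT andP (conj (lexx s) (ltW s1))).
  have h := odds_against_crossing G s0 h1 h2.
  rewrite -(ler_pM2r r0) iterS; apply: le_trans h _.
  have -> : r * kap ^+ i.+1 * r = (r * kap ^+ i) * odds_against (f s).
    by rewrite exprS [odds_against (f s)](_ : _ = kap * r); [ring|rewrite divfK ?gt_eqF].
  by rewrite ler_wpM2r// ltW// odds_against_gt0.
pose S k := \sum_(i < k) r * kap ^+ i.
have Sle k : S k <= r / (1 - kap).
  rewrite ler_pdivlMr ?subr_gt0//.
  have -> : S k * (1 - kap) = r * (1 - kap ^+ k).
    rewrite /S; elim: k => [|k ih]; first by rewrite big_ord0 expr0 subrr mulr0 mul0r.
    by rewrite big_ord_recr /= mulrDl ih exprS; ring.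
  rewrite ger_pMr// gerBl; exact: exprn_ge0 (ltW kap0).
exists (expR (- (r / (1 - kap)))); first exact: expR_gt0.
move=> k q sq; apply: (@le_trans _ _ (expR (- S k))); first by rewrite ler_expR lerN2.
rewrite /S -sumrN expR_sum; apply: ler_prod => i _; rewrite expR_ge0 /=.
have [h1 h2 /andP[h3 _]] := iter_crossing_ge i s01 (ltW sf) sq.
apply: le_trans h3; have x0 := lt_le_trans s0 h1.
apply: (@le_trans _ _ (expR (- odds_against (iter i f s)))); first by rewrite ler_expR lerN2.
rewrite expRN -[leRHS]invrK lef_pV2 ?posrE ?expR_gt0 ?invr_gt0//.
apply: le_trans (expR_ge1Dx _); rewrite /odds_against mulrBl mul1r divff ?gt_eqF//.
by rewrite addrC subrK.
Qed.

Hypothesis two_paths : edge_disjoint_paths (src G) (tgt G).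

Lemma type_prod_both_ge (q : R) k : 0 <= q <= 1 ->
  #|edges G|%:R ^+ k * (\prod_(i < k) iter i f q) ^+ #|edges G| <=
  type_prod G q k ord_max ord_max.
Proof.
move=> q01; elim: k => [|k ih]; first by rewrite big_ord0 expr0 expr1n mulr1 mxE eqxx.
rewrite big_ord_recr type_prodSr mxE (bigD1 (ord_max : 'I_3))//=.
have x01 := iter_crossing_in01 G k q01.
apply: ler_wpDr.
  by apply: sumr_ge0 => i _; rewrite mulr_ge0 ?cluster_matrix_ge0 ?type_prod_ge0.
set x := iter k f q; rewrite -/x in x01 *.
apply: (@le_trans _ _ ((#|edges G|%:R * x ^+ #|edges G|) *
    (#|edges G|%:R ^+ k * (\prod_(i < k) iter i f q) ^+ #|edges G|))).
  by rewrite exprS exprMn le_eqVlt; apply/orP; left; apply/eqP; ring.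
apply: ler_pM => //; last exact: cluster_matrix_both_ge.
- by rewrite mulr_ge0 ?ler0n// exprn_ge0//; case/andP: x01.
- rewrite mulr_ge0 ?exprn_ge0 ?ler0n// prodr_ge0// => i _.
  by have /andP[] := iter_crossing_in01 G i q01.
Qed.

End Supercritical.

Section Regularity.
Import mathcomp.boot.finset.
Variable R : realType.

Lemma weight_exp_lipschitz (s q t : R) (a b n : nat) : 0 < s -> s <= q -> q <= t -> t < 1 ->
  (a <= n)%N -> (b <= n)%N ->
  let C := n%:R * (s^-1 + (1 - t)^-1) in
  q ^+ a * (1 - q) ^+ b <= expR (C * (q - s)) * (s ^+ a * (1 - s) ^+ b) /\
  s ^+ a * (1 - s) ^+ b <= expR (C * (q - s)) * (q ^+ a * (1 - q) ^+ b).
Proof.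
move=> s0 sq qt t1 an bn /=.
have d0 : 0 <= q - s by rewrite subr_ge0.
have q0 := lt_le_trans s0 sq; have q1 := le_lt_trans qt t1; have s1 := le_lt_trans sq q1.
have si : 0 < s^-1 by rewrite invr_gt0.
have ti : 0 < (1 - t)^-1 by rewrite invr_gt0 subr_gt0.
have base : q <= s * expR (s^-1 * (q - s)).
  apply: (@le_trans _ _ (s * (1 + s^-1 * (q - s)))).
    by rewrite mulrDr mulr1 mulrA divff ?gt_eqF// mul1r addrC subrK.
  by rewrite ler_wpM2l ?expR_ge1Dx// ltW.
have base' : 1 - s <= (1 - q) * expR ((1 - t)^-1 * (q - s)).
  apply: (@le_trans _ _ ((1 - q) * (1 + (1 - t)^-1 * (q - s)))); last first.
    by rewrite ler_wpM2l ?expR_ge1Dx// subr_ge0 ltW.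
  rewrite mulrDr mulr1 mulrA -lerBlDl.
  have -> : 1 - s - (1 - q) = 1 * (q - s) by ring.
  apply: ler_wpM2r => //.
  by rewrite ler_pdivlMr ?subr_gt0// mul1r lerB.
have pw (x y D : R) m : 0 <= x -> 0 <= D -> 0 <= y -> x <= y * expR D -> (m <= n)%N ->
    x ^+ m <= y ^+ m * expR (n%:R * D).
  move=> x0 D0 y0 xy mn; apply: (@le_trans _ _ ((y * expR D) ^+ m)).
    by apply: lerXn2r; rewrite ?nnegrE// mulr_ge0// expR_ge0.
  rewrite exprMn -expRM_natl ler_wpM2l ?exprn_ge0// ler_expR.
  by rewrite ler_wpM2r// ler_nat.
have E D D' : 0 <= D -> 0 <= D' -> expR (n%:R * (D * (q - s))) <=
    expR (n%:R * (D + D') * (q - s)) /\ expR (n%:R * (D' * (q - s))) <=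
    expR (n%:R * (D + D') * (q - s)).
  move=> D0 D'0; rewrite !ler_expR -!mulrA; split; rewrite ler_wpM2l ?ler0n//;
    by rewrite ler_wpM2r// ?lerDl ?lerDr.
have [E1 E2] := E _ _ (ltW si) (ltW ti).
split.
  apply: (@le_trans _ _ ((s ^+ a * expR (n%:R * (s^-1 * (q - s)))) * (1 - s) ^+ b)).
    apply: ler_pM; rewrite ?exprn_ge0 ?subr_ge0 ?(ltW q0) ?(ltW q1)//.
      by apply: pw => //; rewrite ?mulr_ge0 ?(ltW q0) ?(ltW s0) ?(ltW si).
    by apply: lerXn2r; rewrite ?nnegrE ?subr_ge0 ?(ltW q1) ?(ltW s1)// lerB.
  rewrite mulrAC [leRHS]mulrC; apply: ler_wpM2l => //.
  by rewrite mulr_ge0// exprn_ge0 ?subr_ge0 ?(ltW s0) ?(ltW s1).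
apply: (@le_trans _ _ (q ^+ a * ((1 - q) ^+ b * expR (n%:R * ((1 - t)^-1 * (q - s)))))).
  apply: ler_pM; rewrite ?exprn_ge0 ?subr_ge0 ?(ltW s0) ?(ltW s1)//.
    by apply: lerXn2r; rewrite ?nnegrE ?(ltW s0) ?(ltW q0).
  by apply: pw => //; rewrite ?mulr_ge0 ?subr_ge0 ?(ltW q1) ?(ltW s1) ?(ltW ti).
rewrite [leRHS]mulrC [leLHS]mulrA; apply: ler_wpM2l => //.
by rewrite mulr_ge0// exprn_ge0 ?subr_ge0 ?(ltW q0) ?(ltW q1).
Qed.

(** A comparison factor that tends to one exponentially in [q - s] can be multiplied
    along an orbit whose distances to [s] have a bounded sum. The comparison holds
    configuration by configuration. *)
Lemma perc_prob_exp_lipschitz (V : finType) (F : {set V * V}) A (s q t : R) n :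
  0 < s -> s <= q -> q <= t -> t < 1 -> (#|F| <= n)%N ->
  let C := n%:R * (s^-1 + (1 - t)^-1) in
  perc_prob q F A <= expR (C * (q - s)) * perc_prob s F A /\
  perc_prob s F A <= expR (C * (q - s)) * perc_prob q F A.
Proof.
move=> s0 sq qt t1 Fn /=; rewrite /perc_prob !mulr_sumr.
have H w : w \in powerset F -> (#|w| <= n)%N /\ (#|F :\: w| <= n)%N.
  rewrite powersetE => wF; split; apply: leq_trans Fn; apply: subset_leq_card => //.
  exact: subsetDl.
split; apply: ler_sum => w /andP[/H[h1 h2] _];
  by have [] := weight_exp_lipschitz s0 sq qt t1 h1 h2.
Qed.

Lemma cluster_matrix_exp_lipschitz (G : ograph) (s q t : R) i j :
  0 < s -> s <= q -> q <= t -> t < 1 ->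
  let C := #|edges G|%:R * (s^-1 + (1 - t)^-1) in
  cluster_matrix G q i j <= expR (C * (q - s)) * cluster_matrix G s i j /\
  cluster_matrix G s i j <= expR (C * (q - s)) * cluster_matrix G q i j.
Proof.
move=> s0 sq qt t1 /=; rewrite !cluster_matrixE !mulr_sumr.
have H e : (#|edges G :\ e| <= #|edges G|)%N by apply: subset_leq_card; exact: subsetDl.
by split; apply: ler_sum => e _;
  have [] := perc_prob_exp_lipschitz
    (fun w => reach_type w (end_set e j) i) s0 sq qt t1 (H e).
Qed.

(** The linearisation of [P] at a fixed point, with the same multiplicative form of
    the error. *)
Lemma poly_fixpoint_exp (P : {poly R}) (s : R) : 0 < s < 1 -> P.[s] = s ->
  1 < P^`().[s] ->
  exists t lam C, [/\ s < t < 1, 1 < lam, 0 <= C &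
    forall x, s <= x <= t -> [/\ lam * (x - s) <= P.[x] - s,
      P.[x] - s <= P^`().[s] * (x - s) * expR (C * (x - s)) &
      P^`().[s] * (x - s) <= expR (C * (x - s)) * (P.[x] - s)]].
Proof.
move=> /andP[s0 s1] Ps; set z := P^`().[s] => z1.
have [g gE] : exists g, P - s%:P = g * ('X - s%:P).
  by apply/factor_theorem; rewrite /root !hornerE Ps subrr.
have PE x : P.[x] - s = g.[x] * (x - s).
  by have := congr1 (horner^~ x) gE; rewrite !hornerE.
have gs : g.[s] = z.
  have := congr1 (fun p => p^`().[s]) gE.
  rewrite derivB derivM derivB derivX !derivC subr0 !hornerE.
  by rewrite subrr mulr0 add0r subr0 mulr1 /z => ->.
have [h hE] : exists h, g - z%:P = h * ('X - s%:P).
  by apply/factor_theorem; rewrite /root !hornerE gs subrr.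
have gE' x : g.[x] - z = h.[x] * (x - s).
  by have := congr1 (horner^~ x) hE; rewrite !hornerE.
have [L0 L0P] := poly_itv_bound h 0 1.
pose L := `|L0| + 1; have L1 : 1 <= L by rewrite lerDr normr_ge0.
have L0' : 0 < L by exact: lt_le_trans L1.
pose del := Num.min ((z - 1) / (2 * L)) ((1 - s) / 2).
have del0 : 0 < del.
  by rewrite lt_min !divr_gt0 ?subr_gt0 ?mulr_gt0.
have delz : L * del <= (z - 1) / 2.
  apply: (@le_trans _ _ (L * ((z - 1) / (2 * L)))).
    by rewrite ler_pM2l// ge_min lexx.
  by rewrite le_eqVlt; apply/orP; left; apply/eqP; field; rewrite gt_eqF.
have dels : del <= (1 - s) / 2 by rewrite ge_min lexx orbT.
exists (s + del), ((z + 1) / 2), L; split => //; try lra; try (apply/andP; split; lra).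
move=> x /andP[sx xd]; set d := x - s.
have d0 : 0 <= d by rewrite subr_ge0.
have dd : d <= del by rewrite /d; lra.
have hb : `|g.[x] - z| <= L * d.
  rewrite gE' normrM (ger0_norm d0); apply: ler_wpM2r => //.
  apply: (@le_trans _ _ L0); last by rewrite /L; have := ler_norm L0; lra.
  by apply: L0P; apply/andP; split; lra.
have Ld : L * d <= (z - 1) / 2 by apply: le_trans delz; rewrite ler_pM2l.
move: hb; rewrite ler_norml => /andP[hb1 hb2].
have e1 : 1 + L * d <= expR (L * d) := expR_ge1Dx _.
have Ldg : 0 <= L * d by rewrite mulr_ge0// ltW.
rewrite PE -/d; split.
- by apply: ler_wpM2r => //; lra.
- rewrite mulrAC; apply: ler_wpM2r => //.
  apply: (@le_trans _ _ (z * (1 + L * d))); last by rewrite ler_wpM2l//; lra.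
  by rewrite mulrDr mulr1; have := ler_wpM2r Ldg (ltW z1); lra.
- rewrite mulrA; apply: ler_wpM2r => //.
  have g1 : 1 <= g.[x] by lra.
  apply: (@le_trans _ _ ((1 + L * d) * g.[x])); last by rewrite ler_wpM2r//; lra.
  by rewrite mulrDl mul1r; have := ler_wpM2l Ldg g1; lra.
Qed.

End Regularity.

(** * Products of matrices near criticality *)

Section NearCritical.
Import mathcomp.boot.finset.
Variables (R : realType) (G : ograph).
Hypothesis nadj : ~~ link (edges G) (src G) (tgt G).
Hypothesis two_paths : edge_disjoint_paths (src G) (tgt G).
Variable ps : R.
Hypothesis ps01 : 0 < ps < 1.
Hypothesis ps_fixed : crossing G ps = ps.

Let f := @crossing R G.
Let z := (event_poly R (edges G) (@crossed G))^`().[ps].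
Let M := @cluster_matrix R G.
Let m := #|edges G|.

(** [N] is the first time the iterates of [p] reach [t]. Since each step multiplies
    the distance to the fixed point by at least [lam], the distances up to [N] sum to
    at most [1 / (lam - 1)], and all the errors accumulated up to [N] are bounded by
    [exp (C / (lam - 1))]. *)
Lemma scale_estimates : exists rho A b K : R,
  [/\ [/\ 0 < rho, 0 < A, 0 < b & 1 <= K], largest_eigenvalue (M ps) = rho &
    forall p, ps < p < 1 -> exists N,
    [/\ \sum_i type_prod G p N i ord_max <= A * rho ^+ N,
        forall k, b * rho ^+ N * m%:R ^+ k <=
          \sum_i type_prod G p (k + N) i ord_max,
        z ^+ N * (p - ps) <= K & 1 <= K * (z ^+ N * (p - ps))]].
Proof.
have [ps0 ps1] := andP ps01.
have ps01w : 0 <= ps <= 1 by rewrite !ltW.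
have z1 : 1 < z := deriv_fixpoint_gt1 nadj ps01 ps_fixed.
have fP x : f x = (event_poly R (edges G) (@crossed G)).[x].
  by rewrite /f crossing_horner.
have [t [lam [C1 [/andP[pst t1] lam1 C10 Pt]]]] :=
  poly_fixpoint_exp ps01 (etrans (esym (fP ps)) ps_fixed) z1.
pose C2 := m%:R * (ps^-1 + (1 - t)^-1).
have C20 : 0 <= C2.
  by rewrite mulr_ge0// addr_ge0// invr_ge0 ?subr_ge0 ltW.
pose C := C1 + C2; have C0 : 0 <= C by exact: addr_ge0.
have t0 : 0 < t := lt_trans ps0 pst.
have lam0 : 0 < lam - 1 by rewrite subr_gt0.
have lampos : 0 < lam := lt_trans ltr01 lam1.
have zpos : 0 < z := lt_trans ltr01 z1.
have expC1 d : 0 <= d -> expR (C1 * d) <= expR (C * d).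
  by move=> d0; rewrite ler_expR ler_wpM2r// lerDl.
have expC2 d : 0 <= d -> expR (C2 * d) <= expR (C * d).
  by move=> d0; rewrite ler_expR ler_wpM2r// lerDr.
have fstep x : ps <= x <= t -> [/\ lam * (x - ps) <= f x - ps,
      f x - ps <= z * (x - ps) * expR (C * (x - ps)) &
      z * (x - ps) <= expR (C * (x - ps)) * (f x - ps)].
  move=> xpt; have [h1 h2 h3] := Pt x xpt; have [px xt] := andP xpt.
  have d0 : 0 <= x - ps by rewrite subr_ge0.
  have fd : 0 <= f x - ps by rewrite fP; apply: le_trans h1; rewrite mulr_ge0//; lra.
  rewrite fP; split => //.
    apply: le_trans h2 _; rewrite ler_wpM2l ?expC1// mulr_ge0//; exact: ltW.
  by apply: le_trans h3 _; rewrite ler_wpM2r ?expC1// -fP.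
have Mstep x i j : ps <= x <= t -> M x i j <= expR (C * (x - ps)) * M ps i j /\
    M ps i j <= expR (C * (x - ps)) * M x i j.
  move=> /andP[px xt]; have d0 : 0 <= x - ps by rewrite subr_ge0.
  have [h1 h2] := cluster_matrix_exp_lipschitz G i j ps0 px xt t1.
  have x01 : 0 <= x <= 1.
    by rewrite (le_trans _ px) ?(ltW ps0)//= (le_trans xt)// ltW.
  split; [apply: le_trans h1 _|apply: le_trans h2 _].
    by rewrite ler_wpM2r ?expC2// cluster_matrix_ge0.
  by rewrite ler_wpM2r ?expC2// cluster_matrix_ge0.
have M0 i j : 0 <= M ps i j by exact: cluster_matrix_ge0.
have Mcol i : 0 < M ps i ord_max by exact: cluster_matrix_last_col_gt0.
have Mrow j : 0 < M ps ord_max j by exact: cluster_matrix_last_row_gt0.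
have [rho [v [rho0 v0 Mv]]] := perron_vector3 M0 Mcol Mrow.
have tf : t < f t.
  have [h _ _] := fstep t (introT andP (conj (ltW pst) (lexx t))).
  have : 0 < (lam - 1) * (t - ps) by rewrite mulr_gt0// subr_gt0.
  by rewrite mulrBl mul1r; lra.
have [c0 c00 prod_ge] := prod_iter_crossing_ge (introT andP (conj t0 t1)) tf.
pose K := expR (C / (lam - 1)).
have K1 : 1 <= K.
  by apply: le_trans (expR_ge1Dx _); rewrite lerDl divr_ge0// ltW.
have K0 : 0 < K := lt_le_trans ltr01 K1.
pose V := \sum_i v i.
(* The vector [a * rho * v] lies below the last column of [M ps], which is the state
   after one step up to the comparison factor; before that step only the last
   coordinate is positive, whence [b0]. *)
pose a := (\sum_i rho * v i / M ps i ord_max)^-1.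
have terms0 i : 0 < rho * v i / M ps i ord_max by rewrite divr_gt0// mulr_gt0.
have sum0 : 0 < \sum_i rho * v i / M ps i ord_max.
  by rewrite (bigD1 ord_max)//= ltr_pwDl//; apply: sumr_ge0 => i _; rewrite ltW.
have a0 : 0 < a by rewrite invr_gt0.
have aM i : a * (rho * v i) <= M ps i ord_max.
  rewrite /a ler_pdivrMl// -ler_pdivrMr//.
  by rewrite (bigD1 i)//= lerDl; apply: sumr_ge0 => j _; rewrite ltW.
pose b0 := Num.min 1 (a * v ord_max).
have b00 : 0 < b0 by rewrite lt_min ltr01 mulr_gt0.
have V0 : 0 < V.
  by rewrite /V (bigD1 ord_max)//= ltr_pwDl//; apply: sumr_ge0 => i _; rewrite ltW.
exists rho, ((v ord_max)^-1 * K * V), (c0 ^+ m * (b0 / K)), (K + K / (t - ps)).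
have tps : 0 < t - ps by rewrite subr_gt0.
split.
- split => //.
  + by rewrite !mulr_gt0// invr_gt0.
  + by rewrite mulr_gt0 ?exprn_gt0// divr_gt0.
  + by apply: (le_trans K1); rewrite lerDl divr_ge0// ltW.
- exact: (largest_eigenvalueE ord_max M0 v0 Mv).
move=> p /andP[psp p1]; pose x i := iter i f p; pose d i := x i - ps.
have p01 : 0 <= p <= 1 by rewrite !ltW// (lt_trans ps0).
have x01 i : 0 <= x i <= 1 by exact: iter_crossing_in01.
have d0pos : 0 < d 0%N by rewrite subr_gt0.
have growth n : (forall i, (i < n)%N -> x i < t) -> lam ^+ n * d 0%N <= d n.
  elim: n => [|n ih] h; first by rewrite expr0 mul1r.
  have ihn := ih (fun i hi => h i (leqW hi)).
  have dn : 0 <= d n by apply: le_trans ihn; rewrite mulr_ge0 ?exprn_ge0 ?(ltW d0pos)//; lra.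
  have pxn : ps <= x n by rewrite -subr_ge0.
  have [h1 _ _] := fstep (x n) (introT andP (conj pxn (ltW (h n (ltnSn n))))).
  apply: le_trans h1; rewrite exprS -mulrA; apply: ler_wpM2l => //; lra.
have exN : exists n, t <= x n.
  apply: contrapT => no.
  have xt i : x i < t by rewrite ltNge; apply/negP => ti; apply: no; exists i.
  have lamV : `|lam^-1| < 1.
    rewrite ger0_norm ?invr_ge0; last by lra.
    by rewrite invf_lt1//; lra.
  have /cvgrPdist_lt/(_ _ d0pos)[n _ /(_ n (leqnn n))] := cvg_expr lamV.
  rewrite sub0r normrN ger0_norm ?exprn_ge0 ?invr_ge0//; last by lra.
  have l0 : 0 < lam ^+ n by rewrite exprn_gt0//; lra.
  rewrite exprVn -(ltr_pM2l l0) divff ?gt_eqF// => h.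
  have := growth n (fun i _ => xt i).
  have /andP[_ xn1] := x01 n; rewrite {2}/d; lra.
have [N tN Nmin] : exists2 N, t <= x N & forall i, (i < N)%N -> x i < t.
  exists (ex_minn exN); case: ex_minnP => n tn nmin // i ilt.
  by rewrite ltNge; apply/negP => /nmin; rewrite leqNgt ilt.
pose S n := \sum_(i < n) d i.
have SS n : S n.+1 = S n + d n by rewrite /S big_ord_recr.
have eS n : expR (C * S n.+1) = expR (C * S n) * expR (C * d n).
  by rewrite SS mulrDr expRD.
have dpos n : (n <= N)%N -> 0 < d n.
  move=> nN; apply: lt_le_trans (growth n _).
    by rewrite mulr_gt0 ?exprn_gt0//; lra.
  by move=> i ilt; apply: Nmin; exact: leq_trans ilt nN.
have xin n : (n < N)%N -> ps <= x n <= t.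
  move=> nN; rewrite (ltW (Nmin n nN)) andbT -subr_ge0 ltW//; exact: dpos (ltnW nN).
have Sd n : (n <= N)%N -> S n * (lam - 1) <= d n.
  elim: n => [_|n ih nN]; first by rewrite /S big_ord0 mul0r ltW.
  have [h1 _ _] := fstep (x n) (xin n nN).
  have := ih (ltnW nN); rewrite SS mulrDl /d /= in h1 *; rewrite -/(x n); lra.
have SK n : (n <= N)%N -> expR (C * S n) <= K.
  move=> nN; rewrite ler_expR ler_wpM2l// -[leRHS]mul1r ler_pdivlMr//.
  by apply: le_trans (Sd n nN) _; have /andP[] := x01 n; rewrite /d; lra.
have zd n : (n <= N)%N -> z ^+ n * d 0%N <= expR (C * S n) * d n /\
    d n <= z ^+ n * d 0%N * expR (C * S n).
  elim: n => [_|n ih nN].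
    by rewrite /S big_ord0 mulr0 expR0 expr0 !mul1r mulr1.
  have [_ h2 h3] := fstep (x n) (xin n nN); have [i1 i2] := ih (ltnW nN).
  rewrite eS exprS; split.
    rewrite -mulrA; apply: le_trans (ler_wpM2l (ltW zpos) i1) _.
    rewrite mulrCA -[leRHS]mulrA; apply: ler_wpM2l; first exact: expR_ge0.
    exact: h3.
  apply: le_trans h2 _.
  rewrite (_ : z * z ^+ n * d 0%N * (expR (C * S n) * expR (C * d n)) =
     z * (z ^+ n * d 0%N * expR (C * S n)) * expR (C * d n)); last by ring.
  by apply: ler_wpM2r; [exact: expR_ge0|apply: ler_wpM2l => //; exact: ltW].
pose y n i := type_prod G p n i ord_max.
have yS n i : y n.+1 i = \sum_j M (x n) i j * y n j.
  by rewrite /y type_prodSr mxE.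
have y0 n i : 0 <= y n i by exact: type_prod_ge0.
have vmax0 := v0 ord_max.
have yup n : (n <= N)%N -> forall i, y n i <= (v ord_max)^-1 * expR (C * S n) * (rho ^+ n * v i).
  elim: n => [_ i|n ih nN i].
    rewrite /y /= mxE /S big_ord0 mulr0 expR0 expr0 mul1r mulr1.
    have [->|_] := eqVneq i ord_max; first by rewrite mulVf// gt_eqF.
    by rewrite mulr_ge0// ?invr_ge0 ltW.
  rewrite yS; apply: (@le_trans _ _ (\sum_j expR (C * d n) * M ps i j *
     ((v ord_max)^-1 * expR (C * S n) * (rho ^+ n * v j)))).
    apply: ler_sum => j _; apply: ler_pM => //; last exact: ih (ltnW nN) j.
      exact: cluster_matrix_ge0.
    by have [] := Mstep (x n) i j (xin n nN).
  have -> : \sum_j expR (C * d n) * M ps i j *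
     ((v ord_max)^-1 * expR (C * S n) * (rho ^+ n * v j)) =
     expR (C * d n) * ((v ord_max)^-1 * expR (C * S n) * rho ^+ n) * \sum_j M ps i j * v j.
    by rewrite mulr_sumr; apply: eq_bigr => j _; ring.
  rewrite Mv eS exprS le_eqVlt; apply/orP; left; apply/eqP; ring.
have ylow n : (n < N)%N -> forall i, a * (rho ^+ n.+1 * v i) <= expR (C * S n.+1) * y n.+1 i.
  elim: n => [|n ih] nN i.
    rewrite expr1 SS /S big_ord0 add0r; apply: le_trans (aM i) _.
    have -> : y 1%N i = M (x 0%N) i ord_max by rewrite /y /= mul1mx.
    by have [] := Mstep (x 0%N) i ord_max (xin 0%N nN).
  apply: (@le_trans _ _ (\sum_j M ps i j * (expR (C * S n.+1) * y n.+1 j))).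
    apply: (@le_trans _ _ (\sum_j M ps i j * (a * (rho ^+ n.+1 * v j)))).
      have -> : \sum_j M ps i j * (a * (rho ^+ n.+1 * v j)) =
        a * rho ^+ n.+1 * \sum_j M ps i j * v j.
        by rewrite mulr_sumr; apply: eq_bigr => j _; ring.
      by rewrite Mv exprS le_eqVlt; apply/orP; left; apply/eqP; ring.
    by apply: ler_sum => j _; apply: ler_wpM2l => //; exact: ih (ltnW nN) j.
  rewrite yS mulr_sumr; apply: ler_sum => j _.
  rewrite (eS n.+1).
  have -> : expR (C * S n.+1) * expR (C * d n.+1) * (M (x n.+1) i j * y n.+1 j) =
    (expR (C * d n.+1) * M (x n.+1) i j) * (expR (C * S n.+1) * y n.+1 j) by ring.
  apply: ler_wpM2r; first by rewrite mulr_ge0// expR_ge0.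
  by have [] := Mstep (x n.+1) i j (xin n.+1 nN).
have yN : b0 / K * rho ^+ N <= y N ord_max.
  rewrite mulrAC ler_pdivrMr//.
  have yN0 : b0 * rho ^+ N <= expR (C * S N) * y N ord_max.
    case EN : N => [|n].
      rewrite expr0 /S big_ord0 mulr0 expR0 mul1r mulr1 /y /= mxE eqxx.
      by rewrite ge_min lexx.
    apply: le_trans (ylow n _ ord_max); last by rewrite EN.
    rewrite [_ * v _]mulrC mulrA; apply: ler_wpM2r; first by rewrite exprn_ge0// ltW.
    by rewrite ge_min lexx orbT.
  apply: le_trans yN0 _; rewrite mulrC; apply: ler_wpM2l => //.
  exact: SK (leqnn N).
have [zd1 zd2] := zd N (leqnn N); have SKN := SK N (leqnn N).
have dN1 : d N <= 1 by have /andP[_] := x01 N; rewrite /d; lra.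
have dN0 := dpos N (leqnn N).
have zN0 : 0 <= z ^+ N * d 0%N by rewrite mulr_ge0 ?exprn_ge0// ltW.
exists N; split.
- apply: (@le_trans _ _ (\sum_i (v ord_max)^-1 * K * (rho ^+ N * v i))).
    apply: ler_sum => i _; apply: le_trans (yup N (leqnn N) i) _.
    apply: ler_wpM2r; first by rewrite mulr_ge0 ?exprn_ge0 ?ltW.
    by apply: ler_wpM2l => //; rewrite invr_ge0 ltW.
  rewrite -mulr_sumr -mulr_sumr -/V le_eqVlt; apply/orP; left; apply/eqP; ring.
- move=> k; rewrite type_prodD.
  have q01 : t <= x N <= 1 by rewrite tN; have /andP[] := x01 N.
  apply: (@le_trans _ _ (type_prod G (x N) k ord_max ord_max * y N ord_max)).
    apply: (@le_trans _ _ ((m%:R ^+ k * c0 ^+ m) * (b0 / K * rho ^+ N))).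
      by rewrite le_eqVlt; apply/orP; left; apply/eqP; ring.
    apply: ler_pM => //.
    + by rewrite mulr_ge0 ?exprn_ge0 ?ler0n// ltW.
    + by rewrite mulr_ge0 ?exprn_ge0 ?divr_ge0// ltW.
    apply: (@le_trans _ _ (m%:R ^+ k * (\prod_(i < k) iter i f (x N)) ^+ m)); last first.
      exact: type_prod_both_ge.
    apply: ler_wpM2l; first by rewrite exprn_ge0 ?ler0n.
    have cq := prod_ge k _ q01.
    apply: lerXn2r => //; rewrite nnegrE ltW//.
    exact: lt_le_trans c00 cq.
  rewrite (bigD1 ord_max)//= mxE (bigD1 ord_max)//= -addrA lerDl.
  apply: addr_ge0; apply: sumr_ge0 => i _; first by rewrite mulr_ge0 ?type_prod_ge0 ?x01.
  by rewrite mxE; apply: sumr_ge0 => j _; rewrite mulr_ge0 ?type_prod_ge0 ?x01.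
- apply: le_trans zd1 _; apply: (@le_trans _ _ (K * 1)).
    by apply: ler_pM => //; exact: ltW.
  by rewrite mulr1 lerDl divr_ge0// ltW.
- rewrite -/(x 0%N) -/(d 0%N) mulrDl.
  apply: (@le_trans _ _ (K / (t - ps) * (z ^+ N * d 0%N))); last first.
    by rewrite lerDr mulr_ge0// ltW.
  rewrite mulrAC ler_pdivlMr// mul1r.
  have h1 : t - ps <= d N by rewrite /d lerD2r.
  apply: (le_trans h1); apply: le_trans zd2 _.
  by rewrite mulrC; apply: ler_wpM2r.
Qed.

End NearCritical.

(** * The finite-dimensional laws of percolation *)

Local Open Scope classical_set_scope.

Section FiniteDimensionalLaw.
Variables (R : realType) (p : R) (Q : probability config_space R).
Hypothesis QB : bernoulli_product p Q.
Variables (I : finType) (c : I -> nat * nat).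
Hypothesis c_inj : injective c.

Definition trace (w : config_space) : {set I} := [set i | w (c i)]%SET.

Let measurable_coord e b : measurable [set w : config_space | w e = b].
Proof.
have mT : measurable [set w : config_space | w e].
  by apply: sub_sigma_algebra; exists e.
case: b; first exact: mT.
rewrite (_ : [set _ | _] = ~` [set w : config_space | w e]); first exact: measurableC.
by apply/seteqP; split=> w /=; case: (w e).
Qed.

Let trace_eq t : [set w | trace w = t] =
  [set w | forall e, e \in map c (enum I) -> w e = [exists i, (c i == e) && (i \in t)]].
Proof.
have ce i t' : [exists i', (c i' == c i) && (i' \in t')] = (i \in t').
  apply/existsP/idP => [[i' /andP[/eqP/c_inj -> //]]|it].
  by exists i; rewrite eqxx.
apply/seteqP; split => w /=.
  by move=> <- _ /mapP[i _ ->]; rewrite ce inE.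
move=> h; apply/setP => i; rewrite inE h ?ce// map_f// mem_enum//.
Qed.

Let measurable_cylinder (s : seq (nat * nat)) (b : nat * nat -> bool) :
  measurable [set w : config_space | forall e, e \in s -> w e = b e].
Proof.
elim: s => [|e s ih].
  by rewrite (_ : [set _ | _] = setT)//; apply/seteqP; split.
rewrite (_ : [set _ | _] = [set w : config_space | w e = b e] `&`
    [set w : config_space | forall e, e \in s -> w e = b e]).
  exact: measurableI.
apply/seteqP; split => w /=.
  by move=> h; split; [apply: h; rewrite mem_head|move=> e' es; apply: h; rewrite inE es orbT].
by move=> [we h] e'; rewrite inE => /orP[/eqP ->//|]; exact: h.
Qed.

Let law_trace_seq (s : seq {set I}) : uniq s ->
  measurable [set w | trace w \in s] /\
  Q [set w | trace w \in s] =
  (\sum_(t <- s) p ^+ #|t| * (1 - p) ^+ #|~: t|%SET)%:E.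
Proof.
elim: s => [_|t s ih /= /andP[ts us]].
  have -> : [set w | trace w \in [::]] = set0 by apply/seteqP; split.
  by rewrite big_nil measure0; split => //; exact: measurable0.
have [ms Qs] := ih us.
have mt : measurable [set w | trace w = t] by rewrite trace_eq; exact: measurable_cylinder.
have -> : [set w | trace w \in t :: s] = [set w | trace w = t] `|` [set w | trace w \in s].
  apply/seteqP; split => w /=; rewrite inE.
    by case/orP => [/eqP|]; [left|right].
  by case=> [->|->]; rewrite ?eqxx ?orbT.
split; first exact: measurableU.
rewrite measureU//; last first.
  by apply/seteqP; split => // w [/= ->]; rewrite (negbTE ts).
rewrite big_cons EFinD -Qs; congr (_ + _)%E.
rewrite trace_eq.
apply: etrans (QB (fun e => [exists i, (c i == e) && (i \in t)]) _) _.
  by rewrite map_inj_uniq ?enum_uniq.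
congr EFin; rewrite big_map enumT -/(index_enum I).
rewrite (bigID [in t]) /=; congr (_ * _).
  rewrite -prodr_const; apply: eq_bigr => i it.
  by rewrite ifT//; apply/existsP; exists i; rewrite eqxx.
rewrite -prodr_const; apply: eq_big => [i|i it]; first by rewrite inE.
rewrite ifF//; apply/existsP => -[j /andP[/eqP/c_inj ->]].
by rewrite (negbTE it).
Qed.

Lemma measurable_trace (E : pred {set I}) : measurable [set w | E (trace w)].
Proof.
have -> : [set w | E (trace w)] = [set w | trace w \in enum E].
  by apply/seteqP; split => w /=; rewrite mem_enum.
by have [] := law_trace_seq (enum_uniq E).
Qed.

Lemma law_trace (E : pred {set I}) :
  Q [set w | E (trace w)] = (perc_exp p [set: I]%SET (fun t => (E t)%:R))%:E.
Proof.
have -> : [set w | E (trace w)] = [set w | trace w \in enum E].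
  by apply/seteqP; split => w /=; rewrite mem_enum.
have [_ ->] := law_trace_seq (enum_uniq E); congr EFin.
rewrite big_enum /= big_mkcond /perc_exp; apply: eq_big => [t|t _].
  by rewrite powersetE finset.subsetT.
rewrite finset.setTD; have -> : (t \in E) = E t by [].
by case: (E t); rewrite ?mulr1 ?mulr0.
Qed.

End FiniteDimensionalLaw.

(** * Escape from a ball as a local event *)

Section LocalEvents.
Implicit Types (G H : egraph) (w : config_space) (r : nat).

Definition escapes r G w : Prop :=
  exists2 y, ~ eball G r y &
    Defs.cluster G w (eroot G).1 y \/ Defs.cluster G w (eroot G).2 y.

(** The coordinate of a configuration that holds the state of the pair. *)
Definition pair_index (x y : nat) : nat * nat := (minn x y, maxn x y).

Lemma pair_indexC x y : pair_index x y = pair_index y x.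
Proof. by rewrite /pair_index minnC maxnC. Qed.

Lemma pair_indexP x y x' y' : pair_index x y = pair_index x' y' ->
  (x = x' /\ y = y') \/ (x = y' /\ y = x').
Proof. by case=> ? ?; lia. Qed.

Lemma eballS G r y : eball G r.+1 y <->
  eball G r y \/ exists2 x, eball G r x & eadj G x y.
Proof.
split=> [[a [s [ar sr sp sy]]]|[|[x [a [s [ar sr sp sx]]] xy]]].
- case/lastP: s sr sp sy => [|s z].
    by move=> _ _ /= <-; left; exists a, [::].
  rewrite size_rcons ltnS rcons_path last_rcons => sr /andP[sp sz] zy.
  by right; exists (last a s); [exists a, s|rewrite -zy].
- exact: (eball_le (leqnSn r)).
- exists a, (rcons s y); split => //; rewrite ?size_rcons// ?last_rcons//.
  by rewrite rcons_path sp sx.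
Qed.

Lemma eball0 G y : eball G 0 y <-> y = (eroot G).1 \/ y = (eroot G).2.
Proof.
split=> [[a [s [ar sr _ <-]]]|[->|->]].
- move: sr ar; rewrite leqn0 => /eqP/size0nil ->.
  by rewrite !inE => /orP[]/eqP ->; auto.
- exact: eball_root1.
- exact: eball_root2.
Qed.

Lemma finite_eball G r : finite_set (eball G r).
Proof.
elim: r => [|r ih].
  rewrite (_ : eball G 0 = [set (eroot G).1; (eroot G).2]); first exact: finite_set2.
  by apply/seteqP; split => y /eball0.
rewrite (_ : eball G r.+1 = eball G r `|` \bigcup_(x in eball G r) [set y | eadj G x y]).
  rewrite finite_setU; split => //; apply: bigcup_finite => // x _; exact: eadj_fin.
by apply/seteqP; split => y /eballS.
Qed.

Definition iso_on r G H (f : nat -> nat) : Prop :=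
  [/\ forall x, eball G r x -> eball H r (f x),
      forall x y, eball G r x -> eball G r y -> eadj G x y = eadj H (f x) (f y) &
      (f (eroot G).1, f (eroot G).2) = eroot H \/
      (f (eroot G).2, f (eroot G).1) = eroot H].

Lemma ball_iso_inv r G H : ball_iso r G H -> exists f g,
  [/\ iso_on r G H f, iso_on r H G g, forall x, eball G r x -> g (f x) = x &
      forall y, eball H r y -> f (g y) = y].
Proof.
move=> [f [[fun_f inj_f surj_f] adj_f root_f]].
pose g y := xget 0%N [set x | eball G r x /\ f x = y].
have gP y : eball H r y -> eball G r (g y) /\ f (g y) = y.
  move=> /surj_f[x Gx fx].
  by apply: (@xgetPex _ 0%N [set x | eball G r x /\ f x = y]); exists x.
have gf x : eball G r x -> g (f x) = x.
  move=> Gx; have [] := gP (f x) (fun_f _ Gx) => Ggx fgx.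
  by apply: inj_f; rewrite ?inE.
exists f, g; split => //; last by move=> y /gP[].
split; first by move=> y /gP[].
- by move=> x y /gP[Gx fx] /gP[Gy fy]; rewrite adj_f// fx fy.
- case: root_f => <- /=; rewrite !gf; try exact: eball_root1;
    try exact: eball_root2; by [left; case: (eroot G)|right; case: (eroot G)].
Qed.

Lemma iso_on_root r G H f : iso_on r G H f ->
  forall x, eball G 0 x -> eball H 0 (f x).
Proof.
move=> [_ _ root_f] x /eball0 h; apply/eball0.
by case: root_f => <- /=; case: h => ->; auto.
Qed.

Lemma eball_map r s G H f x : iso_on r G H f -> (s <= r)%N ->
  eball G s x -> eball H s (f x).
Proof.
move=> fi; elim: s x => [|s ih] x sr; first exact: iso_on_root fi x.
move=> /eballS[xs|[y ys yx]]; apply/eballS; first by left; apply: ih => //; exact: ltnW.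
right; exists (f y); first by apply: ih => //; exact: ltnW.
have [_ adj_f _] := fi; rewrite -adj_f//; first exact: eball_le (ltnW sr) _ ys.
by apply: (eball_le sr); apply/eballS; right; exists y.
Qed.

Definition local_adj r G w : rel nat :=
  fun x y => open_adj G w x y && `[< eball G r y >].

(** Stopping an escaping path at its first exit from the ball of radius [r]
    makes the event depend on the ball of radius [r + 1] only. *)
Lemma escapes_first_exit r G w : escapes r G w <-> exists a s y,
  [/\ eball G 0 a, path (local_adj r G w) a s, open_adj G w (last a s) y &
      ~ eball G r y].
Proof.
split; last first.
  move=> [a [s [y [a0 sp sy yr]]]]; exists y => //.
  have cl : Defs.cluster G w a y.
    exists (rcons s y); last by rewrite last_rcons.
    rewrite rcons_path sy andbT; apply: sub_path sp => u v /andP[]//.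
  by case/eball0: a0 => <-; [left|right].
move=> [y yr cl].
have [a a0 [s sp sy]] : exists2 a, eball G 0 a & Defs.cluster G w a y.
  by case: cl => cl; [exists (eroot G).1|exists (eroot G).2] => //; apply/eball0; auto.
suff H b s' : path (local_adj r G w) a b -> eball G r (last a b) ->
    path (open_adj G w) (last a b) s' -> last (last a b) s' = y ->
    exists s y, [/\ path (local_adj r G w) a s, open_adj G w (last a s) y &
      ~ eball G r y].
  have [t [z [? ? ?]]] := H [::] s isT (eball_le (leq0n r) a0) sp sy.
  by exists a, t, z.
elim: s' b => [|z s' ih] b bp br /=; first by move=> _ by_; rewrite by_ in br.
move=> /andP[bz sp'] s'y.
have [zr|zr] := pselect (eball G r z); last by exists b, z.
apply: (ih (rcons b z)); rewrite ?last_rcons//.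
by rewrite rcons_path bp /local_adj bz; apply/asboolP.
Qed.

Definition agree_on r G (f : nat -> nat) w w' : Prop :=
  forall x y, eball G r x -> eball G r y -> eadj G x y ->
    w (pair_index x y) = w' (pair_index (f x) (f y)).

(** A radius [r + 1] is needed to transport the edge by which the path leaves the
    ball of radius [r]. *)
Lemma escapes_iso r G H f g w w' : iso_on r.+1 G H f -> iso_on r.+1 H G g ->
  (forall x, eball G r.+1 x -> g (f x) = x) -> agree_on r.+1 G f w w' ->
  escapes r G w -> escapes r H w'.
Proof.
move=> fi gi gf ww /escapes_first_exit[a [s [y [a0 sp sy yr]]]].
have [_ adj_f _] := fi.
have rr := eball_le (G := G) (leqnSn r).
have openf u v : eball G r u -> open_adj G w u v -> open_adj H w' (f u) (f v).
  move=> ur /andP[uv wuv]; have vr : eball G r.+1 v by apply/eballS; right; exists u.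
  have ur' := rr _ ur.
  apply/andP; split; first by rewrite -adj_f.
  by have := ww u v ur' vr uv; rewrite /pair_index => <-.
have a_r := eball_le (leq0n r) a0.
have [lr sp'] : eball G r (last a s) /\ path (local_adj r H w') (f a) (map f s).
  elim: s a a_r sp {a0 sy} => //= z s ih a ar /andP[/andP[az /asboolP zr] /(ih _ zr)[lr ->]].
  split => //; rewrite andbT; apply/andP; split; first exact: openf.
  by apply/asboolP; exact: eball_map fi (leqnSn r) zr.
apply/escapes_first_exit; exists (f a), (map f s), (f y); split => //.
- exact: iso_on_root fi _ a0.
- by rewrite last_map; exact: openf.
- move=> /(eball_map gi (leqnSn r)); rewrite gf//.
  by apply/eballS; right; exists (last a s) => //; case/andP: sy.
Qed.

(** The escape events of two graphs with the same ball of radius [r + 1] are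
    one event of one finite family of edge states. *)
Lemma escapes_trace r G H : ball_iso r.+1 G H ->
  exists (n : nat) (c c' : 'I_n -> nat * nat) (E : pred {set 'I_n}),
  [/\ injective c, injective c',
      forall w, escapes r G w <-> E (trace c w) &
      forall w, escapes r H w <-> E (trace c' w)].
Proof.
move=> /ball_iso_inv[f [g [fi gi gf fg]]].
have [fb adj_f _] := fi; have [gb adj_g _] := gi.
pose S : set (nat * nat) := [set e | [/\ (e.1 < e.2)%N, eball G r.+1 e.1,
  eball G r.+1 e.2 & eadj G e.1 e.2]].
have finS : finite_set S.
  apply: (sub_finite_set (B := eball G r.+1 `*` eball G r.+1)).
    by move=> e [_ ? ? _].
  by apply: finite_setX; exact: finite_eball.
have /finite_seqP[s0 Ss] := finS.
pose s := undup s0.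
have sS e : e \in s <-> S e by rewrite mem_undup Ss.
pose c (i : 'I_(size s)) := nth (0%N, 0%N) s i.
pose c' (i : 'I_(size s)) := pair_index (f (c i).1) (f (c i).2).
have cS i : S (c i) by apply/sS; exact: mem_nth.
have c_inj : injective c.
  move=> i j /eqP; rewrite nth_uniq ?undup_uniq// => /eqP; exact: val_inj.
have c_idx x y : eball G r.+1 x -> eball G r.+1 y -> eadj G x y ->
    exists2 i, c i = pair_index x y & c' i = pair_index (f x) (f y).
  move=> xb yb xy; have : pair_index x y \in s.
    apply/sS; rewrite /S /pair_index /=; have [xly|ylx] := ltnP x y; first by split.
    split=> //; last by rewrite eadj_sym.
    rewrite ltn_neqAle ylx andbT; apply/eqP => yx.
    by move: xy; rewrite yx eadj_irr.
  move=> xys; have il : (index (pair_index x y) s < size s)%N by rewrite index_mem.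
  have ci : c (Ordinal il) = pair_index x y by rewrite /c /= nth_index.
  exists (Ordinal il) => //; rewrite /c' ci /pair_index /=.
  by have [xly|ylx] := ltnP x y => //; rewrite minnC maxnC.
have c'_inj : injective c'.
  move=> i j /pair_indexP h; apply: c_inj.
  have [li i1 i2 _] := cS i; have [lj j1 j2 _] := cS j.
  case: h => -[/(congr1 g) + /(congr1 g)]; rewrite !gf// => e1 e2.
    by rewrite [LHS]surjective_pairing [RHS]surjective_pairing e1 e2.
  by move: li lj; rewrite e1 e2; lia.
pose conf (t : {set 'I_(size s)}) : config_space :=
  fun e => [exists i, (i \in t) && (c i == e)].
have confE t i : conf t (c i) = (i \in t).
  apply/existsP/idP => [[j /andP[jt /eqP/c_inj <-]]//|it].
  by exists i; rewrite it eqxx.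
exists (size s), c, c', (fun t => `[< escapes r G (conf t) >]); split => // w.
  have idi : iso_on r.+1 G G id.
    by split => //; left; case: (eroot G).
  split=> [h|/asboolP]; [apply/asboolP; move: h|]; apply: (escapes_iso idi idi) => //.
    by move=> x y xb yb /(c_idx _ _ xb yb)[i <- _]; rewrite confE inE.
  by move=> x y xb yb /(c_idx _ _ xb yb)[i <- _]; rewrite confE inE.
split=> [h|/asboolP]; [apply/asboolP; move: h; apply: (escapes_iso gi fi) => //|
  apply: (escapes_iso fi gi) => //].
  move=> x y xb yb; rewrite adj_g// => /(c_idx _ _ (gb _ xb) (gb _ yb))[i ci c'i].
  by rewrite -ci confE inE c'i !fg.
by move=> x y xb yb /(c_idx _ _ xb yb)[i <- <-]; rewrite confE inE.
Qed.

End LocalEvents.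

Section EscapeProbability.
Variables (R : realType) (p : R).
Hypothesis p01 : 0 <= p <= 1.
Implicit Types (G H : egraph) (r : nat).

Let Q := percolation p.
Let QB : bernoulli_product p Q := percolationP p01.

Definition escape_prob r G : R := fine (percolation p [set w | escapes r G w]).

Lemma measurable_escapes r G : measurable [set w : config_space | escapes r G w].
Proof.
have [n [c [_ [E [ci _ cE _]]]]] := escapes_trace (@ball_iso_refl r.+1 G).
rewrite (_ : [set _ | _] = [set w | E (trace c w)]).
  exact: (measurable_trace QB ci).
by apply/seteqP; split => w /cE.
Qed.

Lemma escape_probE r G : percolation p [set w | escapes r G w] = (escape_prob r G)%:E.
Proof.
rewrite /escape_prob fineK//; apply: fin_num_measure; exact: measurable_escapes.
Qed.

Lemma escape_prob_in01 r G : 0 <= escape_prob r G <= 1.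
Proof.
rewrite -!lee_fin -escape_probE measure_ge0 /=.
by apply: probability_le1; exact: measurable_escapes.
Qed.

Lemma escape_prob_iso r G H : ball_iso r.+1 G H -> escape_prob r G = escape_prob r H.
Proof.
move=> /escapes_trace[n [c [c' [E [ci ci' cE c'E]]]]].
rewrite /escape_prob; congr fine.
have -> : [set w | escapes r G w] = [set w | E (trace c w)].
  by apply/seteqP; split => w /cE.
have -> : [set w | escapes r H w] = [set w | E (trace c' w)].
  by apply/seteqP; split => w /c'E.
by rewrite !(law_trace QB).
Qed.

(** Escape probabilities are locally constant: graphs closer than [1 / (r + 2)] have the same ball of
    radius [r + 1]. *)
Lemma continuous_escape_prob r : continuous (escape_prob r : egraph_space R -> R).
Proof.
move=> G A /nbhs_singleton fA; change (nbhs G (escape_prob r @^-1` A)).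
apply/nbhs_ballP; exists (r.+2%:R)^-1; first by rewrite /= invr_gt0.
move=> H /egraph_dist_lt[s GH].
rewrite ltf_pV2 ?posrE// ltr_nat => rs.
have GH' : ball_iso r.+1 G H by apply: ball_iso_le GH; lia.
by rewrite /= -(escape_prob_iso GH').
Qed.

(** Balls are finite, and every point of a cluster lies in some ball. *)
Lemma infinite_cluster_escapes G :
  [set w | infinite_set (Defs.cluster G w (eroot G).1) \/
           infinite_set (Defs.cluster G w (eroot G).2)] =
  \bigcap_r [set w | escapes r G w].
Proof.
have inball w x y : eball G 0 x -> Defs.cluster G w x y -> exists r, eball G r y.
  move=> x0 [s sp <-]; elim/last_ind: s sp => [_|s z ih]; first by exists 0%N.
  rewrite rcons_path last_rcons => /andP[/ih[r rb] /andP[lz _]].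
  by exists r.+1; apply/eballS; right; exists (last x s).
have root1 := eball_root1 G 0; have root2 := eball_root2 G 0.
apply/seteqP; split => w.
  move=> h r _.
  have key x : infinite_set (Defs.cluster G w x) ->
      exists2 y, ~ eball G r y & Defs.cluster G w x y.
    move=> inf; apply/not_exists2P => no; apply: inf.
    apply: sub_finite_set (finite_eball G r) => y xy.
    by have [/contrapT|//] := no y.
  by case: h => /key[y yr xy]; exists y => //; [left|right].
move=> h; apply: contrapT => /not_orP[/contrapT f1 /contrapT f2].
have : finite_set (Defs.cluster G w (eroot G).1 `|` Defs.cluster G w (eroot G).2).
  by rewrite finite_setU.
move=> /finite_seqP[s sE].
have [r rs] : exists r, forall y, y \in s -> eball G r y.
  have sub y : y \in s -> exists r, eball G r y.
    move=> ys; have : [set` s] y by [].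
    by rewrite -sE => -[]; exact: inball.
  elim: {sE} s sub => [|y s ih] sub; first by exists 0%N.
  have [|r rs] := ih; first by move=> z zs; apply: sub; rewrite inE zs orbT.
  have [|r' ry] := sub y; first by rewrite mem_head.
  exists (maxn r r') => z; rewrite inE => /orP[/eqP ->|/rs].
    by apply: eball_le ry; exact: leq_maxr.
  by apply: eball_le; exact: leq_maxl.
have [y yr cl] := h r I; apply: yr; apply: rs.
have : [set` s] y by rewrite -sE; case: cl; [left|right].
by [].
Qed.

Lemma escape_prob_cvg G : (escape_prob r G)%:E @[r --> \oo] --> root_theta G p.
Proof.
rewrite /root_theta infinite_cluster_escapes.
have -> : (fun r => (escape_prob r G)%:E) =
    percolation p \o (fun r => [set w | escapes r G w]).
  by apply/funext => r /=; rewrite escape_probE.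
apply: nonincreasing_cvg_mu.
- by rewrite [X in (X < _)%E]escape_probE ltry.
- by move=> r; exact: measurable_escapes.
- by apply: bigcap_measurable => // r _; exact: measurable_escapes.
- move=> r s rs; apply/subsetPset => w [y ys cl]; exists y => //.
  by move=> yr; apply: ys; exact: eball_le rs _ yr.
Qed.

End EscapeProbability.

(** * Escape in finite graphs *)

Section EscapeFinite.
Variables (G : ograph) (e : edge G).

Let rk (x : vertex G) : nat := enum_rank x.

Let rk_inj : injective rk.
Proof. by move=> x y /val_inj/enum_rank_inj. Qed.

Let eadj_rk x y : eadj (egraph_of e) (rk x) (rk y) = link (edges G) x y.
Proof.
apply/existsP/idP => [[x' /existsP[y' /and3P[xy /eqP/rk_inj <- /eqP/rk_inj <-]]]//|xy].
by exists x; apply/existsP; exists y; rewrite xy !eqxx.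
Qed.

Let eadj_ex x n : eadj (egraph_of e) (rk x) n ->
  exists2 y, n = rk y & link (edges G) x y.
Proof.
move=> /existsP[x' /existsP[y /and3P[xy /eqP/rk_inj <- /eqP <-]]].
by exists y.
Qed.

Let path_ex (r1 : rel nat) (r2 : rel (vertex G)) x s :
  (forall x n, r1 (rk x) n -> exists2 y, n = rk y & r2 x y) ->
  path r1 (rk x) s -> exists2 t, s = map rk t & path r2 x t.
Proof.
move=> r12; elim: s x => [|n s ih] x; first by exists [::].
move=> /= /andP[/r12[y -> xy] /ih[t -> yt]].
by exists (y :: t); rewrite //= xy.
Qed.

Let path_map (r1 : rel nat) (r2 : rel (vertex G)) x s :
  (forall x y, r2 x y -> r1 (rk x) (rk y)) ->
  path r2 x s -> path r1 (rk x) (map rk s).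
Proof.
by move=> r21; elim: s x => //= y s ih x /andP[/r21 -> /ih].
Qed.

Let eball_rk r x : eball (egraph_of e) r (rk x) <-> near r (val e) x.
Proof.
split=> [[a [s [ar sr sp sx]]]|/nearP].
  have [a' aE ea] : exists2 a', a = rk a' & a' = (val e).1 \/ a' = (val e).2.
    by move: ar; rewrite !inE => /orP[]/eqP ->;
      [exists (val e).1|exists (val e).2]; auto.
  move: sp sx; rewrite aE => /(path_ex eadj_ex)[t st tp].
  rewrite st last_map => /rk_inj tx; apply/nearP.
  have w : within r a' x by exists t; rewrite -(size_map rk) -st.
  by case: ea w => ->; [left|right].
have H a : rk a \in [:: (eroot (egraph_of e)).1; (eroot (egraph_of e)).2] ->
    within r a x -> eball (egraph_of e) r (rk x).
  move=> ar [s [sr sp <-]]; exists (rk a), (map rk s); split => //.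
  - by rewrite size_map.
  - by apply: path_map sp => u v; rewrite eadj_rk.
  - by rewrite last_map.
by case; apply: H; rewrite !inE eqxx ?orbT.
Qed.

Definition state_index (E : edge G) : nat * nat :=
  pair_index (enum_rank (val E).1) (enum_rank (val E).2).

Lemma state_index_inj : injective state_index.
Proof.
move=> E E' /pair_indexP[]-[/rk_inj h1 /rk_inj h2]; apply: val_inj.
  by rewrite [LHS]surjective_pairing [RHS]surjective_pairing h1 h2.
have := valP E; rewrite (surjective_pairing (val E)) /= h1 h2 => /edges_asym.
by rewrite -surjective_pairing (valP E').
Qed.

Definition open_edges (t : {set edge G}) : {set vertex G * vertex G} :=
  [set val E | E in t]%SET.

Let open_rk (w : config_space) x y :
  open_adj (egraph_of e) w (rk x) (rk y) = link (open_edges (trace state_index w)) x y.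
Proof.
rewrite /open_adj eadj_rk -/(pair_index (rk x) (rk y)); apply/andP/orP.
  move=> [/orP[]xy wxy]; [left|right].
    by apply/imsetP; exists (exist _ (x, y) xy); rewrite ?inE.
  by apply/imsetP; exists (exist _ (y, x) xy); rewrite ?inE // /state_index /= pair_indexC.
move=> [] /imsetP[E]; rewrite inE => wE xyE.
  split; first by apply/orP; left; rewrite xyE; exact: valP.
  by move: wE; rewrite /state_index -xyE.
split; first by apply/orP; right; rewrite xyE; exact: valP.
by move: wE; rewrite /state_index -xyE /= pair_indexC.
Qed.

Let open_ex (w : config_space) x n : open_adj (egraph_of e) w (rk x) n ->
  exists2 y, n = rk y & link (open_edges (trace state_index w)) x y.
Proof.
move=> /[dup] xn /andP[/eadj_ex[y ny _] _]; exists y => //.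
by rewrite -open_rk -ny.
Qed.

Lemma escapes_finite r (w : config_space) : escapes r (egraph_of e) w <->
  [exists x in far r (val e),
     reaches (open_edges (trace state_index w)) (end_set (val e) ord_max) x].
Proof.
split.
  move=> [n nr cl].
  have [a ea [s sp sn]] : exists2 a, a \in end_set (val e) ord_max &
      Defs.cluster (egraph_of e) w (rk a) n.
    by case: cl; [exists (val e).1|exists (val e).2]; rewrite // !inE eqxx ?orbT.
  move: sp sn => /(path_ex (@open_ex w))[t -> tp]; rewrite last_map => tn.
  apply/existsP; exists (last a t); rewrite inE; apply/andP; split.
    by apply/negP => /eball_rk; rewrite tn.
  by apply/existsP; exists a; rewrite ea; apply/connectP; exists t.
move=> /existsP[x /andP[]]; rewrite inE => xr /existsP[a /andP[ea /connectP[t tp tx]]].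
exists (rk x); first by move/eball_rk; rewrite (negbTE xr).
have : Defs.cluster (egraph_of e) w (rk a) (rk x).
  exists (map rk t); last by rewrite last_map -tx.
  by apply: path_map tp => u v; rewrite open_rk.
by move: ea; rewrite !inE => /orP[]/eqP ->; [left|right].
Qed.

Lemma escape_prob_finite (R : realType) (p : R) r : 0 <= p <= 1 ->
  escape_prob p r (egraph_of e) = reach_prob p (val e) ord_max (far r (val e)).
Proof.
move=> p01; rewrite /escape_prob.
pose E (t : {set edge G}) := [exists x in far r (val e),
     reaches (open_edges t) (end_set (val e) ord_max) x].
have -> : [set w | escapes r (egraph_of e) w] = [set w | E (trace state_index w)].
  by apply/seteqP; split => w /escapes_finite.
rewrite (law_trace (percolationP p01) state_index_inj) /=.
rewrite -reach_prob_root; last exact: valP.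
have edgesE : [set val E | E in [set: edge G]%SET]%SET = edges G.
  apply/setP => z; apply/imsetP/idP => [[E' _ ->]|zG]; first exact: valP.
  by exists (exist _ z zG).
apply: etrans (congr1 (fun F => perc_exp p F _) edgesE).
by rewrite perc_exp_imset//; move=> ? ? _ _; exact: val_inj.
Qed.

End EscapeFinite.

(** * Percolation on the limit graph *)

Section ThetaLimit.
Variables (R : realType) (G1 : ograph).
Hypothesis nadj : ~~ link (edges G1) (src G1) (tgt G1).
Variables (d : measure_display) (Omega : measurableType d) (P : probability Omega R).
Variable X : {RV P >-> egraph_borel R}.
Hypothesis X_limit : bs_limit G1 X.
Variable p : R.
Hypothesis p01 : 0 <= p <= 1.

Let m : nat := #|edges G1|.

Lemma card_edges_gt0 (G : ograph) : (0 < #|edges G|)%N.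
Proof.
have [v] := ex_link (src G).
by case/orP => h; apply/card_gt0P; eexists; exact: h.
Qed.

Lemma measurable_escape_prob r :
  measurable_fun setT (escape_prob p r : egraph_borel R -> R).
Proof.
apply: (measurability _ (RGenOpens.measurableE R)).
move=> /= _ [A [a [b ->]] <-]; rewrite setTI.
apply: sub_sigma_algebra.
have /continuousP := @continuous_escape_prob R p p01 r; apply.
exact: interval_open.
Qed.

Let mean r := ('E_P[escape_prob p r \o X])%E.

Let average k r := (\sum_(e in edges (hier G1 k)) reach_prob p e ord_max (far r e)) /
  #|edges (hier G1 k)|%:R.

Lemma average_cvg r : (average k r)%:E @[k --> \oo] --> mean r.
Proof.
have -> : (fun k => (average k r)%:E) = (fun k =>
  ((\sum_(e : edge (hier G1 k)) escape_prob p r (egraph_of e)) /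
     #|edges (hier G1 k)|%:R)%:E).
  apply/funext => k; rewrite /average -sum_edge; congr (_ / _)%:E.
  by apply: eq_bigr => e _; rewrite escape_prob_finite.
apply: X_limit; first exact: continuous_escape_prob.
exists 1 => G; have /andP[e0 e1] := escape_prob_in01 p01 r G.
by rewrite ger0_norm.
Qed.

(** Dominated convergence, the escape probabilities being at most one. *)
Lemma mean_cvg : mean r @[r --> \oo] --> theta X p.
Proof.
rewrite /mean unlock /theta.
have mf r : measurable_fun setT (fun o => (escape_prob p r (X o))%:E : \bar R).
  by apply/measurable_EFinP; apply: measurableT_comp => //; exact: measurable_escape_prob.
have fcvg o : (escape_prob p r (X o))%:E @[r --> \oo] --> root_theta (X o) p.
  exact: escape_prob_cvg.
have mt : measurable_fun setT (fun o => root_theta (X o) p).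
  by apply: emeasurable_fun_cvg mf _ => o _; exact: fcvg.
have := @dominated_convergence _ _ _ P setT measurableT
  (fun r o => (escape_prob p r (X o))%:E) (fun o => root_theta (X o) p) (cst 1%E) mf mt.
case.
- by apply: aeW => o _; exact: fcvg.
- exact: finite_measure_integrable_cst.
- apply: aeW => o n _; rewrite /= lee_fin.
  by have /andP[e0 e1] := escape_prob_in01 p01 n (X o); rewrite ger0_norm.
by [].
Qed.

Lemma reach_prob_far_le (G : ograph) r s (e : vertex G * vertex G) j : (r <= s)%N ->
  reach_prob p e j (far s e) <= reach_prob p e j (far r e).
Proof.
move=> rs; apply: le_perc_prob => // w _ /existsP[x /andP[xs Sx]].
apply/existsP; exists x; rewrite Sx andbT; move: xs; rewrite !inE.
by apply: contra; exact: near_le.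
Qed.

(** To leave the ball of radius [radius n] the root edge must reach the boundary of
    its copy of [G_n]. *)
Lemma theta_le_level n :
  (theta X p <= ((\sum_i type_prod G1 p n i ord_max) / m%:R ^+ n)%:E)%E.
Proof.
have m0 : (0 < m%:R :> R) by rewrite ltr0n; exact: card_edges_gt0.
apply: cvge_le mean_cvg; exists (radius G1 n) => // r /= nr.
apply: cvge_le (average_cvg (r := r)); exists n => // k /= nk.
rewrite lee_fin /average card_edges_hier natrX.
have -> : k = ((k - n) + n)%N by rewrite subnK.
rewrite exprD invfM mulrA ler_wpM2r ?invr_ge0 ?exprn_ge0 ?ler0n//.
rewrite ler_pdivrMr ?exprn_gt0// mulrC.
apply: le_trans (sum_far_hier G1 (k - n) n ord_max p01).
by apply: ler_sum => e _; exact: reach_prob_far_le.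
Qed.

(** Reaching a distinguished vertex of [G_k] implies leaving the ball of radius [r]
    except for a fraction of the edges that vanishes as [k] grows. *)
Lemma theta_ge_level c n :
  (forall k, c <= (\sum_i type_prod G1 p (k + n) i ord_max) / m%:R ^+ (k + n)) ->
  (c%:E <= theta X p)%E.
Proof.
move=> hc; have m0 : (0 < m%:R :> R) by rewrite ltr0n; exact: card_edges_gt0.
apply: cvge_ge mean_cvg; apply: nearW => r.
apply/lee_addgt0Pr => eps eps0; rewrite -leeBlDr//= -EFinB.
pose q : R := m.-1%:R / m%:R.
have q01 : 0 <= q < 1.
  rewrite divr_ge0 ?ler0n//= ltr_pdivrMr// mul1r ltr_nat.
  by rewrite prednK //; exact: card_edges_gt0.
have [N Nq] : exists N, q ^+ N < eps.
  have /cvgrPdist_lt/(_ _ eps0)[N _ HN] : q ^+ n @[n --> \oo] --> (0 : R).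
    by apply: cvg_expr; rewrite ger0_norm//; case/andP: q01.
  exists N; have := HN N (leqnn N); rewrite sub0r normrN ger0_norm//.
  by rewrite exprn_ge0//; case/andP: q01.
apply: cvge_ge (average_cvg (r := r)); exists (N + r.+1 + n)%N => // k /= Nk.
rewrite lee_fin; have [k' kE Nk'] : exists2 k', k = (k' + r).+1 & (N <= k')%N.
  by exists (k - r.+1)%N; lia.
have bk : #|near_ends G1 k r|%:R / m%:R ^+ k <= q ^+ N.
  apply: (@le_trans _ _ (q ^+ k')); last first.
    by apply: ler_wiXn2l => //; case/andP: q01 => // _ /ltW.
  rewrite ler_pdivrMr ?exprn_gt0// kE.
  have -> : q ^+ k' * m%:R ^+ (k' + r).+1 = m%:R ^+ r.+1 * m.-1%:R ^+ k'.
    rewrite -addnS exprD mulrA -exprMn /q mulfVK ?gt_eqF//.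
    by rewrite mulrC.
  rewrite -!natrX -natrM ler_nat; apply: card_near_ends => //.
  exact: ltn_expl.
have := hc (k - n)%N; rewrite subnK; last by lia.
rewrite /average card_edges_hier natrX => ck.
apply: (@le_trans _ _ ((\sum_i type_prod G1 p k i ord_max - #|near_ends G1 k r|%:R) /
   m%:R ^+ k)); last first.
  by rewrite ler_wpM2r ?invr_ge0 ?exprn_ge0 ?ler0n//; exact: sum_far_hier_ge.
by rewrite mulrBl; lra.
Qed.

End ThetaLimit.

(** * The critical exponent *)

(** If [N] is the number of scales below the correlation length, then [z ^ N] is
    comparable with [1 / x], and [r ^ N] with a power of [x]. *)
Lemma pow_scale (R : realType) (z r x K : R) N : 1 < z -> 0 < r -> 0 < x -> 1 <= K ->
  z ^+ N * x <= K -> 1 <= K * (z ^+ N * x) ->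
  let beta := logb z r^-1 in let D := expR (`|beta| * ln K) in
  r ^+ N <= D * x `^ beta /\ x `^ beta <= D * r ^+ N.
Proof.
move=> z1 r0 x0 K1 zK Kz beta D.
have z0 : 0 < z := lt_trans ltr01 z1.
have lnz : 0 < ln z by exact: ln_gt0.
have K0 : 0 < K := lt_le_trans ltr01 K1.
have y0 : 0 < z ^+ N * x by rewrite mulr_gt0// exprn_gt0.
pose L := ln (z ^+ N * x).
have LE : L = ln z *+ N + ln x by rewrite /L lnM ?posrE ?exprn_gt0// lnXn.
have L1 : L <= ln K by rewrite ler_ln.
have L2 : - ln K <= L.
  by rewrite -subr_ge0 opprK addrC -lnM ?posrE//; exact: ln_ge0.
have bz : beta * ln z = - ln r by rewrite /beta /logb divfK ?gt_eqF// lnV ?posrE.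
have xb : x `^ beta = expR (beta * ln x) by rewrite /powR gt_eqF.
have rN : r ^+ N = expR (- (beta * (ln z *+ N))).
  by rewrite mulrnAr bz mulNrn opprK -lnXn// lnK// posrE exprn_gt0.
have bL : `|beta * L| <= `|beta| * ln K.
  by rewrite normrM ler_wpM2l// ler_norml L2 L1.
move: bL; rewrite ler_norml => /andP[b1 b2].
by split; rewrite /D xb rN -expRD ler_expR; move: b1 b2; rewrite LE mulrDr; lra.
Qed.

Theorem theorem8p1 (R : realType) (G1 : ograph)
  (dist_gt1 : (1 < gdist (src G1) (tgt G1))%N)
  (two_paths : edge_disjoint_paths (src G1) (tgt G1))
  (ps : R) (ps_in01 : 0 < ps < 1) (ps_fixed : crossing G1 ps = ps)
  (d : measure_display) (Omega : measurableType d) (P : probability Omega R)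
  (Ginf : {RV P >-> egraph_borel R}) (Ginf_limit : bs_limit G1 Ginf) :
  let zeta := (@crossing R G1)^`() ps in
  let d1 : R := (gdist (src G1) (tgt G1))%:R in
  let m1 : R := #|edges G1|%:R in
  let nu := logb zeta d1 in
  let df := largest_eigenvalue (cluster_matrix G1 ps) in
  let alpha1 := ln (m1 / df) / ln d1 in
  let beta := logb zeta (m1 / df) in
  beta = alpha1 * nu /\
  exists2 c : R, 0 < c &
    forall p : R, ps < p < 1 ->
      ((c^-1 * (p - ps) `^ beta)%:E <= theta Ginf p
        <= (c * (p - ps) `^ beta)%:E)%E.
Proof.
move=> zeta d1 m1 nu df alpha1 beta.
have nadj := gdist_gt1_nadj dist_gt1.
have [rho [A [b [K [[rho0 A0 b0 K1] dfE est]]]]] :=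
  scale_estimates nadj two_paths ps_in01 ps_fixed.
have zetaE : zeta = (event_poly R (edges G1) (@crossed G1))^`().[ps].
  by rewrite /zeta crossing_horner -derivE.
have zeta1 : 1 < zeta by rewrite zetaE; exact: deriv_fixpoint_gt1.
have m0 : 0 < m1 by rewrite ltr0n card_edges_gt0.
have [ps0 ps1] := andP ps_in01.
split.
  rewrite /beta /alpha1 /nu /logb mulrA divfK// gt_eqF// ln_gt0//.
  by rewrite ltr1n.
pose D := expR (`|beta| * ln K); have D0 : 0 < D := expR_gt0 _.
exists (A * D + D / b); first by apply: addr_gt0; [exact: mulr_gt0|exact: divr_gt0].
move=> p psp; have [N [up low z1 z2]] := est p psp.
have [pp p1] := andP psp.
have p01 : 0 <= p <= 1 by rewrite !ltW// (lt_trans ps0).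
have x0 : 0 < p - ps by rewrite subr_gt0.
have r0 : 0 < rho / m1 by rewrite divr_gt0.
have [] := pow_scale (N := N) zeta1 r0 x0 K1; rewrite ?zetaE//.
rewrite -zetaE invf_div -/m1 -dfE -/df -/beta -/D => rx xr.
have xb0 : 0 <= (p - ps) `^ beta := powR_ge0 _ _.
have rN0 : 0 < (df / m1) ^+ N by rewrite exprn_gt0// /df dfE.
have AD0 : 0 < A * D by rewrite mulr_gt0.
have Db0 : 0 < D / b by rewrite divr_gt0.
apply/andP; split.
  apply: (@le_trans _ _ (b * (df / m1) ^+ N)%:E).
    rewrite lee_fin; apply: (@le_trans _ _ ((D / b)^-1 * (p - ps) `^ beta)).
      by rewrite ler_wpM2r// lef_pV2 ?posrE ?addr_gt0// lerDr ltW.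
    rewrite invf_div mulrAC ler_pdivrMr// -mulrA ler_wpM2l ?(ltW b0)//.
    by rewrite mulrC.
  apply: (theta_ge_level nadj Ginf_limit p01 (n := N)) => k.
  rewrite ler_pdivlMr ?exprn_gt0//; apply: le_trans (low k).
  rewrite -dfE -/df exprMn exprVn exprD le_eqVlt; apply/orP; left; apply/eqP.
  have mN : m1 ^+ N != 0 by rewrite expf_neq0// gt_eqF.
  by field.
apply: le_trans (theta_le_level Ginf_limit p01 N) _.
rewrite lee_fin; apply: (@le_trans _ _ (A * (df / m1) ^+ N)).
  rewrite ler_pdivrMr ?exprn_gt0// exprMn exprVn -mulrA -[_ ^+ _ / _ * _]mulrA.
  by rewrite mulVf ?expf_neq0 ?gt_eqF// mulr1 /df dfE.
apply: (@le_trans _ _ (A * (D * (p - ps) `^ beta))).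
  by rewrite ler_wpM2l// ltW.
by rewrite mulrA ler_wpM2r// lerDl ltW.
Qed.
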